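(* Let $G_1,\ldots,G_{10}\subseteq\mathrm{GL}(3,\mathbb{C})$ be the ten matrix groups listed in the context and $X_0:=\mathbb{C}^3/G_k$. Then the divisor class group $\mathrm{Cl}(X_0)$ and the Cox ring $\mathcal{R}(X_0)$, as a $\mathrm{Cl}(X_0)$-graded algebra, are in the respective cases as follows, where $\mathcal{R}(X_0)\cong\mathbb{C}[T_1,T_2,T_3,T_4]/\langle f\rangle$ and the degree of $T_j$ is the $j$-th column of the degree matrix $Q_0$: $k=1$: $\mathrm{Cl}(X_0)=\mathbb{Z}/2\mathbb{Z}$, $Q_0=[\bar1\ \bar1\ \bar0\ \bar0]$, $f=4T_3^3-T_2^2-27T_4^2$. $k=2$: $\mathrm{Cl}(X_0)=(\mathbb{Z}/2\mathbb{Z})^2$, $Q_0=\begin{bmatrix}\bar1&\bar1&\bar0&\bar0\\\bar1&\bar0&\bar1&\bar0\end{bmatrix}$, $f=4T_1^2+T_2^2-T_4^2$. $k=3$: $\mathrm{Cl}(X_0)=(\mathbb{Z}/2\mathbb{Z})^2$, $Q_0=\begin{bmatrix}\bar1&\bar1&\bar0&\bar0\\\bar1&\bar0&\bar1&\bar0\end{bmatrix}$, $f=T_1^2-T_2^2+4T_3^2$. $k=4$: $\mathrm{Cl}(X_0)=(\mathbb{Z}/2\mathbb{Z})^2$, $Q_0=\begin{bmatrix}\bar1&\bar1&\bar1&\bar0\\\bar1&\bar0&\bar0&\bar1\end{bmatrix}$, $f=T_1^2-T_3^2+4T_4^2$. $k=5$: $\mathrm{Cl}(X_0)=\mathbb{Z}/2\mathbb{Z}$,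 $Q_0=[\bar1\ \bar1\ \bar0\ \bar0]$, $f=4T_3^5+T_2^2-T_4^2$. $k=6$: $\mathrm{Cl}(X_0)=(\mathbb{Z}/2\mathbb{Z})^2$, $Q_0=\begin{bmatrix}\bar1&\bar1&\bar0&\bar0\\\bar1&\bar0&\bar1&\bar0\end{bmatrix}$, $f=4T_4^3+T_1^2-T_2^2$. $k=7$: $\mathrm{Cl}(X_0)=\mathbb{Z}/3\mathbb{Z}$, $Q_0=[\bar0\ \bar0\ \bar2\ \bar1]$, $f=T_1^3+T_3^3-3T_1T_3T_4+T_4^3-27T_2^2$. $k=8$: $\mathrm{Cl}(X_0)=\mathbb{Z}/4\mathbb{Z}$, $Q_0=[\bar3\ \bar1\ \bar2\ \bar0]$, $f=4T_3^3+T_1^2-T_2^2$. $k=9$: $\mathrm{Cl}(X_0)=\mathbb{Z}/4\mathbb{Z}$, $Q_0=[\bar3\ \bar1\ \bar1\ \bar2]$, $f=4T_4^3+T_1^2-T_3^2$. $k=10$: $\mathrm{Cl}(X_0)=\mathbb{Z}/4\mathbb{Z}$, $Q_0=[\bar3\ \bar1\ \bar2\ \bar2]$, $f=4T_4^3+T_1^2-T_2^2$.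
   Context: The groups $G_k\subseteq\mathrm{GL}(3,\mathbb{C})$ are generated as follows; $i$ is the imaginary unit, $\zeta_k$ a primitive $k$-th root of unity, $\oplus$ denotes block-diagonal sum of matrices. Put $A=\begin{pmatrix}0&-1\\1&0\end{pmatrix}$, $B=\begin{pmatrix}0&1\\1&0\end{pmatrix}$, $C=\begin{pmatrix}0&-i\\-i&0\end{pmatrix}$, $D=\mathrm{diag}(-\zeta_3^2,-\zeta_3)$. $G_1\cong S_3$: $\begin{pmatrix}0&-1\\1&-1\end{pmatrix}\oplus(1)$, $\begin{pmatrix}-1&1\\0&1\end{pmatrix}\oplus(-1)$. $G_2\cong D_8$ (dihedral of order 8): $A\oplus(1)$, $\mathrm{diag}(1,-1,-1)$. $G_3\cong Q_8$ (quaternion group): $\mathrm{diag}(i,-i,1)$, $A\oplus(1)$. $G_4\cong Q_8$: $\mathrm{diag}(i,-i,-1)$, $A\oplus(1)$. $G_5\cong D_{10}$ (dihedral of order 10): $\mathrm{diag}(\zeta_5,\zeta_5^4,1)$, $B\oplus(-1)$. $G_6\cong D_{12}$ (dihedral of order 12): $D\oplus(1)$, $B\oplus(-1)$. $G_7\cong A_4$: $\begin{pmatrix}0&0&1\\1&0&0\\0&1&0\end{pmatrix}$, $\mathrm{diag}(-1,-1,1)$. $G_8\cong BD_3$ (binary dihedral of order 12): $D\oplus(1)$, $C\oplus(1)$. $G_9\cong BD_3$: $D\oplus(-1)$, $C\oplus(i)$. $G_{10}\cong BD_3$: $D\oplus(1)$, $C\oplus(-1)$. Cox ring: for a normal variety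 $X$ with $\Gamma(X,\mathcal{O}^* )=\mathbb{C}^*$ and finitely generated class group, $\mathcal{R}(X)=\bigoplus_{[D]\in\mathrm{Cl}(X)}\Gamma(X,\mathcal{O}(D))$. In the presence of torsion this is made precise as follows: choose a finitely generated group $K$ of Weil divisors mapping onto $\mathrm{Cl}(X)$ with kernel $K^0$ and a homomorphism $\chi\colon K^0\to\mathbb{C}(X)^*$ with $\mathrm{div}(\chi(E))=E$; then $\mathcal{R}(X)$ is the ring of global sections of $\bigoplus_{D\in K}\mathcal{O}(D)$ modulo the ideal sheaf generated by all $1-\chi(E)$, $E\in K^0$ ($\chi(E)$ in degree $-E$). *)

(* Defs.v *)
From HB Require Import structures.
From mathcomp Require Import all_boot all_order all_algebra.
From mathcomp Require Import boolp classical_sets functions.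
From mathcomp Require Import reals complex.
From mathcomp Require Import freeg mpoly.

Set Implicit Arguments.
Unset Strict Implicit.
Unset Printing Implicit Defensive.

Import Order.TTheory GRing.Theory Num.Theory.
Local Open Scope ring_scope.
Local Open Scope quotient_scope.

(* MathComp only equips R / I with a ring structure when I is proper; here    *)
(* the quotient is a possibly zero ring, so that no properness is presupposed. *)
HB.mixin Record isIdeal (R : comPzRingType) (I : R -> bool) := {
  ideal_mull_subproof : forall a u, u \in (I : {pred R}) -> a * u \in (I : {pred R})
}.

#[short(type="ideal")]
HB.structure Definition Ideal (R : comPzRingType) :=
  {I of GRing.ZmodClosed R I & isIdeal R I}.

Section QuotientRing.
Variables (R : comPzRingType) (I : ideal R).
Local Notation zquot := (@Quotient.quot R I).

Definition quot_ring := zquot.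
HB.instance Definition _ := GRing.Zmodule.on quot_ring.

Lemma quot_eqP (x y : R) : reflect (\pi_zquot x = \pi y) (x - y \in I).
Proof. by rewrite Quotient.idealrBE; apply: eqP. Qed.

Lemma ideal_mull (a u : R) : u \in I -> a * u \in I.
Proof. exact: ideal_mull_subproof. Qed.

Definition quot_one : quot_ring := \pi_zquot 1.
Definition quot_mul (x y : quot_ring) : quot_ring :=
  \pi_zquot (repr (x : zquot) * repr (y : zquot)).

Lemma quot_mulE (x y : R) : quot_mul (\pi_zquot x) (\pi_zquot y) = \pi_zquot (x * y).
Proof.
have h z : repr (\pi_zquot z) - z \in I by apply/quot_eqP; rewrite reprK.
apply/quot_eqP.
set x' := repr _; set y' := repr _.
have -> : x' * y' - x * y = y' * (x' - x) + x * (y' - y).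
  by rewrite !mulrBr [y' * x']mulrC [y' * x]mulrC addrA subrK.
by rewrite rpredD ?ideal_mull ?h.
Qed.

Lemma quot_piP (x : quot_ring) : exists y, x = \pi_zquot y.
Proof. by exists (repr (x : zquot)); rewrite reprK. Qed.

Lemma quot_mulA : associative quot_mul.
Proof.
move=> x y z; have [[x' ->] [y' ->] [z' ->]] := And3 (quot_piP x) (quot_piP y) (quot_piP z).
by rewrite !quot_mulE mulrA.
Qed.

Lemma quot_mulC : commutative quot_mul.
Proof. by move=> x y; rewrite /quot_mul mulrC. Qed.

Lemma quot_mul1 : left_id quot_one quot_mul.
Proof. by move=> x; have [x' ->] := quot_piP x; rewrite quot_mulE mul1r. Qed.

Lemma quot_mulDl : left_distributive quot_mul +%R.
Proof.
move=> x y z; have [[x' ->] [y' ->] [z' ->]] := And3 (quot_piP x) (quot_piP y) (quot_piP z).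
rewrite -(raddfD (\pi_zquot)) !quot_mulE mulrDl.
exact: (raddfD (\pi_zquot)).
Qed.

HB.instance Definition _ := GRing.Zmodule_isComPzRing.Build quot_ring
  quot_mulA quot_mulC quot_mul1 quot_mulDl.

Definition quot_pi (x : R) : quot_ring := \pi_zquot x.

Lemma quot_pi_zmod : zmod_morphism quot_pi.
Proof. exact: (raddfB (\pi_zquot)). Qed.

Lemma quot_pi_monoid : monoid_morphism quot_pi.
Proof. by split=> // x y; rewrite /quot_pi -quot_mulE. Qed.

HB.instance Definition _ := GRing.isZmodMorphism.Build R quot_ring quot_pi quot_pi_zmod.
HB.instance Definition _ := GRing.isMonoidMorphism.Build R quot_ring quot_pi quot_pi_monoid.
End QuotientRing.

Section PrincipalIdeal.
Variables (R : comPzRingType) (f : R).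

Definition principal_ideal : {pred R} := fun x => `[< exists q, x = q * f >].

Lemma principal_ideal_zmod : zmod_closed principal_ideal.
Proof.
split=> [|x y /asboolP[p ->] /asboolP[q ->]]; apply/asboolP.
  by exists 0; rewrite mul0r.
by exists (p - q); rewrite mulrBl.
Qed.

Lemma principal_ideal_mull a u :
  u \in principal_ideal -> a * u \in principal_ideal.
Proof. by move=> /asboolP[q ->]; apply/asboolP; exists (a * q); rewrite mulrA. Qed.

HB.instance Definition _ := GRing.isZmodClosed.Build R principal_ideal principal_ideal_zmod.
HB.instance Definition _ := isIdeal.Build R principal_ideal principal_ideal_mull.
End PrincipalIdeal.

Section GroupAlgebra.
Variables (F : fieldType) (K : zmodType).

Definition galg := {freeg K / F}.
HB.instance Definition _ := GRing.Lmodule.on galg.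

(* The elements of F[K] are the finite F-linear combinations of K. *)
Definition gmon (c : F) (k : K) : galg := << c *g k >>.

Definition galg_mul (g h : galg) : galg :=
  \sum_(k <- dom g) \sum_(l <- dom h) << coeff k g * coeff l h *g k + l >>.

Definition galg_one : galg := << 1 *g 0 >>.

Lemma fgliftE (M : lmodType F) (f : K -> M) (g : {freeg K / F}) :
  fglift f g = \sum_(k <- dom g) coeff k g *: f k.
Proof.
pose L := GRing.isZmodMorphism.Build _ _ _ (lift_is_additive f).
pose Lf : {additive {freeg K / F} -> M} := HB.pack (fglift f) L.
rewrite -{1}[g]freeg_sumE -[LHS]/(Lf _) raddf_sum.
by apply: eq_bigr => k _; rewrite /= liftU.
Qed.

Lemma fgscaleU (c d : F) (k : K) :
  c *: << d *g k >> = << c * d *g k >> :> {freeg K / F}.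
Proof. by apply/eqP/freeg_eqP => x; rewrite coeffZ !coeffU mulrA. Qed.

Lemma galg_mulE g h : galg_mul g h =
  fglift (fun k => fglift (fun l => << 1 *g k + l >> : galg) h) g.
Proof.
rewrite fgliftE; apply: eq_bigr => k _; rewrite fgliftE scaler_sumr.
by apply: eq_bigr => l _; rewrite !fgscaleU mulr1.
Qed.

Lemma galg_mulC : commutative galg_mul.
Proof.
move=> g h; rewrite /galg_mul exchange_big /=; apply: eq_bigr => l _.
by apply: eq_bigr => k _; rewrite mulrC addrC.
Qed.

Lemma galg_mulBl g g' h : galg_mul (g - g') h = galg_mul g h - galg_mul g' h.
Proof. by rewrite !galg_mulE lift_is_additive. Qed.

Lemma galg_mul0l h : galg_mul 0 h = 0.
Proof. by have := galg_mulBl 0 0 h; rewrite !subrr. Qed.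

Lemma galg_mulDl : left_distributive galg_mul +%R.
Proof.
move=> g g' h; rewrite -[g']opprK galg_mulBl -[- g']sub0r galg_mulBl galg_mul0l.
by rewrite sub0r opprK opprB subr0.
Qed.

Lemma galg_mul_suml (I : Type) (r : seq I) (G : I -> galg) h :
  galg_mul (\sum_(i <- r) G i) h = \sum_(i <- r) galg_mul (G i) h.
Proof.
by rewrite (big_morph (galg_mul^~ h) (fun x y => galg_mulDl x y h) (galg_mul0l h)).
Qed.

Lemma galg_mul_sumr (I : Type) (r : seq I) (G : I -> galg) h :
  galg_mul h (\sum_(i <- r) G i) = \sum_(i <- r) galg_mul h (G i).
Proof.
by rewrite galg_mulC galg_mul_suml; apply: eq_bigr => i _; rewrite galg_mulC.
Qed.

Lemma galg_mulUU (c d : F) (k l : K) :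
  galg_mul << c *g k >> << d *g l >> = << c * d *g k + l >>.
Proof. by rewrite galg_mulE !liftU !fgscaleU mulr1. Qed.

Lemma galg_sumP (g : galg) :
  exists r : seq (F * K), g = \sum_(x <- r) (<< x.1 *g x.2 >> : galg).
Proof.
by exists [seq (coeff k g, k) | k <- dom g]; rewrite big_map freeg_sumE.
Qed.

Lemma galg_mulA : associative galg_mul.
Proof.
move=> g h p; have [[r ->] [s ->] [t ->]] := And3 (galg_sumP g) (galg_sumP h) (galg_sumP p).
rewrite (galg_mul_suml r) (galg_mul_suml r (fun x => << x.1 *g x.2 >>)).
rewrite (galg_mul_suml r); apply: eq_bigr => x _.
rewrite (galg_mul_suml s) (galg_mul_sumr s _ << _ *g _ >>).
rewrite (galg_mul_sumr s (fun y => << y.1 *g y.2 >>)) (galg_mul_suml s).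
apply: eq_bigr => y _; rewrite !(galg_mul_sumr t); apply: eq_bigr => z _.
by rewrite !galg_mulUU mulrA addrA.
Qed.

Lemma galg_mul1 : left_id galg_one galg_mul.
Proof.
move=> g; have [r ->] := galg_sumP g; rewrite (galg_mul_sumr r).
by apply: eq_bigr => x _; rewrite galg_mulUU mul1r add0r.
Qed.

HB.instance Definition _ := GRing.Zmodule_isComPzRing.Build galg
  galg_mulA galg_mulC galg_mul1 galg_mulDl.
End GroupAlgebra.

(* Weil divisors and the Cox ring of the affine variety X = Spec A. A point   *)
(* of X is a prime ideal, and the principal open set D(a) consists of the     *)
(* points not containing a.                                                   *)
Section CoxRing.
Variable A : idomainType.
Local Notation F := {fraction A}.
Local Notation "a %:F" := (@tofrac A a).

(* MathComp's type prime_idealr A lives in too large a universe to index the  *)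
(* free abelian group of divisors.                                            *)
Record point := Point {
  pt_pred : A -> bool;
  pt_ideal : idealr_closed pt_pred;
  pt_prime : prime_idealr_closed pt_pred
}.
Definition pt_mem (P : point) : {pred A} := pt_pred P.
Coercion pt_mem : point >-> pred_sort.

Definition height_one (P : point) : Prop :=
  (exists2 a, a \in P & a != 0) /\
  (forall Q : point, {subset Q <= P} -> (exists2 a, a \in Q & a != 0) ->
     {subset P <= Q}).

Record primeDiv := PrimeDiv {pd_point :> point; _ : height_one pd_point}.
HB.instance Definition _ := gen_eqMixin primeDiv.
HB.instance Definition _ := gen_choiceMixin primeDiv.

Definition local_ring (P : point) : set F :=
  fun f => exists a s, s \notin P /\ f = a%:F / s%:F.

(* v is the normalized discrete valuation with valuation ring A_P; only its   *)
(* values on nonzero arguments are meaningful.                                *)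
Definition valuation_at (P : point) (v : F -> int) : Prop :=
  [/\ forall f g, f != 0 -> g != 0 -> v (f * g) = v f + v g,
      exists2 f, f != 0 & v f = 1
    & forall f, f != 0 -> 0 <= v f <-> local_ring P f].

(* If X is normal, ord P is the vanishing order along P; the default value of *)
(* xget only occurs when A_P is not a discrete valuation ring.                *)
Definition ord (P : primeDiv) : F -> int :=
  xget (fun=> 0) (valuation_at P).

Definition WDiv := {freeg primeDiv / int}.
HB.instance Definition _ := GRing.Zmodule.on WDiv.

Definition div_of (f : F) (D : WDiv) : Prop :=
  f != 0 /\ forall P : primeDiv, coeff P D = ord P f.

Definition principal : {pred WDiv} := fun D => `[< exists f, div_of f D >].

Lemma ordM (P : primeDiv) f g : f != 0 -> g != 0 ->
  ord P (f * g) = ord P f + ord P g.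
Proof.
by rewrite /ord; case: xgetP => [v _ [vM _ _]|_ *]; [exact: vM | rewrite addr0].
Qed.

Lemma ord1 (P : primeDiv) : ord P 1 = 0.
Proof.
have := ordM P (oner_neq0 F) (oner_neq0 F); rewrite mulr1 => /eqP.
by rewrite -subr_eq0 opprD addrA subrr add0r oppr_eq0 => /eqP.
Qed.

Lemma ordV (P : primeDiv) f : f != 0 -> ord P f^-1 = - ord P f.
Proof.
move=> f0; have V0 : f^-1 != 0 by rewrite invr_eq0.
have := ordM P V0 f0; rewrite mulVf // ord1 => /esym/eqP.
by rewrite addr_eq0 => /eqP.
Qed.

Lemma principal_zmod : zmod_closed principal.
Proof.
split=> [|D E /asboolP[f [f0 fD]] /asboolP[g [g0 gE]]]; apply/asboolP.
  by exists 1; split=> [|P]; rewrite ?oner_neq0 // ord1 coeff0.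
exists (f / g); split=> [|P]; first by rewrite mulf_neq0 ?invr_eq0.
by rewrite coeffB fD gE ordM ?invr_eq0 // ordV.
Qed.

HB.instance Definition _ := GRing.isZmodClosed.Build WDiv principal principal_zmod.

Definition Cl := {ideal_quot principal}.
HB.instance Definition _ := GRing.Zmodule.on Cl.
Definition cl (D : WDiv) : Cl := \pi_{ideal_quot principal} D.

(* Sections of O(D) over the open set U; zero is a section of every O(D). *)
Definition sheafO (U : set point) (D : WDiv) : set F :=
  fun f => f != 0 -> forall P : primeDiv, U P -> 0 <= ord P f + coeff P D.

(* The kernel K^0 of K -> Cl(X) consists of the principal divisors in K; only  *)
(* the values of chi on K^0 are meaningful.                                   *)
Record cox_data := CoxData {
  cox_grp : zmodClosed WDiv;
  cox_grp_fg : exists s : seq WDiv,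
    [/\ {subset s <= cox_grp}
      & forall D, D \in cox_grp ->
          exists c : 'I_(size s) -> int, D = \sum_(i < size s) s`_i *~ c i];
  cox_grp_onto : forall D, exists2 E, E \in cox_grp & cl E = cl D;
  chi : WDiv -> F;
  chi_div : forall E, E \in cox_grp -> E \in principal -> div_of (chi E) E;
  chiD : forall E E', E \in cox_grp -> E \in principal ->
    E' \in cox_grp -> E' \in principal -> chi (E + E') = chi E * chi E'
}.

Variable cd : cox_data.
Local Notation K := (cox_grp cd).
Local Notation FK := (galg F WDiv).

(* Sections over U of the sheaf of K-graded algebras S, the direct sum of the *)
(* O(D), D in K; the component of degree D is the coefficient at D.           *)
Definition sectS (U : set point) : set FK :=
  fun s => {subset dom s <= K} /\ forall D, sheafO U D (coeff D s).

Definition popen (a : A) : set point := fun Q => a \notin Q.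

Definition stalkS (Q : point) : set FK :=
  fun s => exists2 a, popen a Q & sectS (popen a) s.

(* The stalk at Q of the ideal sheaf generated by the 1 - chi(E). *)
Definition stalkI (Q : point) : set FK :=
  fun s => exists l : seq (FK * WDiv),
    (forall p, p \in l -> [/\ stalkS Q p.1, p.2 \in K & p.2 \in principal]) /\
    s = \sum_(p <- l) p.1 * (1 - gmon (chi cd p.2) (- p.2)).

(* Sections of S / I over X are, modulo the families vanishing in every stalk *)
(* of S / I, the families of germs that are locally induced by sections of S. *)
(* B restricts the degrees of these local sections.                           *)
Definition local_sect (B : set WDiv) (s : point -> FK) : Prop :=
  forall Q, exists2 a, popen a Q &
    exists t, [/\ sectS (popen a) t, forall D, D \in dom t -> B D
                & forall Q', popen a Q' -> stalkI Q' (s Q' - t)].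

Definition cox_sect : {pred point -> FK} := fun s => `[< local_sect setT s >].

Lemma local_ring_leD (P : primeDiv) v f g : valuation_at P v ->
  f != 0 -> g != 0 -> f + g != 0 -> v f <= v g -> v f <= v (f + g).
Proof.
move=> [vM _ vA] f0 g0 fg0 le_fg.
have v1 : v 1 = 0.
  have := vM 1 1 (oner_neq0 F) (oner_neq0 F); rewrite mulr1 => /eqP.
  by rewrite -subr_eq0 opprD addrA subrr add0r oppr_eq0 => /eqP.
have fV0 : f^-1 != 0 by rewrite invr_eq0.
have vV : v f^-1 = - v f.
  have := vM f^-1 f fV0 f0; rewrite (mulVf f0) v1 => /esym/eqP.
  by rewrite addr_eq0 => /eqP.
have gf0 : g / f != 0 := mulf_neq0 g0 fV0.
have : local_ring P (g / f).
  by apply/(vA _ gf0); rewrite (vM _ _ g0 fV0) vV subr_ge0.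
move=> [a [s [sP gfE]]].
have e : f + g = f * (1 + g / f) by rewrite mulrDr mulr1 mulrCA (mulfV f0) mulr1.
have h0 : 1 + g / f != 0 by apply: contra_neq fg0 => h; rewrite e h mulr0.
rewrite e (vM _ _ f0 h0) lerDl; apply/(vA _ h0); exists (s + a), s.
split; first exact: sP.
have s0 : s%:F != 0.
  by rewrite tofrac_eq0; apply: contraNneq sP => ->; have [] := pt_ideal P.
by rewrite gfE tofracD mulrDl (mulfV s0).
Qed.

Lemma ord_leD (P : primeDiv) f g : f != 0 -> g != 0 -> f + g != 0 ->
  ord P f <= ord P g -> ord P f <= ord P (f + g).
Proof.
rewrite /ord; case: xgetP => [v _ vP|//]; exact: local_ring_leD vP.
Qed.

Lemma ord_leDmin (P : primeDiv) f g m : f != 0 -> g != 0 -> f + g != 0 ->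
  m <= ord P f -> m <= ord P g -> m <= ord P (f + g).
Proof.
move=> f0 g0 fg0 mf mg; case/orP: (le_total (ord P f) (ord P g)) => h.
  exact: le_trans mf (ord_leD f0 g0 fg0 h).
by rewrite addrC in fg0 *; apply: le_trans mg (ord_leD g0 f0 fg0 h).
Qed.

Lemma ord_int (P : primeDiv) a : a != 0 -> 0 <= ord P a%:F.
Proof.
move=> a0; rewrite /ord; case: xgetP => [v _ [_ _ vA]|//]; apply/vA.
  by rewrite tofrac_eq0.
by exists a, 1; rewrite tofrac1 divr1; have [] := pt_ideal P.
Qed.

Lemma ordN (P : primeDiv) f : f != 0 -> ord P (- f) = ord P f.
Proof.
move=> f0; rewrite -mulN1r ordM ?oppr_eq0 ?oner_neq0 //.
suff -> : ord P (-1) = 0 by rewrite add0r.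
have h : -1 != 0 :> F by rewrite oppr_eq0 oner_neq0.
have := ordM P h h; rewrite mulrNN mulr1 ord1 => /esym/eqP.
by rewrite -mulr2n mulrn_eq0 /= => /eqP.
Qed.

Lemma sheafO0 U D : sheafO U D 0.
Proof. by rewrite /sheafO eqxx. Qed.

Lemma sheafOB U D f g : sheafO U D f -> sheafO U D g -> sheafO U D (f - g).
Proof.
move=> hf hg; have [->|f0] := eqVneq f 0.
  by rewrite sub0r => g0 P UP; rewrite oppr_eq0 in g0; rewrite ordN // hg.
have [->|g0] := eqVneq g 0; first by rewrite subr0.
have gN0 : - g != 0 by rewrite oppr_eq0.
move=> fg0 P UP; rewrite -lerBlDr sub0r; apply: (ord_leDmin f0 gN0 fg0).
  by rewrite -subr_ge0 opprK; apply: hf f0 P UP.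
by rewrite (ordN P g0) -subr_ge0 opprK; apply: hg g0 P UP.
Qed.

Lemma sheafO_sum U D (I : eqType) (r : seq I) (G : I -> F) :
  (forall i, i \in r -> sheafO U D (G i)) -> sheafO U D (\sum_(i <- r) G i).
Proof.
move=> hG; rewrite big_seq; apply: (big_ind (sheafO U D)) hG.
  exact: sheafO0.
move=> f g hf hg; have := sheafOB hf (sheafOB (@sheafO0 U D) hg).
by rewrite sub0r opprK.
Qed.

Lemma sheafOM U D E f g :
  sheafO U D f -> sheafO U E g -> sheafO U (D + E) (f * g).
Proof.
move=> hf hg; rewrite /sheafO mulf_eq0 negb_or => /andP[f0 g0] P UP.
rewrite (ordM P f0 g0) coeffD addrACA.
exact: addr_ge0 (hf f0 P UP) (hg g0 P UP).
Qed.

Lemma sheafO_sub U V D f : (forall P, V P -> U P) ->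
  sheafO U D f -> sheafO V D f.
Proof. by move=> VU hf f0 P /VU; apply: hf. Qed.

Lemma popen1 Q : popen 1 Q.
Proof. by have [] := pt_ideal Q. Qed.

Lemma popenM a b Q : popen (a * b) Q <-> popen a Q /\ popen b Q.
Proof.
have [Q0 _ QM] := pt_ideal Q; have QMl c d : d \in Q -> c * d \in Q.
  by move=> dQ; rewrite -[c * d]addr0; apply: QM.
rewrite /popen; split=> [abQ|[aQ bQ]].
  split; apply: contra abQ => h; last exact: QMl.
  by rewrite mulrC; apply: QMl.
by apply/negP => /(@pt_prime Q)/orP[h|h]; [rewrite h in aQ|rewrite h in bQ].
Qed.

Lemma sectS_sub (U V : set point) s : (forall P, V P -> U P) ->
  sectS U s -> sectS V s.
Proof. by move=> VU [sK hs]; split=> // D; apply: sheafO_sub (hs D). Qed.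

Lemma sectSU U c D : D \in K -> sheafO U D c -> sectS U (gmon c D).
Proof.
move=> DK hc; split=> [E|E].
  by rewrite mem_dom coeffU; have [<-//|_] := eqVneq D E; rewrite mulr0 eqxx.
rewrite coeffU; have [<-|_] := eqVneq D E; rewrite ?mulr1 ?mulr0 //.
exact: sheafO0.
Qed.

Lemma sectS0 U : sectS U 0.
Proof.
by split=> [D|D]; rewrite ?mem_dom coeff0 ?eqxx //; apply: sheafO0.
Qed.

Lemma sectSB U s t : sectS U s -> sectS U t -> sectS U (s - t).
Proof.
move=> [sK hs] [tK ht]; split=> [D|D].
  by move=> /domB; rewrite mem_cat => /orP[/sK|/tK].
by rewrite coeffB; apply: sheafOB.
Qed.

Lemma sectSD U s t : sectS U s -> sectS U t -> sectS U (s + t).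
Proof.
move=> hs ht; have := sectSB hs (sectSB (sectS0 U) ht).
by rewrite sub0r opprK.
Qed.

Lemma sectS_sum U (I : eqType) (r : seq I) (G : I -> FK) :
  (forall i, i \in r -> sectS U (G i)) -> sectS U (\sum_(i <- r) G i).
Proof.
move=> hG; rewrite big_seq; apply: (big_ind (sectS U)) hG.
  exact: sectS0.
exact: sectSD.
Qed.

Lemma sectS1 U : sectS U 1.
Proof.
apply: sectSU; first exact: rpred0.
by move=> _ P _; rewrite ord1 coeff0.
Qed.

Lemma sectSM U s t : sectS U s -> sectS U t -> sectS U (s * t).
Proof.
move=> [sK hs] [tK ht]; apply: sectS_sum => D /sK DK.
apply: sectS_sum => E /tK EK; apply: sectSU; first exact: rpredD.
exact: sheafOM.
Qed.

Lemma stalkS_sect a Q s : popen a Q -> sectS (popen a) s -> stalkS Q s.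
Proof. by exists a. Qed.

Lemma stalkS2 (op : FK -> FK -> FK) Q s t :
  (forall U s t, sectS U s -> sectS U t -> sectS U (op s t)) ->
  stalkS Q s -> stalkS Q t -> stalkS Q (op s t).
Proof.
move=> hop [a aQ hs] [b bQ ht]; exists (a * b); first by apply/popenM.
by apply: hop; [apply: sectS_sub hs|apply: sectS_sub ht] => P /popenM[].
Qed.

Lemma stalkS_gen Q E : E \in K -> E \in principal ->
  stalkS Q (1 - gmon (chi cd E) (- E)).
Proof.
move=> EK Epr; exists 1; first exact: popen1.
apply: sectSB; first exact: sectS1.
apply: sectSU; first by rewrite rpredN.
by move=> c0 P _; have [_ e] := chi_div EK Epr; rewrite coeffN e subrr.
Qed.

Lemma stalkS_sum Q (I : eqType) (r : seq I) (G : I -> FK) :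
  (forall i, i \in r -> stalkS Q (G i)) -> stalkS Q (\sum_(i <- r) G i).
Proof.
move=> hG; rewrite big_seq; apply: (big_ind (stalkS Q)) hG.
  by exists 1; [apply: popen1|apply: sectS0].
by move=> s t; apply: stalkS2; apply: sectSD.
Qed.

Lemma stalkI_S Q s : stalkI Q s -> stalkS Q s.
Proof.
move=> [l [hl ->]]; apply: stalkS_sum => p /hl[h1 h2 h3].
exact: (stalkS2 (@sectSM) h1 (stalkS_gen Q h2 h3)).
Qed.

Lemma stalkI0 Q : stalkI Q 0.
Proof. by exists [::]; split=> //; rewrite big_nil. Qed.

Lemma stalkID Q s t : stalkI Q s -> stalkI Q t -> stalkI Q (s + t).
Proof.
move=> [l [hl ->]] [m [hm ->]]; exists (l ++ m); rewrite big_cat; split=> //.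
by move=> p; rewrite mem_cat => /orP[/hl|/hm].
Qed.

Lemma stalkIM Q s t : stalkS Q s -> stalkI Q t -> stalkI Q (s * t).
Proof.
move=> hs [l [hl ->]]; exists [seq (s * p.1, p.2) | p <- l]; split.
  move=> _ /mapP[p /hl[h1 h2 h3] ->].
  by split; [exact: (stalkS2 (@sectSM) hs h1)|exact: h2|exact: h3].
by rewrite big_map mulr_sumr; apply: eq_bigr => p _; rewrite mulrA.
Qed.

Lemma stalkIN Q s : stalkI Q s -> stalkI Q (- s).
Proof.
rewrite -mulN1r; apply: stalkIM; exists 1; first exact: popen1.
by rewrite -sub0r; apply: sectSB; [apply: sectS0|apply: sectS1].
Qed.

Lemma local_sect_stalk B s Q : local_sect B s -> stalkS Q (s Q).
Proof.
move=> /(_ Q)[a aQ [t [tS _ /(_ Q aQ)/stalkI_S h]]].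
rewrite -[s Q](subrK t).
exact: (stalkS2 (@sectSD) h (stalkS_sect aQ tS)).
Qed.

Lemma cox_sect_subring : subring_closed cox_sect.
Proof.
have two (s t : point -> FK) op : local_sect setT s -> local_sect setT t ->
  (forall U x y, sectS U x -> sectS U y -> sectS U (op x y)) ->
  (forall Q x y x' y', stalkS Q x -> stalkS Q y' -> stalkI Q (x - x') ->
     stalkI Q (y - y') -> stalkI Q (op x y - op x' y')) ->
  local_sect setT (fun Q => op (s Q) (t Q)).
  move=> hs ht opS opI Q; have [a aQ [x [xS _ sx]]] := hs Q.
  have [b bQ [y [yS _ ty]]] := ht Q.
  exists (a * b); first by apply/popenM.
  exists (op x y); split; last 1 first.
  - move=> Q' /popenM[aQ' bQ']; apply: opI (sx _ aQ') (ty _ bQ').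
      exact: local_sect_stalk hs.
    exact: stalkS_sect yS.
  - by apply: opS; [apply: sectS_sub xS|apply: sectS_sub yS] => P /popenM[].
  - by [].
split=> [|s t /asboolP hs /asboolP ht|s t /asboolP hs /asboolP ht]; apply/asboolP.
- move=> Q; exists 1; first exact: popen1.
  exists 1; split; [exact: sectS1|by []|move=> Q' _].
  by rewrite subrr; apply: stalkI0.
- apply: (two s t (fun x y => x - y) hs ht) => [U x y|Q x y x' y' _ _ hx hy].
    exact: sectSB.
  have -> : x - y - (x' - y') = (x - x') - (y - y') by rewrite !opprD addrACA.
  exact: stalkID hx (stalkIN hy).
- apply: (two s t (fun x y => x * y) hs ht) => [U x y|Q x y x' y' hx hy' hxx hyy].
    exact: sectSM.
  have -> : x * y - x' * y' = x * (y - y') + y' * (x - x').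
    by rewrite !mulrBr [y' * x]mulrC [y' * x']mulrC addrA subrK.
  exact: stalkID (stalkIM hx hyy) (stalkIM hy' hxx).
Qed.

HB.instance Definition _ := GRing.isSubringClosed.Build (point -> FK) cox_sect
  cox_sect_subring.

Record cox_family := CoxFamily {cox_germ :> point -> FK; _ : cox_germ \in cox_sect}.
HB.instance Definition _ := [isSub for cox_germ].
HB.instance Definition _ := [Choice of cox_family by <:].
HB.instance Definition _ :=
  GRing.SubChoice_isSubComPzRing.Build _ _ cox_family cox_sect_subring.

Definition cox_null : {pred cox_family} :=
  fun s => `[< forall Q, stalkI Q (cox_germ s Q) >].

Lemma cox_null_zmod : zmod_closed cox_null.
Proof.
split=> [|s t /asboolP hs /asboolP ht]; apply/asboolP => Q.
  exact: stalkI0.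
exact: stalkID (hs Q) (stalkIN (ht Q)).
Qed.

Lemma cox_null_mull s t : t \in cox_null -> s * t \in cox_null.
Proof.
move=> /asboolP ht; apply/asboolP => Q.
have -> : cox_germ (s * t) Q = cox_germ s Q * cox_germ t Q by [].
apply: stalkIM (ht Q); have /asboolP := valP s; exact: local_sect_stalk.
Qed.

HB.instance Definition _ := GRing.isZmodClosed.Build cox_family cox_null cox_null_zmod.
HB.instance Definition _ := isIdeal.Build cox_family cox_null cox_null_mull.

Definition cox_ring := quot_ring cox_null.
HB.instance Definition _ := GRing.ComPzRing.on cox_ring.

Definition cox_degree (w : Cl) : set cox_ring :=
  fun x => exists2 s, local_sect (fun D => cl D = w) (cox_germ s)
                    & x = quot_pi cox_null s.

Lemma cox_const_sect a : (fun=> gmon a%:F 0 : FK) \in cox_sect.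
Proof.
apply/asboolP => Q; exists 1; first exact: popen1.
exists (gmon a%:F 0); split; [|by []|by move=> Q' _; rewrite subrr; apply: stalkI0].
apply: sectSU; first exact: rpred0.
by rewrite /sheafO tofrac_eq0 => a0 P _; rewrite coeff0 addr0 ord_int.
Qed.

Definition cox_const (a : A) : cox_ring := quot_pi cox_null (CoxFamily (cox_const_sect a)).
End CoxRing.

Section GradedIsomorphism.
Variables (k : fieldType) (A : idomainType) (iota : k -> A).
Variables (n : nat) (M : zmodType) (deg : 'I_n -> M) (f : {mpoly k[n]}).
Local Notation I := (principal_ideal f).

Definition mnm_weight (m : 'X_{1..n}) : M := \sum_(j < n) deg j *+ m j.

Definition quot_degree (w : M) : set (quot_ring I) :=
  fun x => exists2 p : {mpoly k[n]},
    (forall m, m \in msupp p -> mnm_weight m = w) & x = quot_pi I p.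

(* X = Spec A, a k-variety through iota, has class group M and, whatever the  *)
(* choice of K and chi, its Cox ring is isomorphic to k[T] / <f> as a graded  *)
(* k-algebra.                                                                 *)
Definition class_group_and_cox_ring : Prop :=
  exists2 phi : {additive Cl A -> M}, bijective phi &
    inhabited (cox_data A) /\
    forall cd : cox_data A,
      exists psi : {rmorphism cox_ring cd -> quot_ring I},
        [/\ bijective psi,
            forall c, psi (cox_const cd (iota c)) = quot_pi I c%:MP
          & forall w x, cox_degree w x <-> quot_degree (phi w) (psi x)].
End GradedIsomorphism.

Section Invariants.
Variables (C : fieldType) (n : nat).

Inductive gen_group (S : seq 'M[C]_n) : set 'M[C]_n :=
| Gen1 : gen_group S 1%:M
| GenM g h : gen_group S g -> h \in S -> gen_group S (g *m h)
| GenV g h : gen_group S g -> h \in S -> gen_group S (g *m invmx h).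

Definition lin_subst (g : 'M[C]_n) : n.-tuple {mpoly C[n]} :=
  [tuple \sum_(j < n) g i j *: 'X_j | i < n].

(* f \mPo lin_subst g is the polynomial function v |-> f (g v). *)
Definition invariant (G : set 'M[C]_n) : {pred {mpoly C[n]}} :=
  fun f => `[< forall g, G g -> f \mPo lin_subst g = f >].

Lemma invariant_divring G : divring_closed (invariant G).
Proof.
split=> [|p q /asboolP hp /asboolP hq|p q /asboolP hp /asboolP hq]; apply/asboolP => g Gg.
- exact: comp_mpoly1.
- by rewrite comp_mpolyB hp ?hq.
- rewrite rmorphM /= hp //; congr (_ * _).
  have [uq|nuq] := boolP (q \is a GRing.unit); last by rewrite invr_out ?hq.
  by rewrite rmorphV //= hq.
Qed.

HB.instance Definition _ G := GRing.isDivringClosed.Build {mpoly C[n]} (invariant G)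
  (invariant_divring G).

(* The coordinate ring of C^n / G. *)
Record inv_ring (G : set 'M[C]_n) :=
  InvRing {inv_val :> {mpoly C[n]}; _ : inv_val \in invariant G}.

Section InvRing.
Variable G : set 'M[C]_n.
HB.instance Definition _ := [isSub for @inv_val G].
HB.instance Definition _ := [Choice of inv_ring G by <:].
HB.instance Definition _ :=
  GRing.SubChoice_isSubIntegralDomain.Build _ _ (inv_ring G) (invariant_divring G).

Lemma inv_const_subproof c : c%:MP \in invariant G.
Proof. by apply/asboolP => g _; apply: comp_mpolyC. Qed.

Definition inv_const c : inv_ring G := InvRing (inv_const_subproof c).
End InvRing.
End Invariants.

Definition seqmx (R : nmodType) (m n : nat) (s : seq (seq R)) : 'M[R]_(m, n) :=
  \matrix_(i, j) nth 0 (nth [::] s i) j.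

Section Groups.
Variables (C : numClosedFieldType) (zeta3 zeta5 : C).

Definition osum (g : 'M[C]_2) (c : C) : 'M[C]_3 := block_mx g 0 0 (c%:M : 'M_1).
Definition diag2 (a b : C) : 'M[C]_2 := seqmx 2 2 [:: [:: a; 0]; [:: 0; b]].

Definition mxA : 'M[C]_2 := seqmx 2 2 [:: [:: 0; -1]; [:: 1; 0]].
Definition mxB : 'M[C]_2 := seqmx 2 2 [:: [:: 0; 1]; [:: 1; 0]].
Definition mxC : 'M[C]_2 := seqmx 2 2 [:: [:: 0; - 'i]; [:: - 'i; 0]].
Definition mxD : 'M[C]_2 := diag2 (- zeta3 ^+ 2) (- zeta3).

Definition gensG1 := [:: osum (seqmx 2 2 [:: [:: 0; -1]; [:: 1; -1]]) 1;
                         osum (seqmx 2 2 [:: [:: -1; 1]; [:: 0; 1]]) (-1)].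
Definition gensG2 := [:: osum mxA 1; osum (diag2 1 (-1)) (-1)].
Definition gensG3 := [:: osum (diag2 'i (- 'i)) 1; osum mxA 1].
Definition gensG4 := [:: osum (diag2 'i (- 'i)) (-1); osum mxA 1].
Definition gensG5 := [:: osum (diag2 zeta5 (zeta5 ^+ 4)) 1; osum mxB (-1)].
Definition gensG6 := [:: osum mxD 1; osum mxB (-1)].
Definition gensG7 : seq 'M[C]_3 :=
  [:: seqmx 3 3 [:: [:: 0; 0; 1]; [:: 1; 0; 0]; [:: 0; 1; 0]];
      osum (diag2 (-1) (-1)) 1].
Definition gensG8 := [:: osum mxD 1; osum mxC 1].
Definition gensG9 := [:: osum mxD (-1); osum mxC 'i].
Definition gensG10 := [:: osum mxD 1; osum mxC (-1)].
End Groups.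

(* The j-th of the four variables, counted from 1. *)
Definition T_ {C : fieldType} (j : nat) : {mpoly C[4]} := 'X_(inord j.-1).
Arguments T_ {C} j%_N.

(* X_0 = C^3 / <S> has class group (Z/m)^r, realized as column vectors, and   *)
(* Cox ring C[T_1, .., T_4] / <f>, the degree of T_j being column j of Q.     *)
Definition cl_cox_quotient {C : fieldType} (S : seq 'M[C]_3) (m r : nat)
    (Q : seq (seq 'Z_m)) (f : {mpoly C[4]}) : Prop :=
  class_group_and_cox_ring (@inv_const C 3 (gen_group S))
    (fun j => col j (seqmx r 4 Q)) f.
Arguments cl_cox_quotient {C} S%_seq_scope (m r)%_N Q%_seq_scope f%_R.

(* Main.v *)
(** Let a finite group G act linearly on S = C[x,y,z]. If every semi-invariant becomes
    invariant after multiplication by an element prime to a given prime of S, then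
    Spec S -> Spec S^G is unramified in codimension one. The preimage of a prime divisor
    of the quotient then has a semi-invariant equation in S, and sending a divisor to the
    weight of its equation identifies Cl with the character group of G. Multiplying a
    section of O(D) by a suitably normalized equation of D identifies the Cox ring with
    the span of the semi-invariants, that is with the invariants of [G,G], graded by the
    characters. The ramification condition holds as soon as each weight is attained by
    two coprime monomials in the generators.
    For k <> 7 the group is conjugate to one generated by a diagonal matrix and a
    monomial matrix swapping x and y; [G,G] is generated by diag(r, 1/r, 1) with r of
    order n, and its invariants are generated by x^n, y^n, xy, z. For k = 7, [G,G] is the
    Klein four-group with invariants generated by x^2, y^2, z^2, xyz. In both cases a
    linear change of these generators diagonalizes G/[G,G] and yields the T_j and f. *)
Require Import Defs.
From HB Require Import structures.
From mathcomp Require Import all_boot all_order all_algebra.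
From mathcomp Require Import boolp classical_sets.
From mathcomp Require Import reals complex freeg mpoly.
From mathcomp Require Import ring zify.

Set Implicit Arguments.
Unset Strict Implicit.
Unset Printing Implicit Defensive.

Import Order.TTheory GRing.Theory Num.Theory.
Local Open Scope ring_scope.

(** * Factorial rings *)

(** The Cox ring has to be computed for every choice of K and chi, and this dictates the
    normalization. Multiplying sections by equations is a ring map only if the equations depend
    multiplicatively on D in K, and it kills the 1 - chi(E) only if they equal chi on K^0. Products
    of fixed local equations are multiplicative, but on K^0 they agree with chi only up to
    constants. These constants form a character of K^0, and it extends to the finitely generated
    group K because the ground field is algebraically closed. Coprime monomials yield the
    ramification condition because a prime divides at most one of them: the other one, taken of
    weight -w, makes a semi-invariant of weight w invariant without changing its order along that
    prime. So no reflections or inertia groups have to be inspected. The constants in f come from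
    two identities: 4uv = (u+v)^2 - (u-v)^2 with u = x^n, v = y^n, and the splitting of a^3 + b^3 +
    c^3 - 3abc into three linear forms, which at the Fourier transform of x^2, y^2, z^2 gives 27 x^2
    y^2 z^2. *)

Section Divisibility.
Variable R : idomainType.
Implicit Types a b c p q u : R.

Definition dv a b : Prop := exists c, b = c * a.

Definition prime_elt p : Prop :=
  [/\ p != 0, p \isn't a GRing.unit & forall a b, dv p (a * b) -> dv p a \/ dv p b].

Definition has_factorization a : Prop :=
  exists u (l : seq R), [/\ u \is a GRing.unit, forall p, p \in l -> prime_elt p
                & a = u * \prod_(p <- l) p].

(** The factors are prime and not merely irreducible, so uniqueness of the factorization comes for
    free. *)
Definition factorial_ring : Prop := forall a, a != 0 -> has_factorization a.

Lemma dv_refl a : dv a a.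
Proof. by exists 1; rewrite mul1r. Qed.

Lemma dv0 a : dv a 0.
Proof. by exists 0; rewrite mul0r. Qed.

Lemma dv_trans b a c : dv a b -> dv b c -> dv a c.
Proof. by move=> [x ->] [y ->]; exists (y * x); rewrite mulrA. Qed.

Lemma dv_mull a b c : dv a c -> dv a (b * c).
Proof. by move=> [x ->]; exists (b * x); rewrite mulrA. Qed.

Lemma dv_mulr a b c : dv a b -> dv a (b * c).
Proof. by rewrite mulrC; apply: dv_mull. Qed.

Lemma dvD a b c : dv a b -> dv a c -> dv a (b + c).
Proof. by move=> [x ->] [y ->]; exists (x + y); rewrite mulrDl. Qed.

Lemma dvN a b : dv a b -> dv a (- b).
Proof. by move=> [x ->]; exists (- x); rewrite mulNr. Qed.

Lemma dvB a b c : dv a b -> dv a c -> dv a (b - c).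
Proof. by move=> ab ac; apply: dvD => //; apply: dvN. Qed.

Lemma dv_unit u a : u \is a GRing.unit -> dv a u -> a \is a GRing.unit.
Proof. by move=> uu [c e]; move: uu; rewrite e unitrM => /andP[]. Qed.

Lemma unit_dv u a : u \is a GRing.unit -> dv u a.
Proof. by move=> uu; exists (a / u); rewrite divrK. Qed.

Lemma prime_dv_unit p u : prime_elt p -> u \is a GRing.unit -> ~ dv p u.
Proof. by move=> [_ /negP pu _] uu /(dv_unit uu). Qed.

Lemma prime_dv1 p : prime_elt p -> ~ dv p 1.
Proof. by move=> pp; apply: prime_dv_unit pp (unitr1 _). Qed.

Lemma prime_dvM p a b : prime_elt p -> dv p (a * b) -> dv p a \/ dv p b.
Proof. by case=> _ _; apply. Qed.

Lemma prime_dvX p a n : prime_elt p -> dv p (a ^+ n) -> dv p a.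
Proof.
move=> pp; elim: n => [/(prime_dv1 pp)//|n IH].
by rewrite exprS => /(prime_dvM pp)[|/IH].
Qed.

Lemma prime_dv_prod p (J : eqType) (r : seq J) (F : J -> R) : prime_elt p ->
  dv p (\prod_(i <- r) F i) -> exists2 i, i \in r & dv p (F i).
Proof.
move=> pp; elim: r => [|j r IH]; first by rewrite big_nil => /(prime_dv1 pp).
rewrite big_cons => /(prime_dvM pp)[h|/IH[i ir hi]]; first by exists j; rewrite ?mem_head.
by exists i; rewrite // in_cons ir orbT.
Qed.

Lemma prime_dv_prodfin p (J : finType) (F : J -> R) : prime_elt p ->
  dv p (\prod_i F i) -> exists i, dv p (F i).
Proof. by move=> pp /(prime_dv_prod pp)[i _ h]; exists i. Qed.

Lemma prime_dv_sym p q : prime_elt p -> prime_elt q -> dv p q -> dv q p.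
Proof.
move=> pp qp [c e].
have [|[d ed]|//] := @prime_dvM q c p qp; first by rewrite -e; apply: dv_refl.
have [q0 _ _] := qp; have [_ /negP[]] := pp.
apply: (@dv_unit 1); rewrite ?unitr1 //; exists d.
by apply: (mulfI q0); rewrite mulr1 {1}e ed; rewrite mulrA [q * d]mulrC.
Qed.

Lemma prime_quot_unit p q c : prime_elt p -> prime_elt q -> q = c * p ->
  c \is a GRing.unit.
Proof.
move=> pp qp e; have [d ed] := prime_dv_sym pp qp (ex_intro _ c e).
have [p0 _ _] := pp; apply: (@dv_unit 1); rewrite ?unitr1 //; exists d.
by apply: (mulIf p0); rewrite mul1r {1}ed e mulrA.
Qed.

Hypothesis fR : factorial_ring.

Lemma prime_dvP a : a != 0 -> a \isn't a GRing.unit -> exists2 p, prime_elt p & dv p a.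
Proof.
move=> a0 au; have [u [[|p l] [uu lp e]]] := fR a0.
  by move: au; rewrite e big_nil mulr1 uu.
exists p; first by apply: lp; rewrite mem_head.
by rewrite e big_cons; exists (u * \prod_(j <- l) j); rewrite -mulrA [_ * p]mulrC.
Qed.

Definition val_spec p a n := exists2 b, ~ dv p b & a = p ^+ n * b.
(** The multiplicity of a prime [p] in [a]. For [a = 0] no exponent satisfies [val_spec], and the
    default 0 is taken. *)
Definition pval p a : nat := xget 0%N (val_spec p a).

Lemma val_specE p a n : prime_elt p -> val_spec p a n -> pval p a = n.
Proof.
move=> pp an; rewrite /pval; case: xgetP => [m _ am|/(_ n an)//].
have [p0 _ _] := pp.
have aux i j : val_spec p a i -> val_spec p a j -> (i <= j)%N.
  move=> [b pb e] [c pc e']; rewrite leqNgt; apply/negP => ji; apply: pc.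
  have e2 : p ^+ j * c = p ^+ j * (p ^+ (i - j) * b).
    by rewrite -e' e mulrA -exprD subnKC // ltnW.
  move/(mulfI (expf_neq0 _ p0)): e2 => ->; apply: dv_mulr.
  by move: ji; rewrite -subn_gt0; case: (i - j)%N => // d _; rewrite exprS; apply: dv_mulr; apply: dv_refl.
by apply/eqP; rewrite eqn_leq !aux.
Qed.

(** Induction over a factorization of [a]: a factor associated to [p] raises the exponent by one,
    any other factor joins the cofactor, which stays prime to [p]. *)
Lemma val_spec_ex p a : prime_elt p -> a != 0 -> exists n, val_spec p a n.
Proof.
move=> pp a0.
have unitV u : u \is a GRing.unit -> exists n, val_spec p u n.
  by move=> uu; exists 0%N, u; [apply: prime_dv_unit|rewrite mul1r].
have [u [l [uu lp ->]]] := fR a0; elim: l u uu lp {a a0} => [|q l IH] u uu lp.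
  by rewrite big_nil mulr1; apply: unitV.
have [n [b pb e]] := IH u uu (fun x xl => lp x (@mem_behead _ (q :: l) x xl)).
have qp : prime_elt q by apply: lp; rewrite mem_head.
rewrite big_cons mulrCA e; have [pq|npq] := pselect (dv p q).
  have [c ec] := pq; have cu := prime_quot_unit pp qp ec.
  exists n.+1, (c * b); last by rewrite ec exprS; ring.
  move=> /(prime_dvM pp)[h|//]; exact: prime_dv_unit pp cu h.
exists n, (q * b); last by rewrite mulrCA.
by move=> /(prime_dvM pp)[].
Qed.

Lemma pvalP p a : prime_elt p -> a != 0 -> val_spec p a (pval p a).
Proof.
by move=> pp a0; have [n an] := val_spec_ex pp a0; rewrite (val_specE pp an).
Qed.

Lemma valM p a b : prime_elt p -> a != 0 -> b != 0 -> pval p (a * b) = (pval p a + pval p b)%N.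
Proof.
move=> pp a0 b0; have [x px ex] := pvalP pp a0; have [y py ey] := pvalP pp b0.
apply: val_specE => //; exists (x * y); first by move=> /(prime_dvM pp)[].
by rewrite {1}ex {1}ey exprD mulrACA.
Qed.

Lemma val_dv p a : prime_elt p -> a != 0 -> (0 < pval p a)%N <-> dv p a.
Proof.
move=> pp a0; have [x px ex] := pvalP pp a0; split=> [|[c e]].
  case: (pval p a) ex => // n -> _.
  by rewrite exprSr -mulrA; apply: dv_mull; apply: dv_mulr; apply: dv_refl.
rewrite lt0n; apply/negP => /eqP v0; apply: px.
by move: ex; rewrite v0 mul1r => <-; exists c.
Qed.

Lemma val_ndv p a : prime_elt p -> a != 0 -> ~ dv p a -> pval p a = 0%N.
Proof. by move=> pp a0 pa; apply/eqP; rewrite -leqn0 leqNgt; apply/negP => /(val_dv pp a0). Qed.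

Lemma val_unit p u : prime_elt p -> u \is a GRing.unit -> pval p u = 0%N.
Proof.
move=> pp uu; apply: val_ndv => //; last exact: prime_dv_unit.
by apply: contraTneq uu => ->; rewrite unitr0.
Qed.

Lemma val_assoc p q : prime_elt p -> prime_elt q -> dv p q -> pval p q = 1%N.
Proof.
move=> pp qp [c e]; apply: val_specE => //; exists c; last by rewrite expr1 mulrC.
exact/prime_dv_unit/(prime_quot_unit pp qp e).
Qed.

Lemma val_eq_assoc p q a : prime_elt p -> prime_elt q -> dv p q -> pval p a = pval q a.
Proof.
move=> pp qp [c e]; have cu := prime_quot_unit pp qp e.
have [->|a0] := eqVneq a 0.
  rewrite /pval; congr xget; apply/funext => n; apply/propext.
  have [p0 _ _] := pp; have [q0 _ _] := qp.
  split=> -[b pb /esym/eqP]; rewrite mulf_eq0 expf_eq0 ?(negPf p0) ?(negPf q0) andbF /=;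
    by move=> /eqP b0; case: pb; rewrite b0; apply: dv0.
have [x qx ex] := pvalP qp a0; apply: val_specE => //; exists (c ^+ pval q a * x).
  move=> /(prime_dvM pp)[/(prime_dvX pp)|px].
    exact: prime_dv_unit.
  by apply: qx; apply: (dv_trans (prime_dv_sym pp qp (ex_intro _ c e))).
by rewrite {1}ex e exprMn; ring.
Qed.

Definition coprime_elt a b := forall p, prime_elt p -> dv p a -> dv p b -> False.

(** Induction over the prime factors of [b]: such a factor divides [a * c] but not [a], hence
    divides [c], and can be cancelled on both sides. *)
Lemma coprime_dvM a b c : b != 0 -> coprime_elt a b -> dv b (a * c) -> dv b c.
Proof.
move=> b0; have [u [l [uu lp ->]]] := fR b0; elim: l lp c {b b0} => [|q l IH] lp c cab.
  by rewrite big_nil mulr1 => _; apply: unit_dv.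
have qp : prime_elt q by apply: lp; rewrite mem_head.
rewrite big_cons mulrCA => bac.
have qac : dv q (a * c).
  by apply: dv_trans bac; apply: dv_mulr; apply: dv_refl.
have qb : dv q (u * \prod_(p <- q :: l) p).
  by rewrite big_cons mulrCA; apply: dv_mulr; apply: dv_refl.
have [/cab/(_ qb)[//]|[c' ec]] := prime_dvM qp qac.
have [q0 _ _] := qp.
have lp' p : p \in l -> prime_elt p by move=> pl; apply: lp; rewrite in_cons pl orbT.
have [||x ex] := IH lp' c'.
- move=> p pp pa pb; apply: (cab p pp pa).
  by rewrite big_cons mulrCA; apply: dv_mull.
- have [x ex] := bac; exists x; apply: (mulfI q0).
  transitivity (a * c); [rewrite ec|rewrite ex]; ring.
by exists x; rewrite ec ex; ring.
Qed.

(** Multiply one prime from each associate class: a [q] that already divides a later member of the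
    list is skipped. Applied to the orbit of a prime under the group, this gives the reduced
    equation of the preimage of a divisor. *)
Lemma squarefree_prod (l : seq R) : (forall p, p \in l -> prime_elt p) ->
  exists2 h, h != 0 & forall p, prime_elt p ->
    pval p h = `[< exists2 q, q \in l & dv p q >].
Proof.
elim: l => [_|q l IH lp].
  exists 1 => [|p pp]; first exact: oner_neq0.
  by rewrite val_unit ?unitr1 //; case: asboolP => // -[].
have qp : prime_elt q by apply: lp; rewrite mem_head.
have [h h0 hh] := IH (fun x xl => lp x (@mem_behead _ (q :: l) x xl)).
have [ql|nql] := pselect (exists2 q', q' \in l & dv q q').
  exists h => // p pp; rewrite hh //; congr (nat_of_bool _); apply/asboolP/asboolP.
    by move=> [q' q'l pq']; exists q'; rewrite // in_cons q'l orbT.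
  move=> [q']; rewrite in_cons => /orP[/eqP-> pq|]; last by exists q'.
  by have [q2 q2l qq2] := ql; exists q2 => //; apply: dv_trans qq2.
have [q0 _ _] := qp; exists (q * h) => [|p pp]; first by rewrite mulf_neq0.
rewrite valM // hh //; have [pq|npq] := pselect (dv p q).
  rewrite val_assoc //; rewrite asboolF ?asboolT //; first by exists q; rewrite ?mem_head.
  move=> [q' q'l pq']; apply: nql; exists q' => //.
  exact: dv_trans (prime_dv_sym pp qp pq) pq'.
rewrite val_ndv // add0n; congr (nat_of_bool _); apply/asboolP/asboolP.
  by move=> [q' q'l pq']; exists q'; rewrite // in_cons q'l orbT.
by move=> [q']; rewrite in_cons => /orP[/eqP->|]; [|exists q'].
Qed.
End Divisibility.

Section Factorization.
Variable R : idomainType.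
Implicit Types a b p : R.

Lemma has_factorizationM a b :
  has_factorization a -> has_factorization b -> has_factorization (a * b).
Proof.
move=> [u [l [uu lp ->]]] [v [m [vv mp ->]]]; exists (u * v), (l ++ m); split.
- by rewrite unitrM uu.
- by move=> p; rewrite mem_cat => /orP[/lp|/mp].
- by rewrite big_cat /=; ring.
Qed.

Lemma has_factorization_prime p : prime_elt p -> has_factorization p.
Proof.
move=> pp; exists 1, [:: p]; split; [exact: unitr1| |by rewrite big_seq1 mul1r].
by move=> q; rewrite inE => /eqP ->.
Qed.
End Factorization.

Section Transfer.
Variables (R T : idomainType) (f : {rmorphism R -> T}) (g : {rmorphism T -> R}).
Hypotheses (fK : cancel f g) (gK : cancel g f).

Lemma iso_dv a b : dv (f a) (f b) <-> dv a b.
Proof.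
split=> -[c e]; first by exists (g c); rewrite -[LHS]fK e rmorphM fK.
by exists (f c); rewrite e rmorphM.
Qed.

Lemma iso_prime p : prime_elt p -> prime_elt (f p).
Proof.
move=> [p0 pu pm]; split.
- by apply: contraNneq p0 => fp; rewrite -[p]fK fp rmorph0.
- by apply: contraNN pu => fpu; rewrite -[p]fK rmorph_unit.
- by move=> a b; rewrite -[a]gK -[b]gK -rmorphM !iso_dv; apply: pm.
Qed.

Lemma iso_factorial : factorial_ring R -> factorial_ring T.
Proof.
move=> fR b b0; have gb0 : g b != 0 by apply: contraNneq b0 => e; rewrite -[b]gK e rmorph0.
have [u [l [uu lp e]]] := fR _ gb0.
exists (f u), [seq f p | p <- l]; split; first exact: rmorph_unit.
  by move=> _ /mapP[p /lp pp ->]; apply: iso_prime.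
by rewrite -[b]gK e rmorphM rmorph_prod big_map.
Qed.
End Transfer.

(** * Gauss's lemma: univariate polynomials over a factorial ring *)

Section Gauss.
Variable R : idomainType.
Hypothesis fR : factorial_ring R.
Implicit Types (p q : {poly R}).

Lemma dv_polyC (c : R) p : dv c%:P p <-> forall i, dv c p`_i.
Proof.
split=> [[q ->] i|h]; first by rewrite coefMC; exists q`_i.
exists (\poly_(i < size p) sval (cid (h i))); apply/polyP => i.
rewrite coefMC coef_poly; case: ltnP => [_|/(nth_default 0)->]; last by rewrite mul0r.
exact: svalP (cid (h i)).
Qed.

(** If [c] divides neither [a] nor [b], let [i] and [j] be the least indices of coefficients not
    divisible by [c]. Modulo [c] the coefficient of [a * b] at [i + j] is the product of these two,
    so [c] does not divide it. *)
Lemma prime_polyC (c : R) : prime_elt c -> prime_elt c%:P.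
Proof.
move=> cp; have [c0 cu _] := cp; split; first by rewrite polyC_eq0.
  by rewrite poly_unitE size_polyC c0 coefC.
move=> a b cab.
have [//|ca] := pselect (dv c%:P a); first by left.
have [//|cb] := pselect (dv c%:P b); first by right.
have mini p : ~ dv c%:P p ->
    exists2 i, ~ dv c p`_i & forall j, (j < i)%N -> dv c p`_j.
  rewrite dv_polyC => /existsNP[i pi].
  have ex : exists i, `[< ~ dv c p`_i >] by exists i; apply/asboolP.
  case: (ex_minnP ex) => m /asboolP pm hm; exists m => // j jm.
  by apply: contrapT => /asboolP/hm; rewrite leqNgt jm.
have [i ci hi] := mini _ ca; have [j cj hj] := mini _ cb.
suff : dv c (a`_i * b`_j) by move=> /(prime_dvM cp)[].
move/dv_polyC/(_ (i + j)%N): cab; rewrite coefM.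
have ilt : (i < (i + j).+1)%N by rewrite ltnS leq_addr.
rewrite (bigD1 (Ordinal ilt)) //= addKn => h.
set s := \sum_(_ < _ | _) _ in h; rewrite -[_ * _](addrK s); apply: dvB h _.
rewrite /s; apply: big_ind => [|x y|k ki]; [exact: dv0|exact: dvD|].
have [ik|ik|e] := ltngtP k i.
- by apply: dv_mulr; apply: hi.
- by apply: dv_mull; apply: hj; rewrite ltn_subLR ?ltn_add2r // -ltnS.
- by case/eqP: ki; apply: val_inj.
Qed.

Definition primitive_poly p := forall c, prime_elt c -> ~ dv c%:P p.

(** Each division by [c] lowers the multiplicity of [c] in the leading coefficient, so the process
    stops. *)
Lemma strip_prime (c : R) p : prime_elt c -> p != 0 ->
  exists d q, [/\ p = d%:P * q, d != 0 & ~ dv c%:P q].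
Proof.
move=> cp; have [c0 _ _] := cp.
have [n] := ubnP (pval c (lead_coef p)); elim: n p => // n IH p le p0.
have [[q e]|ncp] := pselect (dv c%:P p); last first.
  by exists 1, p; rewrite mul1r oner_neq0.
have q0 : q != 0 by apply: contraNneq p0 => q0; rewrite e q0 mul0r.
have [||d [r [eq d0 cr]]] := IH q; last first.
- exists (d * c), r; split=> //; last by rewrite mulf_neq0.
  by rewrite e eq polyCM; ring.
- by [].
move: le; rewrite e lead_coefM lead_coefC valM ?lead_coef_eq0 //.
by rewrite (val_assoc cp cp) ?addn1 //; apply: dv_refl.
Qed.

(** A prime constant dividing a polynomial divides its leading coefficient, so stripping the
    finitely many primes of [lead_coef p] leaves a primitive polynomial. *)
Lemma strip_content p : p != 0 ->
  exists c q, [/\ p = c%:P * q, c != 0 & primitive_poly q].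
Proof.
move=> p0; have lp0 : lead_coef p != 0 by rewrite lead_coef_eq0.
have [u [l [uu lp e]]] := fR lp0.
have [c [q [ep c0 hq]]] : exists c q,
    [/\ p = c%:P * q, c != 0 & forall d, d \in l -> ~ dv d%:P q].
  elim: l lp {e} => [_|d l IH lp]; first by exists 1, p; rewrite mul1r oner_neq0.
  have [c [q [ep c0 hq]]] := IH (fun x xl => lp x (@mem_behead _ (d :: l) x xl)).
  have q0 : q != 0 by apply: contraNneq p0 => q0; rewrite ep q0 mulr0.
  have [c' [q' [eq c'0 cq']]] := strip_prime (lp d (mem_head _ _)) q0.
  exists (c * c'), q'; split; [by rewrite ep eq polyCM mulrA|by rewrite mulf_neq0|].
  move=> x; rewrite in_cons => /orP[/eqP->//|xl xq']; apply: (hq x xl).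
  by rewrite eq; apply: dv_mull.
exists c, q; split=> // d dp dq.
have : dv d (lead_coef p).
  by rewrite ep lead_coefM; apply: dv_mull; move/dv_polyC: dq; apply.
rewrite e => /(prime_dvM dp)[/(prime_dv_unit dp uu)//|].
move=> /(prime_dv_prod dp)[x xl dx]; apply: (hq x xl).
apply: dv_trans dq; have [y ey] := prime_dv_sym dp (lp x xl) dx.
by exists y%:P; rewrite ey polyCM.
Qed.

(** The prime factors of the constant are cancelled one at a time: a prime [c] dividing [r * p] with
    [p] primitive must divide [r]. *)
Lemma gauss_dv p q (c : R) : primitive_poly p -> c != 0 -> dv p (c%:P * q) -> dv p q.
Proof.
move=> pp c0; have [u [l [uu lp ->]]] := fR c0; elim: l lp {c c0} => [_|c l IH lp].
  rewrite big_nil mulr1 => -[r e]; exists (u^-1%:P * r).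
  by rewrite -mulrA -e mulrA -polyCM mulVr // mul1r.
have cp : prime_elt c by apply: lp; rewrite mem_head.
have [c0 _ _] := cp.
rewrite big_cons mulrCA polyCM -mulrA => -[r e].
have [|[r' er]|/(pp c cp)//] := @prime_dvM _ c%:P r p (prime_polyC cp).
  by rewrite -e; apply: dv_mulr; apply: dv_refl.
apply: IH => [x xl|]; first by apply: lp; rewrite in_cons xl orbT.
exists r'; apply: (@mulfI _ c%:P); first by rewrite polyC_eq0.
by rewrite e er; ring.
Qed.

(** The relation [%|] allows a nonzero constant factor, so it is divisibility over the fraction
    field; for a primitive divisor this is divisibility over [R]. *)
Lemma dvdp_dv p q : primitive_poly p -> p %| q -> dv p q.
Proof.
move=> pp /Pdiv.Idomain.dvdpP[[c r] /= c0 e]; apply: (gauss_dv pp c0).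
by exists r; rewrite mul_polyC.
Qed.

Lemma primitive_irreducible_prime p :
  primitive_poly p -> irreducible_poly p -> prime_elt p.
Proof.
move=> pp ip; split; [exact: irredp_neq0| |].
  by rewrite poly_unitE; case: ip => sp _; rewrite gtn_eqF.
move=> a b [r e]; have pab : p %| a * b by rewrite e Pdiv.Idomain.dvdp_mull.
have [pa|npa] := boolP (p %| a); first by left; apply: dvdp_dv.
right; apply: dvdp_dv => //; rewrite -(Pdiv.Idomain.Gauss_dvdpr _ (q := a)) //.
rewrite Pdiv.Idomain.coprimep_def; apply: contraNT npa => sg.
have := ip.2 _ sg (Pdiv.Idomain.dvdp_gcdl p a).
by move/Pdiv.Idomain.eqp_dvdl <-; apply: Pdiv.Idomain.dvdp_gcdr.
Qed.

Lemma polyC_factorization (c : R) : c != 0 -> has_factorization c%:P.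
Proof.
move=> /fR[u [l [uu lp ->]]]; exists u%:P, (map (@polyC R) l); split.
- have u0 : u != 0 by apply: contraTneq uu => ->; rewrite unitr0.
  by rewrite poly_unitE size_polyC coefC u0.
- by move=> _ /mapP[p /lp pp ->]; apply: prime_polyC.
- by rewrite polyCM rmorph_prod big_map.
Qed.

(** Induction on the degree. After removing the content the polynomial is a constant, or irreducible
    and hence prime, or a product of two factors of smaller degree. *)
Lemma poly_factorial : factorial_ring {poly R}.
Proof.
move=> p; have [n] := ubnP (size p); elim: n p => // n IH p sp p0.
have [c [q [e c0 pq]]] := strip_content p0.
rewrite e; apply: has_factorizationM (polyC_factorization c0) _.
have q0 : q != 0 by apply: contraNneq p0 => q0; rewrite e q0 mulr0.
have {sp e} sq : (size q <= n)%N by move: sp; rewrite e size_Cmul.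
have [s1|s1] := leqP (size q) 1.
  rewrite (size1_polyC s1); apply: polyC_factorization.
  by move: q0; rewrite {1}(size1_polyC s1) polyC_eq0.
have [ip|nip] := pselect (irreducible_poly q).
  exact/has_factorization_prime/primitive_irreducible_prime.
have [r sr [rq nrq]] : exists2 r : {poly R}, size r != 1%N & r %| q /\ ~~ (r %= q).
  apply: contrapT => h; apply: nip; split=> // r sr rq; apply: contrapT => nrq.
  by apply: h; exists r => //; split => //; apply/negP.
have r0 : r != 0 by apply: Pdiv.Idomain.dvdpN0 rq q0.
have ltr : (size r < size q)%N.
  rewrite ltn_neqAle Pdiv.Idomain.dvdp_leq // andbT.
  by rewrite Pdiv.Idomain.dvdp_size_eqp.
(* The factor [r] divides [q] only over the fraction field; its primitive part [r'] divides [q] over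
   [R]. *)
have [d [r' [er d0 pr']]] := strip_content r0.
have r'q : r' %| q.
  by apply: Pdiv.Idomain.dvdp_trans rq; rewrite er Pdiv.Idomain.dvdp_mull.
have [t et] := dvdp_dv pr' r'q.
have sr' : size r' = size r by rewrite er size_Cmul.
have r'0 : r' != 0 by rewrite -size_poly_gt0 sr' size_poly_gt0.
have t0 : t != 0 by apply: contraNneq q0 => t0; rewrite et t0 mul0r.
have st : (size t < size q)%N.
  have : (1 < size r)%N by rewrite ltn_neqAle eq_sym sr size_poly_gt0.
  rewrite et size_mul // sr'.
  by case: (size r) => [|[|k]] // _; rewrite !addnS /= ltnS leq_addr.
rewrite et; apply: has_factorizationM; apply: IH => //.
  exact: leq_trans st sq.
by rewrite sr'; apply: leq_trans ltr sq.
Qed.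
End Gauss.

Lemma mpoly_rmorph_ext n (k : nzRingType) (T : comNzRingType)
    (f g : {rmorphism {mpoly k[n]} -> T}) :
  (forall c, f c%:MP = g c%:MP) -> (forall i, f 'X_i = g 'X_i) -> f =1 g.
Proof.
move=> hc hX p; rewrite [p]mpolyE !rmorph_sum; apply: eq_bigr => m _.
rewrite -mul_mpolyC !rmorphM hc mpolyXE_id !rmorph_prod; congr (_ * _).
by apply: eq_bigr => i _; rewrite !rmorphXn hX.
Qed.

(** * Polynomials in several variables, by splitting off the last one *)

Section MpolyFactorial.
Variable k : idomainType.

Definition poly_of_mpoly n : {mpoly k[n.+1]} -> {poly {mpoly k[n]}} :=
  mmap (polyC \o @mpolyC n k)
    (fun i => oapp (fun j => ('X_j)%:P) 'X (unlift ord_max i)).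

Definition mpoly_widen n : {mpoly k[n]} -> {mpoly k[n.+1]} :=
  mmap (@mpolyC n.+1 k) (fun j => 'X_(fintype.lift ord_max j)).

Definition mpoly_of_poly n : {poly {mpoly k[n]}} -> {mpoly k[n.+1]} :=
  horner_eval 'X_ord_max \o map_poly (@mpoly_widen n).

HB.instance Definition _ n := GRing.RMorphism.on (@poly_of_mpoly n).
HB.instance Definition _ n := GRing.RMorphism.on (@mpoly_widen n).
HB.instance Definition _ n := GRing.RMorphism.on (@mpoly_of_poly n).

Lemma mpoly_of_polyC n (p : {mpoly k[n]}) : mpoly_of_poly p%:P = mpoly_widen p.
Proof. by rewrite /mpoly_of_poly /= map_polyC /horner_eval hornerC. Qed.

Lemma mpoly_of_polyX n : mpoly_of_poly 'X = 'X_(@ord_max n).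
Proof. by rewrite /mpoly_of_poly /= map_polyX /horner_eval hornerX. Qed.

Lemma poly_of_mpolyK n : cancel (@poly_of_mpoly n) (@mpoly_of_poly n).
Proof.
apply: (@mpoly_rmorph_ext _ _ _ (@mpoly_of_poly n \o @poly_of_mpoly n) idfun) => [c|i] /=.
  by rewrite /poly_of_mpoly mmapC /= mpoly_of_polyC /mpoly_widen mmapC.
rewrite /poly_of_mpoly mmapX mmap1U; case: unliftP => [j ->|->] /=.
  by rewrite mpoly_of_polyC /mpoly_widen mmapX mmap1U.
exact: mpoly_of_polyX.
Qed.

Lemma mpoly_of_polyK n : cancel (@mpoly_of_poly n) (@poly_of_mpoly n).
Proof.
move=> p; rewrite -[p in RHS]coefK poly_def -[p in LHS]coefK poly_def.
rewrite !rmorph_sum; apply: eq_bigr => i _.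
rewrite -mul_polyC !rmorphM /= !rmorphXn /= mpoly_of_polyC mpoly_of_polyX.
congr (_ * _ ^+ _); last first.
  by rewrite /poly_of_mpoly mmapX mmap1U unlift_none.
apply: (@mpoly_rmorph_ext _ _ _ (@poly_of_mpoly n \o @mpoly_widen n) polyC) => [c|j] /=.
  by rewrite /mpoly_widen mmapC /poly_of_mpoly mmapC.
by rewrite /mpoly_widen mmapX mmap1U /poly_of_mpoly mmapX mmap1U liftK.
Qed.
End MpolyFactorial.

Lemma mpoly_factorial (k : fieldType) n : factorial_ring {mpoly k[n]}.
Proof.
elim: n => [|n IH]; last exact: iso_factorial (@mpoly_of_polyK k n) (@poly_of_mpolyK k n) (poly_factorial IH).
move=> p p0; exists p, [::]; split=> //; last by rewrite big_nil mulr1.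
have e : p = (p@_0%MM)%:MP.
  apply/mpolyP => m; rewrite mcoeffC; have -> : m = 0%MM by apply/mnmP => -[].
  by rewrite eqxx mulr1.
have c0 : p@_0%MM != 0 by apply: contraNneq p0 => c0; rewrite e c0 mpolyC0.
by rewrite e rmorph_unit // unitfE.
Qed.

(** * Fraction fields and valuations *)

Section FractionNumDen.
Variable R : idomainType.
Local Notation F := {fraction R}.
Local Notation "a %:F" := (@tofrac R a).

Definition fnum (f : F) : R := \n_(repr f).
Definition fden (f : F) : R := \d_(repr f).

Lemma fden_neq0 f : fden f != 0.
Proof. exact: denom_ratioP. Qed.

Lemma fracE f : f = (fnum f)%:F / (fden f)%:F.
Proof.
have d0 : (fden f)%:F != 0 by rewrite tofrac_eq0 fden_neq0.
apply: (canRL (mulfK d0)); rewrite -{1}[f]reprK /fnum /fden.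
move: (repr f) => x; rewrite !piE; apply/eqmodP.
rewrite /= FracField.equivfE /FracField.mulf !numden_Ratio ?oner_neq0 ?mulf_neq0 ?denom_ratioP ?oner_neq0 //.
by rewrite !mulr1 mulrC.
Qed.

Lemma frac_ind (P : F -> Prop) : (forall a b, b != 0 -> P (a%:F / b%:F)) -> forall f, P f.
Proof. by move=> h f; rewrite (fracE f); apply: h; apply: fden_neq0. Qed.

Lemma frac_eq a b c d : b != 0 -> d != 0 -> (a%:F / b%:F = c%:F / d%:F) <-> a * d = c * b.
Proof.
move=> b0 d0; have b0' : b%:F != 0 by rewrite tofrac_eq0.
have d0' : d%:F != 0 by rewrite tofrac_eq0.
split=> [/eqP|e]; last (apply/eqP).
  by rewrite eqr_div // -!tofracM tofrac_eq => /eqP.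
by rewrite eqr_div // -!tofracM tofrac_eq e.
Qed.

Lemma frac_eq0 a b : b != 0 -> (a%:F / b%:F == 0) = (a == 0).
Proof. by move=> b0; rewrite mulf_eq0 invr_eq0 !tofrac_eq0 (negPf b0) orbF. Qed.

Lemma frac_numE a b : b != 0 -> fnum (a%:F / b%:F) * b = a * fden (a%:F / b%:F).
Proof. by move=> b0; apply/frac_eq => //; [apply: fden_neq0|rewrite -fracE]. Qed.

Lemma fnum_eq0 f : (fnum f == 0) = (f == 0).
Proof. by rewrite [in RHS](fracE f) frac_eq0 // fden_neq0. Qed.
End FractionNumDen.

Section FractionMap.
Variables (R T : idomainType) (f : {rmorphism R -> T}) (fi : injective f).
Local Notation "a %:F" := (tofrac a).

(* The injectivity proof is a parameter so that instances can be attached to the extension. *)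
Definition frac_map of injective f : {fraction R} -> {fraction T} :=
  fun x => (f (fnum x))%:F / (f (fden x))%:F.
Local Notation F := (frac_map fi).

Lemma inj_rmorph_eq0 a : (f a == 0) = (a == 0).
Proof. by rewrite -(inj_eq fi) rmorph0. Qed.

Lemma frac_map_div a b : b != 0 -> F (a%:F / b%:F) = (f a)%:F / (f b)%:F.
Proof.
move=> b0; apply/frac_eq; rewrite ?inj_rmorph_eq0 ?fden_neq0 //.
by rewrite -!rmorphM frac_numE.
Qed.

Lemma frac_map_tofrac a : F a%:F = (f a)%:F.
Proof. by rewrite -[a%:F]divr1 -tofrac1 frac_map_div ?oner_neq0 // rmorph1 tofrac1 divr1. Qed.

Lemma frac_map_zmod : zmod_morphism F.
Proof.
elim/frac_ind => a b b0; elim/frac_ind => c d d0.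
have b1 : f b != 0 by rewrite inj_rmorph_eq0.
have d1 : f d != 0 by rewrite inj_rmorph_eq0.
have h (U : idomainType) (x y z t : U) : y != 0 -> t != 0 ->
    x%:F / y%:F - z%:F / t%:F = (x * t - z * y)%:F / (y * t)%:F.
  move=> y0 t0; have -> : - (z%:F / t%:F) = (- z)%:F / t%:F by rewrite tofracN mulNr.
  by rewrite addf_div ?tofrac_eq0 // -!tofracM -tofracD mulNr.
by rewrite !frac_map_div // !h // frac_map_div ?mulf_neq0 // !(rmorphB, rmorphM).
Qed.

Lemma frac_map_monoid : monoid_morphism F.
Proof.
split=> [|]; first by rewrite -[in LHS](@tofrac1 R) frac_map_tofrac rmorph1 tofrac1.
elim/frac_ind => a b b0; elim/frac_ind => c d d0.
transitivity (F ((a * c)%:F / (b * d)%:F)); first by rewrite !tofracM -mulf_div.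
by rewrite !frac_map_div ?mulf_neq0 // !rmorphM -mulf_div.
Qed.

HB.instance Definition _ := GRing.isZmodMorphism.Build _ _ F frac_map_zmod.
HB.instance Definition _ := GRing.isMonoidMorphism.Build _ _ F frac_map_monoid.

End FractionMap.

Section FractionValuation.
Variable R : idomainType.
Hypothesis fR : factorial_ring R.
Local Notation F := {fraction R}.
Local Notation "a %:F" := (@tofrac R a).
Implicit Types (f g : F) (p : R).

Definition fval p f : int := (pval p (fnum f))%:Z - (pval p (fden f))%:Z.

(** Independence of the representative: the two fractions are compared by taking multiplicities in
    the cross-multiplied identity [frac_numE]. *)
Lemma fval_div p a b : prime_elt p -> a != 0 -> b != 0 ->
  fval p (a%:F / b%:F) = (pval p a)%:Z - (pval p b)%:Z.
Proof.
move=> pp a0 b0; set f := _ / _; have e := frac_numE a b0; rewrite -/f in e.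
have n0 : fnum f != 0 by rewrite fnum_eq0 frac_eq0.
have := valM fR pp n0 b0; rewrite e valM ?fden_neq0 // => /(congr1 Posz).
rewrite !PoszD => h; rewrite /fval; apply/eqP.
by rewrite subr_eq addrAC eq_sym subr_eq h addrC.
Qed.

Lemma fvalM p f g : prime_elt p -> f != 0 -> g != 0 ->
  fval p (f * g) = fval p f + fval p g.
Proof.
move=> pp; elim/frac_ind: f => a b b0; elim/frac_ind: g => c d d0.
rewrite !frac_eq0 // => a0 c0; rewrite mulf_div -!tofracM !fval_div ?mulf_neq0 //.
by rewrite !valM // !PoszD; ring.
Qed.

Lemma fval_tofrac p a : prime_elt p -> a != 0 -> fval p a%:F = pval p a.
Proof.
move=> pp a0; rewrite -[a%:F]divr1 -tofrac1 fval_div ?oner_neq0 //.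
by rewrite (val_unit fR pp (unitr1 _)) subr0.
Qed.

Lemma fval1 p : prime_elt p -> fval p 1 = 0.
Proof. by move=> pp; rewrite -tofrac1 fval_tofrac ?oner_neq0 // (val_unit fR pp (unitr1 _)). Qed.

Lemma fvalV p f : prime_elt p -> f != 0 -> fval p f^-1 = - fval p f.
Proof.
move=> pp f0; apply/eqP; rewrite -subr_eq0 opprK -fvalM ?invr_eq0 //.
by rewrite mulVf //; apply/eqP; apply: fval1.
Qed.

Lemma fvalX p f n : prime_elt p -> f != 0 -> fval p (f ^+ n) = fval p f *+ n.
Proof.
move=> pp f0; elim: n => [|n IH]; first by rewrite expr0; apply: fval1.
by rewrite exprS mulrS fvalM ?expf_neq0 // IH.
Qed.

Lemma fvalXz p f n : prime_elt p -> f != 0 -> fval p (f ^ n) = fval p f *~ n.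
Proof.
move=> pp f0; case: n => n; first exact: fvalX.
by rewrite /exprz fvalV ?expf_neq0 // fvalX.
Qed.

Lemma fval_prod p (J : eqType) (r : seq J) (G : J -> F) : prime_elt p ->
  (forall j, G j != 0) -> fval p (\prod_(j <- r) G j) = \sum_(j <- r) fval p (G j).
Proof.
move=> pp G0; elim: r => [|j r IH]; first by rewrite !big_nil; apply: fval1.
rewrite !big_cons fvalM //; first by rewrite IH.
by rewrite prodf_seq_neq0; apply/allP => i _; rewrite G0.
Qed.

(** The prime factors of the denominator are treated one by one: each is cancelled against the
    numerator or, if it does not divide the numerator, kept. *)
Lemma frac_coprime f : exists a b, [/\ b != 0, f = a%:F / b%:F & coprime_elt a b].
Proof.
elim/frac_ind: f => a b b0; have [u [l [uu lp ->]]] := fR b0.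
have u0 : u != 0 by apply: contraTneq uu => ->; rewrite unitr0.
elim: l lp {b b0} => [_|q l IH lp].
  exists a, u; rewrite big_nil mulr1; split=> // p pp _; exact: prime_dv_unit.
have qp : prime_elt q by apply: lp; rewrite mem_head.
have [q0 _ _] := qp.
have [c [d [d0 e cd]]] := IH (fun x xl => lp x (@mem_behead _ (q :: l) x xl)).
have -> : a%:F / (u * \prod_(p <- q :: l) p)%:F = c%:F / (q * d)%:F.
  rewrite big_cons mulrCA !tofracM invfM mulrCA -tofracM e.
  by rewrite invfM mulrCA.
have [[c' ec]|nqc] := pselect (dv q c).
  exists c', d; split=> //.
    apply/frac_eq; rewrite ?mulf_neq0 // ec; ring.
  by move=> p pp pc' /(cd p pp); apply; rewrite ec; apply: dv_mulr.
exists c, (q * d); split=> //; first by rewrite mulf_neq0.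
move=> p pp pc /(prime_dvM pp)[pq|/(cd p pp pc)//].
exact: nqc (dv_trans (prime_dv_sym pp qp pq) pc).
Qed.

(** In lowest terms a prime factor of the denominator would have negative valuation, so the
    denominator is a unit. *)
Lemma fval_ge0_int f : f != 0 -> (forall p, prime_elt p -> 0 <= fval p f) ->
  exists2 a, a != 0 & f = a%:F.
Proof.
have [a [b [b0 -> cab]]] := frac_coprime f; rewrite frac_eq0 // => a0 h.
have [bu|bnu] := boolP (b \is a GRing.unit).
  exists (a / b); first by rewrite mulf_neq0 // invr_eq0.
  apply: (canLR (mulfK _)); first by rewrite tofrac_eq0.
  by rewrite -tofracM divrK.
have [p pp pb] := prime_dvP fR b0 bnu.
have := h p pp; rewrite fval_div // (val_ndv fR pp a0) => [|pa]; last exact: cab pp pa pb.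
by rewrite sub0r oppr_ge0 lez_nat leqn0 => /eqP v0; have := (val_dv fR pp b0).2 pb; rewrite v0.
Qed.

Lemma fval_eq0_unit f : f != 0 -> (forall p, prime_elt p -> fval p f = 0) ->
  exists2 u, u \is a GRing.unit & f = u%:F.
Proof.
move=> f0 h; have [a a0 ea] := fval_ge0_int f0 (fun p pp => eq_ind_r (fun x => 0 <= x) (lexx _) (h p pp)).
exists a => //; apply/negPn/negP => anu; have [p pp pa] := prime_dvP fR a0 anu.
have := h p pp; rewrite ea fval_tofrac // => -[v0].
by have := (val_dv fR pp a0).2 pa; rewrite v0.
Qed.
End FractionValuation.

(** * Points and discrete valuations *)

Section Points.
Variable A : idomainType.
Implicit Types (P Q : Defs.point A).

Lemma pt_mull P a b : b \in P -> a * b \in P.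
Proof.
have [P0 _ PM] := pt_ideal P; move=> bP.
by rewrite -[a * b]addr0; apply: PM.
Qed.

Lemma pt_0 P : 0 \in P.
Proof. by have [] := pt_ideal P. Qed.

Lemma pt_1 P : 1 \notin P.
Proof. by have [] := pt_ideal P. Qed.

Lemma pt_M P a b : a * b \in P -> a \in P \/ b \in P.
Proof. by move=> /(@pt_prime _ P)/orP. Qed.

Lemma pt_X P a n : a ^+ n \in P -> a \in P.
Proof.
elim: n => [|n IH]; first by rewrite expr0 (negPf (pt_1 P)).
by rewrite exprS => /pt_M[|/IH].
Qed.

Lemma pt_prod P (l : seq A) : (\prod_(a <- l) a) \in P -> exists2 a, a \in l & a \in P.
Proof.
elim: l => [|b l IH]; first by rewrite big_nil (negPf (pt_1 P)).
rewrite big_cons => /pt_M[bP|/IH[a al aP]]; first by exists b; rewrite ?mem_head.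
by exists a; rewrite // in_cons al orbT.
Qed.

Lemma point_eq P Q : P =i Q -> P = Q.
Proof.
case: P Q => [p p1 p2] [q q1 q2] h; have e : p = q by apply/funext => a; exact: h a.
by move: p1 p2 {h}; rewrite e => p1 p2; congr Point; apply: Prop_irrelevance.
Qed.

Lemma primeDiv_eq (P Q : primeDiv A) : P =i Q -> P = Q.
Proof.
case: P Q => [P hP] [Q hQ] /= /point_eq e; move: hP; rewrite e => hP.
by congr PrimeDiv; apply: Prop_irrelevance.
Qed.

(** Both valuations vanish on the same elements, the units of the common valuation ring. With
    [v g = 1], the quotient of [f] by [g ^ v f] is such a unit, so [w f = w g * v f]. At an [h] with
    [w h = 1] this reads [w g * v h = 1] with both factors nonnegative, so [w g = 1]. This makes the
    chosen value of [ord] computable. *)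
Lemma valuation_at_unique P (v w : {fraction A} -> int) :
  valuation_at P v -> valuation_at P w -> forall f, f != 0 -> v f = w f.
Proof.
have vX u : valuation_at P u -> [/\ forall f, f != 0 -> u f^-1 = - u f
    & forall f (n : int), f != 0 -> u (f ^ n) = u f *~ n].
  move=> [uM _ _].
  have u1 : u 1 = 0.
    have := uM 1 1 (oner_neq0 _) (oner_neq0 _); rewrite mulr1 => /eqP.
    by rewrite -subr_eq0 opprD addrA subrr add0r oppr_eq0 => /eqP.
  have uV f : f != 0 -> u f^-1 = - u f.
    move=> f0; apply/eqP; rewrite -subr_eq0 opprK -uM ?invr_eq0 //.
    by rewrite mulVf // u1.
  have uX f n : f != 0 -> u (f ^+ n) = u f *+ n.
    move=> f0; elim: n => [|n IH]; first by rewrite expr0 u1.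
    by rewrite exprS mulrS uM ?expf_neq0 // IH.
  split=> // f [n|n] f0; first exact: uX.
  by rewrite /exprz uV ?expf_neq0 // uX.
have zero u u' : valuation_at P u -> valuation_at P u' ->
    forall f, f != 0 -> u f = 0 -> u' f = 0.
  move=> hu hu' f f0 uf; have [uV _] := vX _ hu; have [u'V _] := vX _ hu'.
  case: hu => _ _ uA; case: hu' => _ _ u'A; apply: le_anti; apply/andP; split.
    rewrite -oppr_ge0 -u'V //; apply/u'A; rewrite ?invr_eq0 //.
    by apply/uA; rewrite ?invr_eq0 // uV // uf oppr0.
  by apply/u'A => //; apply/uA => //; rewrite uf.
have prop u u' : valuation_at P u -> valuation_at P u' ->
    forall g, g != 0 -> u g = 1 -> forall f, f != 0 -> u' f = u' g *~ u f.
  move=> hu hu' g g0 ug f f0; have [uV uX] := vX _ hu; have [u'V u'X] := vX _ hu'.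
  have gn : g ^ (u f) != 0 by rewrite expfz_neq0.
  have := zero u u' hu hu' (f / g ^ u f).
  case: (hu) => uM _ _; case: (hu') => u'M _ _.
  rewrite mulf_neq0 ?invr_eq0 // uM ?invr_eq0 // uV // uX // ug intz.
  rewrite subrr u'M ?invr_eq0 // u'V // u'X // => /(_ isT erefl) /eqP.
  by rewrite subr_eq0 => /eqP.
move=> hv hw f f0; have [_ [g g0 vg] vA] := hv; have [_ [h h0 wh] wA] := hw.
have wg0 : 0 <= w g by apply/wA => //; apply/vA => //; rewrite vg.
have := prop v w hv hw g g0 vg h h0; rewrite wh => /esym e1.
have wg : w g = 1.
  move: e1; rewrite -mulrzr intz => e1.
  have vh0 : 0 <= v h by apply/vA => //; apply/wA => //; rewrite wh.
  case: (w g) wg0 e1 => // a _; case: (v h) vh0 => // b _.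
  by rewrite -PoszM => -[] /eqP; rewrite muln_eq1 => /andP[/eqP -> _].
by rewrite (prop v w hv hw g g0 vg f f0) wg intz.
Qed.

Lemma ord_valuation (P : primeDiv A) v f : valuation_at P v -> f != 0 -> ord P f = v f.
Proof.
move=> hv f0; rewrite /ord; case: xgetP => [w _ hw|/(_ v)//].
exact: valuation_at_unique hw hv _ f0.
Qed.
End Points.

(** * Quotients by small groups *)

(* An affine quotient Spec S -> Spec A by a finite group of automorphisms of a factorial  *)
(* ring S with units k^*. The group is indexed by I, a generating set by T. Smallness is  *)
(* the condition that makes S unramified over A in codimension one: every semi-invariant  *)
(* becomes invariant after multiplication by an element prime to a given prime.           *)
Record small_quotient (k : fieldType) (S A : idomainType) := SmallQuotient {
  sq_const : {rmorphism k -> S};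
  sq_inc : {rmorphism A -> S};
  sq_I : finType;
  sq_T : finType;
  sq_act : sq_I -> {rmorphism S -> S};
  sq_gen : sq_T -> sq_I;
  sq_mul : sq_I -> sq_I -> sq_I;
  sq_one : sq_I;
  sq_inv : sq_I -> sq_I;
  sq_factorial : factorial_ring S;
  sq_inc_inj : injective sq_inc;
  sq_unit : forall u, u \is a GRing.unit -> exists c, u = sq_const c;
  sq_act_const : forall i c, sq_act i (sq_const c) = sq_const c;
  sq_actK : forall i, cancel (sq_act i) (sq_act (sq_inv i));
  sq_actKV : forall i, cancel (sq_act (sq_inv i)) (sq_act i);
  sq_act1 : sq_act sq_one =1 id;
  sq_actM : forall i j s, sq_act (sq_mul i j) s = sq_act j (sq_act i s);
  sq_mulI : forall j, injective (sq_mul^~ j);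
  sq_incP : forall s, (forall t, sq_act (sq_gen t) s = s) -> exists a, s = sq_inc a;
  sq_act_inc : forall i a, sq_act i (sq_inc a) = sq_inc a;
  sq_genP : forall s, (forall t, exists c, sq_act (sq_gen t) s = sq_const c * s) ->
    forall i, exists c, sq_act i s = sq_const c * s;
  sq_small : forall s, s != 0 ->
    (forall t, exists c, sq_act (sq_gen t) s = sq_const c * s) ->
    forall q, prime_elt q -> exists2 u, ~ dv q u
      & forall t, sq_act (sq_gen t) (s * u) = s * u
}.

(** * Primes of [S] over the prime divisors of [A] *)

Section PrimesOver.
Variables (k : fieldType) (S A : idomainType) (Q : small_quotient k S A).
Local Notation kk := (sq_const Q).
Local Notation inc := (sq_inc Q).
Local Notation act := (@sq_act _ _ _ Q).
Local Notation I := (sq_I Q).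
Local Notation gen := (@sq_gen _ _ _ Q).
Local Notation inv := (@sq_inv _ _ _ Q).
Let fS := sq_factorial Q.

Lemma act_inj i : injective (act i).
Proof. exact: can_inj (sq_actK i). Qed.

Lemma act_dv i a b : dv (act i a) (act i b) <-> dv a b.
Proof. exact: iso_dv (sq_actK i) a b. Qed.

Lemma act_prime i q : prime_elt q -> prime_elt (act i q).
Proof. exact: iso_prime (sq_actK i) (sq_actKV i) q. Qed.

Lemma act_eq0 i a : (act i a == 0) = (a == 0).
Proof. exact: inj_rmorph_eq0 (@act_inj i) a. Qed.

Lemma inc_eq0 a : (inc a == 0) = (a == 0).
Proof. exact: inj_rmorph_eq0 (@sq_inc_inj _ _ _ Q) a. Qed.

Lemma const_eq0 c : (kk c == 0) = (c == 0).
Proof. by rewrite fmorph_eq0. Qed.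

Lemma const_unit c : c != 0 -> kk c \is a GRing.unit.
Proof. by move=> c0; rewrite rmorph_unit // unitfE. Qed.

(** Every [s] divides its norm, and the norm lies in [A]. This takes the place of integrality and of
    lying-over theorems. *)
Definition norm s := \prod_(i : I) act i s.

Lemma act_norm j s : act j (norm s) = norm s.
Proof.
rewrite /norm rmorph_prod [RHS](reindex_inj (@sq_mulI _ _ _ Q j)).
by apply: eq_bigr => i _; rewrite sq_actM.
Qed.

Lemma norm_inc s : exists n, norm s = inc n.
Proof. by apply: sq_incP => t; apply: act_norm. Qed.

Lemma normM a b : norm (a * b) = norm a * norm b.
Proof. by rewrite /norm -big_split; apply: eq_bigr => i _; rewrite rmorphM. Qed.

Lemma norm1 : norm 1 = 1.
Proof. by rewrite /norm big1 // => i _; rewrite rmorph1. Qed.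

Lemma norm_of_inc a : norm (inc a) = inc (a ^+ #|I|).
Proof.
rewrite /norm (eq_bigr (fun=> inc a)) => [|i _]; last exact: sq_act_inc.
by rewrite prodr_const rmorphXn.
Qed.

Lemma norm_neq0 s : s != 0 -> norm s != 0.
Proof. by move=> s0; apply/prodf_neq0 => i _; rewrite act_eq0. Qed.

Lemma dv_norm s : dv s (norm s).
Proof. by rewrite /norm (bigD1 (sq_one Q)) //= sq_act1; apply: dv_mulr; apply: dv_refl. Qed.

Lemma prime_dv_norm q s : prime_elt q -> dv q (norm s) -> exists i, dv q (act i s).
Proof. exact: prime_dv_prodfin. Qed.

Definition over q (P : Defs.point A) := forall a, a \in P <-> dv q (inc a).

(** The group acts transitively, up to units, on the primes over [P]: the norm of [q'] lies in [P],
    so [q] divides it and hence one of its factors. *)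
Lemma over_conj q q' P : prime_elt q -> over q P -> over q' P -> exists i, dv q (act i q').
Proof.
move=> qp qP q'P; apply: prime_dv_norm => //; have [n en] := norm_inc q'.
by rewrite en; apply/qP/q'P; rewrite -en; apply: dv_norm.
Qed.

Lemma over_assoc q q' P : prime_elt q -> prime_elt q' -> dv q q' -> over q' P -> over q P.
Proof.
move=> qp q'p qq' h a; split=> [/h|]; first exact: dv_trans.
by move=> qa; apply/h; apply: dv_trans qa; apply: prime_dv_sym.
Qed.

Lemma over_act i q P : over (act i q) P <-> over q P.
Proof. by split=> h a; rewrite (h a) -(act_dv i q) sq_act_inc. Qed.

(** Taking norms in [inc x = y * q] exhibits a power of [x] as a multiple of [n]. *)
Lemma dv_norm_mem (P : Defs.point A) q n x :
  norm q = inc n -> n \in P -> dv q (inc x) -> x \in P.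
Proof.
move=> en nP [y e]; apply: (@pt_X _ _ _ #|I|); have [m em] := norm_inc y.
have : inc (x ^+ #|I|) = inc (m * n) by rewrite rmorphM -em -en -normM -e norm_of_inc.
by move/(@sq_inc_inj _ _ _ Q) ->; apply: pt_mull.
Qed.

(** Take norms in a factorization of [inc a]: a power of [a] becomes a product of elements of [A],
    and the prime ideal [P] contains one of them. It is not the norm of the unit factor, which is a
    unit of [A]. *)
Lemma mem_norm_prime (P : Defs.point A) a : a \in P -> a != 0 ->
  exists q n, [/\ prime_elt q, norm q = inc n & n \in P].
Proof.
move=> aP a0; have ia0 : inc a != 0 by rewrite inc_eq0.
have [u [l [uu lp e]]] := fS ia0.
pose nm s := sval (cid (norm_inc s)).
have nmE s : norm s = inc (nm s) := svalP (cid (norm_inc s)).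
have e2 : a ^+ #|I| = nm u * \prod_(x <- map nm l) x.
  apply: (@sq_inc_inj _ _ _ Q); rewrite -norm_of_inc e normM rmorphM nmE; congr (_ * _).
  rewrite rmorph_prod big_map; elim: (l) => [|x m IH]; first by rewrite !big_nil norm1.
  by rewrite !big_cons normM IH nmE.
have nuP : nm u \notin P.
  apply: contraNN (pt_1 P) => h; have -> : 1 = nm u^-1 * nm u; last exact: pt_mull.
  by apply: (@sq_inc_inj _ _ _ Q); rewrite rmorphM rmorph1 -!nmE -normM mulVr // norm1.
have : a ^+ #|I| \in P.
  have := max_card (pred1 (sq_one Q)); rewrite card1.
  by case: #|I| => // n _; rewrite exprSr; apply: pt_mull.
rewrite e2 => /pt_M[h|/pt_prod[x /mapP[q ql ->] qP]]; first by rewrite h in nuP.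
by exists q, (nm q); split=> //; apply: lp.
Qed.

Definition prime_trace q : A -> bool := fun a => `[< dv q (inc a) >].

Lemma prime_trace_ideal q : prime_elt q -> idealr_closed (prime_trace q).
Proof.
move=> qp; split; first by apply/asboolP; rewrite rmorph0; apply: dv0.
  by apply/asboolP; rewrite rmorph1; apply: prime_dv1.
move=> a x y /asboolP xq /asboolP yq; apply/asboolP.
by rewrite rmorphD rmorphM; apply: dvD => //; apply: dv_mull.
Qed.

Lemma prime_trace_prime q : prime_elt q -> prime_idealr_closed (prime_trace q).
Proof.
move=> qp x y /asboolP; rewrite rmorphM => /(prime_dvM qp)[h|h]; apply/orP;
  by [left; apply/asboolP|right; apply/asboolP].
Qed.

Definition point_under q (qp : prime_elt q) : Defs.point A :=
  Point (prime_trace_ideal qp) (prime_trace_prime qp).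

Lemma over_under q (qp : prime_elt q) : over q (point_under qp).
Proof. by move=> a; split=> [/asboolP|h]; [|apply/asboolP]. Qed.

(** A nonzero prime [P] below contains the norm of some prime [q']. Then [q] divides a conjugate of
    [q'], so the two are associated, and everything divisible by [q] already lies in [P]. *)
Lemma under_height_one q (qp : prime_elt q) : height_one (point_under qp).
Proof.
have [q0 _ _] := qp; split.
  have [n en] := norm_inc q; exists n; last by rewrite -inc_eq0 -en norm_neq0.
  by apply/over_under; rewrite -en; apply: dv_norm.
move=> P Pq [a aP a0]; have [q' [n [q'p en nP]]] := mem_norm_prime aP a0.
have [i qi] : exists i, dv q (act i q').
  by apply: prime_dv_norm => //; rewrite en; apply/over_under/Pq.
move=> x /over_under qx; apply: dv_norm_mem en nP _.
apply/(act_dv i); rewrite sq_act_inc; apply: dv_trans qx.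
exact: prime_dv_sym qp (act_prime i q'p) qi.
Qed.

Definition div_under q (qp : prime_elt q) : primeDiv A := PrimeDiv (under_height_one qp).

(** Some prime [q] has its norm in [P]; the trace of [q] on [A] is then a nonzero prime contained in
    [P], and equals [P] because [P] has height one. *)
Lemma over_exists (P : primeDiv A) : exists2 q, prime_elt q & over q P.
Proof.
case: P => P [[a aP a0] hP] /=; have [q [n [qp en nP]]] := mem_norm_prime aP a0.
exists q => // x; split=> [|/(dv_norm_mem en nP)//].
move=> xP; apply/(over_under qp); apply: hP => //.
  by move=> y /over_under; apply: dv_norm_mem en nP.
exists n; first by apply/over_under; rewrite -en; apply: dv_norm.
by rewrite -inc_eq0 -en norm_neq0 //; case: qp.
Qed.

Lemma over_unique q (P P' : primeDiv A) : over q P -> over q P' -> P = P'.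
Proof. by move=> h h'; apply: primeDiv_eq => a; apply/idP/idP => [/h/h'|/h'/h]. Qed.

Lemma over_div_under q (qp : prime_elt q) (P : primeDiv A) : over q P -> P = div_under qp.
Proof. by move=> h; apply: over_unique h _; apply: over_under. Qed.

Lemma val_act i q s : prime_elt q -> s != 0 -> pval (act i q) (act i s) = pval q s.
Proof.
move=> qp s0; have [b qb e] := pvalP fS qp s0; apply: val_specE; first exact: act_prime.
by exists (act i b); [rewrite act_dv|rewrite {1}e rmorphM rmorphXn].
Qed.

Lemma val_eq_const a b : a != 0 -> b != 0 ->
  (forall p, prime_elt p -> pval p a = pval p b) -> exists2 c, c != 0 & a = kk c * b.
Proof.
move=> a0 b0 h; have [||u uu e] := fval_eq0_unit fS (f := tofrac a / tofrac b).
- by rewrite frac_eq0.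
- by move=> p pp; rewrite fval_div // h // subrr.
have e2 : a = u * b.
  apply/eqP; rewrite -tofrac_eq tofracM -e divfK //; by rewrite tofrac_eq0.
have [c ec] := sq_unit Q uu; exists c; last by rewrite -ec.
by apply: contraTneq uu => c0; rewrite ec c0 rmorph0 unitr0.
Qed.

Definition prime_of (P : primeDiv A) : S := s2val (cid2 (over_exists P)).

Lemma prime_of_prime P : prime_elt (prime_of P).
Proof. exact: s2valP (cid2 (over_exists P)). Qed.

Lemma over_prime_of P : over (prime_of P) P.
Proof. exact: s2valP' (cid2 (over_exists P)). Qed.

Lemma conj_primes (P : primeDiv A) p :
  p \in [seq act i (prime_of P) | i <- enum I] -> prime_elt p.
Proof. by move=> /mapP[i _ ->]; apply/act_prime/prime_of_prime. Qed.

(** The reduced equation in [S] of the preimage of [P]: by conjugacy the orbit of one prime over [P]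
    meets every associate class of primes over [P]. *)
Definition local_eq (P : primeDiv A) : S :=
  s2val (cid2 (squarefree_prod fS (@conj_primes P))).

Lemma local_eq_neq0 P : local_eq P != 0.
Proof. exact: s2valP (cid2 (squarefree_prod fS (@conj_primes P))). Qed.

Lemma val_local_eq P p : prime_elt p -> pval p (local_eq P) = `[< over p P >].
Proof.
move=> pp; rewrite /local_eq; case: cid2 => h /= _ ->//; congr (nat_of_bool _).
apply/asboolP/asboolP => [[_ /mapP[i _ ->] pi]|pP].
  apply: over_assoc pi _ => //; first exact/act_prime/prime_of_prime.
  exact/over_act/over_prime_of.
have [i pi] := over_conj pp pP (@over_prime_of P).
by exists (act i (prime_of P)) => //; apply/mapP; exists i; rewrite ?mem_enum.
Qed.

(** The group permutes the primes over [P], so a translate has the same multiplicities; the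
    resulting unit is a constant. *)
Lemma act_local_eq i P : exists2 c, c != 0 & act i (local_eq P) = kk c * local_eq P.
Proof.
apply: val_eq_const; rewrite ?act_eq0 ?local_eq_neq0 // => p pp.
have e : p = act i (act (inv i) p) by rewrite sq_actKV.
have p'p := act_prime (inv i) pp.
rewrite {1}e val_act ?local_eq_neq0 // !val_local_eq //.
by congr (nat_of_bool _); apply/asboolP/asboolP; rewrite over_act.
Qed.

(** Applied to the reduced form a/b of an invariant fraction: coprimality makes [b] and [act i b]
    divide each other, so the denominator is semi-invariant. *)
Lemma act_cofactor i a b : a != 0 -> b != 0 -> coprime_elt a b ->
  act i a * b = a * act i b -> exists2 c, c != 0 & act i b = kk c * b.
Proof.
move=> a0 b0 cab e; have [x ex] : dv b (act i b).
  by apply: (coprime_dvM fS b0 cab); rewrite -e; apply: dv_mull; apply: dv_refl.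
have cab' : coprime_elt (act i a) (act i b).
  move=> p pp; rewrite -(sq_actKV i p) !act_dv; apply: cab; exact: act_prime.
have [y ey] : dv (act i b) b.
  apply: (coprime_dvM fS _ cab'); rewrite ?act_eq0 // e.
  by apply: dv_mull; apply: dv_refl.
have xu : x \is a GRing.unit.
  apply: (@dv_unit _ 1); rewrite ?unitr1 //; exists y.
  by apply: (mulIf b0); rewrite mul1r {1}ey ex mulrA.
have [c ec] := sq_unit Q xu; exists c; last by rewrite -ec.
by apply: contraTneq xu => c0; rewrite ec c0 rmorph0 unitr0.
Qed.
End PrimesOver.

(** * Vanishing orders on the quotient computed in [S] *)

Section Orders.
Variables (k : fieldType) (S A : idomainType) (Q : small_quotient k S A).
Local Notation kk := (sq_const Q).
Local Notation inc := (sq_inc Q).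
Local Notation act := (@sq_act _ _ _ Q).
Local Notation gen := (@sq_gen _ _ _ Q).
Local Notation FS := {fraction S}.
Local Notation FA := {fraction A}.
Local Notation "a %:F" := (tofrac a).
Let fS := sq_factorial Q.

Definition incF : FA -> FS := frac_map (@sq_inc_inj _ _ _ Q).
Definition actF i : FS -> FS := frac_map (@act_inj _ _ _ Q i).
HB.instance Definition _ := GRing.RMorphism.on incF.
HB.instance Definition _ i := GRing.RMorphism.on (actF i).

Lemma incF_tofrac a : incF a%:F = (inc a)%:F.
Proof. exact: frac_map_tofrac. Qed.

Lemma actF_tofrac i a : actF i a%:F = (act i a)%:F.
Proof. exact: frac_map_tofrac. Qed.

Lemma incF_inj : injective incF.
Proof. exact: fmorph_inj. Qed.

Lemma incF_eq0 f : (incF f == 0) = (f == 0).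
Proof. by rewrite fmorph_eq0. Qed.

Lemma incF_div a b : incF (a%:F / b%:F) = (inc a)%:F / (inc b)%:F.
Proof. by rewrite fmorph_div /= !incF_tofrac. Qed.

Lemma actF_incF i f : actF i (incF f) = incF f.
Proof.
by elim/frac_ind: f => a b b0; rewrite incF_div fmorph_div /= !actF_tofrac !sq_act_inc.
Qed.

Lemma actF_cofactor i a b : a != 0 -> b != 0 -> coprime_elt a b ->
  actF i (a%:F / b%:F) = a%:F / b%:F -> exists2 c, c != 0 & act i b = kk c * b.
Proof.
move=> a0 b0 cab; rewrite fmorph_div /= !actF_tofrac => /frac_eq e.
by apply: (act_cofactor a0 b0 cab); rewrite e // act_eq0.
Qed.

(** Extend the fraction so that its denominator becomes the norm of [b]; the denominator is then
    invariant, and therefore so is the numerator. *)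
Lemma actF_fixed f : (forall t, actF (gen t) f = f) -> exists g, f = incF g.
Proof.
have [->|f0] := eqVneq f 0; first by exists 0; rewrite rmorph0.
have [a [b [b0 e cab]]] := frac_coprime fS f.
have [n en] := norm_inc Q b; have [b' eb] := dv_norm Q b => h.
have n0 : n != 0 by rewrite -(inc_eq0 Q) -en norm_neq0.
have [m em] : exists m, a * b' = inc m.
  apply: sq_incP => t; apply/eqP; rewrite -tofrac_eq -actF_tofrac.
  have -> : (a * b')%:F = f * (inc n)%:F.
    by rewrite -en eb e !tofracM mulrA mulrAC divfK ?tofrac_eq0 // mulrAC.
  by rewrite rmorphM /= h actF_tofrac sq_act_inc.
exists (m%:F / n%:F); rewrite incF_div e; apply/frac_eq; rewrite ?inc_eq0 //.
by rewrite -en eb -em; ring.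
Qed.

(** This is unramifiedness in codimension one. The value 1 is attained because [local_eq Q P] has
    multiplicity one at [q] and becomes invariant after multiplication by some [u] prime to [q]. *)
Lemma valuation_over (P : primeDiv A) q : prime_elt q -> over Q q P ->
  valuation_at P (fun f => fval q (incF f)).
Proof.
move=> qp qP; split=> [f g f0 g0||f f0].
- by rewrite rmorphM /= fvalM // incF_eq0.
- have [|u qu hu] := @sq_small _ _ _ Q (local_eq Q P) (local_eq_neq0 Q P) _ q qp.
    by move=> t; have [c _ e] := act_local_eq (gen t) P; exists c.
  have u0 : u != 0 by apply: contra_notN qu => /eqP->; apply: dv0.
  have [a ea] := sq_incP hu.
  have a0 : inc a != 0 by rewrite -ea mulf_neq0 // local_eq_neq0.
  exists a%:F; first by rewrite tofrac_eq0 -(inc_eq0 Q).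
  rewrite incF_tofrac fval_tofrac // -ea valM ?local_eq_neq0 //.
  by rewrite val_local_eq // asboolT // (val_ndv fS qp u0 qu).
- split=> [|[a [s [sP ef]]]]; last first.
    have s0 : s != 0 by apply: contraNneq sP => ->; apply: pt_0.
    have a0 : a != 0 by apply: contraNneq f0 => a0; rewrite ef a0 rmorph0 mul0r.
    rewrite ef incF_div fval_div ?inc_eq0 //.
    rewrite (val_ndv fS qp (a := inc s)) ?inc_eq0 ?subr0 //.
    by move=> /qP; apply/negP.
  have [a [b [b0 e cab]]] := frac_coprime fS (incF f).
  have a0 : a != 0 by move: f0; rewrite -incF_eq0 e frac_eq0.
  rewrite e fval_div // => h.
  have qb : ~ dv q b.
    move=> qb; have qa : ~ dv q a by move=> /cab; apply.
    have := (val_dv fS qp b0).2 qb; rewrite ltnNge => /negP; apply.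
    by move: h; rewrite (val_ndv fS qp a0 qa) sub0r oppr_ge0.
  (* The reduced denominator [b] is semi-invariant and prime to [q], so [b * u] is a denominator
     coming from [A] and outside [P]. *)
  have [|u qu hu] := @sq_small _ _ _ Q b b0 _ q qp.
    move=> t; have [|c _ ec] := @actF_cofactor (gen t) a b a0 b0 cab.
      by rewrite -e actF_incF.
    by exists c.
  have u0 : u != 0 by apply: contra_notN qu => /eqP->; apply: dv0.
  have [s es] := sq_incP hu.
  have auE : (a * u)%:F = incF (f * s%:F).
    by rewrite [RHS]rmorphM /= incF_tofrac -es e !tofracM mulrA divfK // tofrac_eq0.
  have [r er] : exists r, a * u = inc r.
    by apply: sq_incP => t; apply/eqP; rewrite -tofrac_eq -actF_tofrac auE actF_incF.
  have s0 : s != 0 by rewrite -(inc_eq0 Q) -es mulf_neq0.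
  exists r, s; split.
    by apply/negP => /qP; rewrite -es => /(prime_dvM qp)[].
  apply: incF_inj; rewrite incF_div -er auE -incF_tofrac -fmorph_div /=.
  by rewrite mulfK // tofrac_eq0.
Qed.

Lemma ord_fval (P : primeDiv A) q f : prime_elt q -> over Q q P -> f != 0 ->
  ord P f = fval q (incF f).
Proof. by move=> qp qP f0; apply: (ord_valuation (valuation_over qp qP)). Qed.

(** An equation on Spec S of the pullback of [D]. Since the local equations are fixed once and for
    all, it is multiplicative in [D] exactly and not only up to constants. *)
Definition div_elt (D : WDiv A) : FS := \prod_(P <- dom D) (local_eq Q P)%:F ^ coeff P D.

Lemma local_eqF_neq0 P : (local_eq Q P)%:F != 0 :> FS.
Proof. by rewrite tofrac_eq0 local_eq_neq0. Qed.

Lemma div_elt_sub (l : seq (primeDiv A)) D : uniq l -> {subset dom D <= l} ->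
  div_elt D = \prod_(P <- l) (local_eq Q P)%:F ^ coeff P D.
Proof.
move=> ul sub; rewrite (bigID (mem (dom D))) /= [X in _ * X]big1 => [|P].
  rewrite mulr1 -big_filter; apply: perm_big; apply: uniq_perm.
  - exact: uniq_dom.
  - by rewrite filter_uniq.
  - by move=> P; rewrite mem_filter; have [/sub->|] := boolP (P \in dom D).
by rewrite mem_dom negbK => /eqP ->.
Qed.

Lemma div_eltD D E : div_elt (D + E) = div_elt D * div_elt E.
Proof.
pose l := undup (dom D ++ dom E ++ dom (D + E)).
have hl F : {subset F <= dom D ++ dom E ++ dom (D + E)} -> {subset F <= l}.
  by move=> h P /h; rewrite mem_undup.
rewrite (@div_elt_sub l D) ?(@div_elt_sub l E) ?(@div_elt_sub l (D + E)) ?undup_uniq //.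
- by rewrite -big_split; apply: eq_bigr => P _; rewrite coeffD expfzDr ?local_eqF_neq0.
all: by apply: hl => P h; rewrite !mem_cat h ?orbT.
Qed.

Lemma div_elt_neq0 D : div_elt D != 0.
Proof.
by rewrite prodf_seq_neq0; apply/allP => P _; rewrite implyTb expfz_neq0 ?local_eqF_neq0.
Qed.

Lemma div_elt0 : div_elt 0 = 1.
Proof. by rewrite /div_elt dom0 big_nil. Qed.

Lemma div_eltN D : div_elt (- D) = (div_elt D)^-1.
Proof.
apply: (mulIf (div_elt_neq0 D)); rewrite mulVf ?div_elt_neq0 //.
by rewrite -div_eltD addNr div_elt0.
Qed.

Lemma fval_div_elt (P : primeDiv A) q D : prime_elt q -> over Q q P ->
  fval q (div_elt D) = coeff P D.
Proof.
move=> qp qP; rewrite (@div_elt_sub (undup (P :: dom D))) ?undup_uniq //; last first.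
  by move=> x xD; rewrite mem_undup in_cons xD orbT.
rewrite fval_prod // => [|x]; last by rewrite expfz_neq0 ?local_eqF_neq0.
rewrite (bigD1_seq P) ?undup_uniq ?mem_undup ?mem_head //= big1 => [|x xP].
  rewrite fvalXz ?local_eqF_neq0 // fval_tofrac ?local_eq_neq0 // val_local_eq //.
  by rewrite asboolT // addr0 intz.
rewrite fvalXz ?local_eqF_neq0 // fval_tofrac ?local_eq_neq0 // val_local_eq //.
rewrite asboolF ?mul0rz // => qx; case/eqP: xP; exact: over_unique qx qP.
Qed.

Lemma fval_eq_const f g : f != 0 -> g != 0 ->
  (forall p, prime_elt p -> fval p f = fval p g) ->
  exists2 c, c != 0 & f = (kk c)%:F * g.
Proof.
move=> f0 g0 h; have [||u uu e] := fval_eq0_unit fS (f := f / g).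
- by rewrite mulf_neq0 ?invr_eq0.
- by move=> p pp; rewrite fvalM ?fvalV ?invr_eq0 // h // subrr.
have [c ec] := sq_unit Q uu; exists c; last by rewrite -ec -e divfK.
by apply: contraTneq uu => c0; rewrite ec c0 rmorph0 unitr0.
Qed.

Lemma div_of_elt f D : div_of f D -> exists2 c, c != 0 & incF f = (kk c)%:F * div_elt D.
Proof.
move=> [f0 h]; apply: fval_eq_const; rewrite ?incF_eq0 ?div_elt_neq0 // => p pp.
have pP : over Q p (div_under Q pp) := over_under Q pp.
by rewrite (fval_div_elt D pp pP) h (ord_fval pp pP).
Qed.

Lemma elt_div_of f c D : c != 0 -> incF f = (kk c)%:F * div_elt D -> div_of f D.
Proof.
move=> c0 e; have cF0 : (kk c)%:F != 0 by rewrite tofrac_eq0 const_eq0.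
have f0 : f != 0 by rewrite -incF_eq0 e mulf_neq0 ?div_elt_neq0.
split=> // P; have pp := prime_of_prime Q P; have pP := @over_prime_of _ _ _ Q P.
rewrite (ord_fval pp pP) // e fvalM ?div_elt_neq0 //.
rewrite fval_tofrac ?const_eq0 // (val_unit fS pp (const_unit Q c0)) add0r.
by rewrite (fval_div_elt D pp pP).
Qed.

Lemma finite_support s : s != 0 ->
  exists r : seq (primeDiv A), forall P, pval (prime_of Q P) s != 0%N -> P \in r.
Proof.
move=> s0; have [u [l [uu lp ->]]] := fS s0.
have u0 : u != 0 by apply: contraTneq uu => ->; rewrite unitr0.
elim: l lp {s s0} => [_|q l IH lp].
  by exists [::] => P; rewrite big_nil mulr1 (val_unit fS) //; apply: prime_of_prime.
have [r hr] := IH (fun x xl => lp x (@mem_behead _ (q :: l) x xl)).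
have qp : prime_elt q by apply: lp; rewrite mem_head.
exists (div_under Q qp :: r) => P; have pp := prime_of_prime Q P.
have [q0 _ _] := qp.
have l0 : u * \prod_(p <- l) p != 0.
  rewrite mulf_neq0 // prodf_seq_neq0; apply/allP => x xl.
  by have [] := lp x (@mem_behead _ (q :: l) x xl).
rewrite big_cons mulrCA valM // in_cons; have [pq|npq] := pselect (dv (prime_of Q P) q).
  move=> _; apply/orP; left; apply/eqP/over_div_under.
  by apply: over_assoc (prime_dv_sym pp qp pq) _ => //; apply: over_prime_of.
by rewrite (val_ndv fS pp q0 npq) add0n => /hr ->; rewrite orbT.
Qed.

(** A semi-invariant has the same multiplicity at conjugate primes, so its divisor is pulled back
    from [A]. *)
Lemma semi_div_elt s : s != 0 ->
  (forall i, exists2 c, c != 0 & act i s = kk c * s) ->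
  exists D, exists2 c, c != 0 & s%:F = (kk c)%:F * div_elt D.
Proof.
move=> s0 hs; have [r hr] := finite_support s0.
pose D : WDiv A := \sum_(P <- undup r) << (pval (prime_of Q P) s)%:Z *g P >>.
have DE P : coeff P D = pval (prime_of Q P) s.
  rewrite /D raddf_sum /=; have [Pr|Pr] := boolP (P \in undup r).
    rewrite (bigD1_seq P) ?undup_uniq //= coeffU eqxx mulr1 big1 ?addr0 // => x xP.
    by rewrite coeffU (negPf xP) mulr0.
  rewrite big_seq big1 => [|x xr]; last first.
    by rewrite coeffU; case: eqP => [e|_]; rewrite ?mulr0 //; rewrite -e xr in Pr.
  by apply/esym; congr Posz; apply/eqP; apply: contraNT Pr => /hr; rewrite mem_undup.
exists D; apply: fval_eq_const; rewrite ?tofrac_eq0 ?div_elt_neq0 // => p pp.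
have pP : over Q p (div_under Q pp) := over_under Q pp.
rewrite (fval_div_elt D pp pP) DE fval_tofrac //; congr Posz.
have [i pi] := over_conj pp pP (@over_prime_of _ _ _ Q (div_under Q pp)).
set q := prime_of _ _ in pi *; have qp : prime_elt q := prime_of_prime Q _.
rewrite (val_eq_assoc fS _ pp (act_prime i qp) pi).
have [c c0 ec] := hs i; rewrite -(val_act i qp s0) ec valM ?const_eq0 //.
  by rewrite (val_unit fS (act_prime i qp) (const_unit Q c0)).
exact: act_prime.
Qed.
End Orders.

(** * The class group *)

Lemma sum_fibers (V : nmodType) (J K : eqType) (h : J -> K) (l : seq J) (r : seq K)
    (G : J -> V) : uniq r -> {subset map h l <= r} ->
  \sum_(j <- l) G j = \sum_(w <- r) \sum_(j <- l | h j == w) G j.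
Proof.
move=> ur hl; rewrite (exchange_big_dep xpredT) //= big_seq [RHS]big_seq.
apply: eq_bigr => j jl; rewrite -big_filter.
rewrite (_ : [seq i <- r | h j == i] = [:: h j]) ?big_seq1 //.
apply: perm_small_eq => //; apply: uniq_perm; rewrite ?filter_uniq //.
move=> w; rewrite mem_filter inE [in RHS]eq_sym.
by case: eqP => // <-; rewrite hl // map_f.
Qed.

(** Identifies [M] with the characters of the acting group that occur on semi-invariants, each
    character being given by its values on the generators. *)
Record weight_system (k : fieldType) (S A : idomainType) (Q : small_quotient k S A)
    (M : zmodType) := WeightSystem {
  ws_chi : M -> sq_T Q -> k;
  ws_chi_neq0 : forall w t, ws_chi w t != 0;
  ws_chiD : forall v w t, ws_chi (v + w) t = ws_chi v t * ws_chi w t;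
  ws_chi_inj : forall v w, ws_chi v =1 ws_chi w -> v = w;
  ws_semi_ex : forall w, exists2 s : S, s != 0
    & forall t, @sq_act _ _ _ Q (sq_gen t) s = sq_const Q (ws_chi w t) * s;
  ws_weight : forall s : S, s != 0 ->
    (forall t, exists c, @sq_act _ _ _ Q (sq_gen t) s = sq_const Q c * s) ->
    exists w, forall t, @sq_act _ _ _ Q (sq_gen t) s = sq_const Q (ws_chi w t) * s
}.

(** The usual independence of eigenvectors: subtracting [chi v t] times the relation from its image
    under [a t] removes the term of [v], and [t] is chosen so that the coefficient at [w] stays
    nonzero. *)
Lemma eigen_indep (k : fieldType) (V : idomainType) (c : {rmorphism k -> V}) (T : Type)
    (J : eqType) (a : T -> {additive V -> V}) (chi : J -> T -> k) :
  (forall v w, chi v =1 chi w -> v = w) ->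
  (forall t d x, a t (c d * x) = c d * a t x) ->
  forall (r : seq J) (f : J -> V), uniq r ->
  (forall w t, a t (f w) = c (chi w t) * f w) -> \sum_(w <- r) f w = 0 ->
  forall w, w \in r -> f w = 0.
Proof.
move=> chi_inj ac; elim=> [//|v r IH] f /= /andP[vr ur] hf e.
have tail w : w \in r -> f w = 0.
  move=> wr; have wv : w != v by apply: contraNneq vr => <-.
  have [t ht] : exists t, chi w t != chi v t.
    apply: contrapT => /forallNP h; case/eqP: wv; apply: chi_inj => t.
    by apply/eqP; have /negP := h t; rewrite negbK.
  pose g x := c (chi x t - chi v t) * f x.
  have : g w = 0.
    apply: (IH g ur) => // [x u|]; first by rewrite /g ac hf; ring.
    have : a t (\sum_(x <- v :: r) f x) - c (chi v t) * (\sum_(x <- v :: r) f x) = 0.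
      by rewrite e raddf0 mulr0 subrr.
    rewrite raddf_sum mulr_sumr -sumrB big_cons /= hf subrr add0r => h; rewrite -[RHS]h.
    by apply: eq_bigr => x _; rewrite /g hf rmorphB mulrBl.
  by move/eqP; rewrite mulf_eq0 fmorph_eq0 subr_eq0 (negPf ht) => /eqP.
move=> w; rewrite in_cons => /orP[/eqP->|/tail//].
by move: e; rewrite big_cons big_seq big1 ?addr0 // => x /tail.
Qed.

Section ClassGroup.
Variables (k : fieldType) (S A : idomainType) (Q : small_quotient k S A).
Variables (M : zmodType) (W : weight_system Q M).
Local Notation kk := (sq_const Q).
Local Notation act := (@sq_act _ _ _ Q).
Local Notation gen := (@sq_gen _ _ _ Q).
Local Notation chi := (ws_chi W).
Local Notation FS := {fraction S}.
Local Notation "a %:F" := (tofrac a).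
Local Notation incF := (incF Q).
Local Notation actF := (@actF _ _ _ Q).
Local Notation div_elt := (div_elt Q).

Definition semi w s : Prop := forall t, act (gen t) s = kk (chi w t) * s.
Definition semiF w (f : FS) : Prop := forall t, actF (gen t) f = (kk (chi w t))%:F * f.

Lemma semiF_tofrac w s : semiF w s%:F <-> semi w s.
Proof.
split=> h t; last by rewrite actF_tofrac h tofracM.
by apply/eqP; rewrite -tofrac_eq tofracM -actF_tofrac h.
Qed.

Lemma chi0 t : chi 0 t = 1.
Proof.
have := ws_chiD W 0 0 t; rewrite addr0 => /eqP.
by rewrite -{1}[chi 0 t]mulr1 (inj_eq (mulfI (ws_chi_neq0 W 0 t))) => /eqP.
Qed.

Lemma chiN w t : chi (- w) t = (chi w t)^-1.
Proof.
apply: (mulIf (ws_chi_neq0 W w t)).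
by rewrite mulVf ?ws_chi_neq0 // -ws_chiD addNr chi0.
Qed.

Lemma semiF_unique v w f : f != 0 -> semiF v f -> semiF w f -> v = w.
Proof.
move=> f0 hv hw; apply: (@ws_chi_inj _ _ _ _ _ W) => t.
have := hv t; rewrite hw => /(mulIf f0)/eqP; rewrite tofrac_eq => /eqP.
by move/fmorph_inj.
Qed.

Lemma semiFM v w f g : semiF v f -> semiF w g -> semiF (v + w) (f * g).
Proof. by move=> hf hg t; rewrite rmorphM /= hf hg ws_chiD rmorphM tofracM; ring. Qed.

Lemma semiFV w f : semiF w f -> semiF (- w) f^-1.
Proof.
move=> hf t; have n0 : (kk (chi w t))%:F != 0 by rewrite tofrac_eq0 const_eq0 ws_chi_neq0.
rewrite fmorphV /= hf chiN invfM; congr (_ * _); apply: (mulIf n0).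
by rewrite mulVf // -tofracM -rmorphM mulVf ?ws_chi_neq0 // rmorph1 tofrac1.
Qed.

Lemma semiF1 : semiF 0 1.
Proof. by move=> t; rewrite rmorph1 chi0 !rmorph1 mulr1. Qed.

Lemma semiFX w f n : semiF w f -> semiF (w *+ n) (f ^+ n).
Proof.
move=> hf; elim: n => [|n IH]; first exact: semiF1.
by rewrite mulrS exprS; apply: semiFM.
Qed.

Lemma semiFXz w f n : semiF w f -> semiF (w *~ n) (f ^ n).
Proof. by move=> hf; case: n => n; [|apply: semiFV]; apply: semiFX. Qed.

Lemma semiFZ w c f : semiF w f -> semiF w ((kk c)%:F * f).
Proof. by move=> hf t; rewrite rmorphM /= actF_tofrac sq_act_const hf; ring. Qed.

Lemma semiFD w f g : semiF w f -> semiF w g -> semiF w (f + g).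
Proof. by move=> hf hg t; rewrite rmorphD /= hf hg; ring. Qed.

Lemma semiF0 w : semiF w 0.
Proof. by move=> t; rewrite rmorph0 mulr0. Qed.

Lemma semiF_incF f : semiF 0 (incF f).
Proof. by move=> t; rewrite actF_incF chi0 rmorph1 tofrac1 mul1r. Qed.

Lemma semiF0_incF f : semiF 0 f -> exists g, f = incF g.
Proof.
by move=> h; apply: actF_fixed => t; rewrite h chi0 rmorph1 tofrac1 mul1r.
Qed.

Lemma weight_ex D : exists w, semiF w (div_elt D).
Proof.
rewrite /div_elt; elim: (dom D) => [|P l [w hw]].
  by exists 0; rewrite big_nil; apply: semiF1.
rewrite big_cons; have [|v hv] := @ws_weight _ _ _ _ _ W (local_eq Q P) (local_eq_neq0 Q P).
  by move=> t; have [c _ e] := act_local_eq (gen t) P; exists c.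
exists (v *~ coeff P D + w); apply: semiFM => //.
by apply: semiFXz; apply/semiF_tofrac.
Qed.

Definition weight D : M := sval (cid (weight_ex D)).

Lemma weightP D : semiF (weight D) (div_elt D).
Proof. exact: svalP (cid (weight_ex D)). Qed.

Lemma weight_unique D w : semiF w (div_elt D) -> weight D = w.
Proof. exact: semiF_unique (div_elt_neq0 Q D) (weightP D). Qed.

Lemma weightD D E : weight (D + E) = weight D + weight E.
Proof. by apply: weight_unique; rewrite div_eltD; apply: semiFM; apply: weightP. Qed.

Lemma weightN D : weight (- D) = - weight D.
Proof. by apply: weight_unique; rewrite div_eltN; apply: semiFV; apply: weightP. Qed.

Lemma weightB D E : weight (D - E) = weight D - weight E.
Proof. by rewrite weightD weightN. Qed.

(** Weight zero means that the equation of [D] is fixed by the group, so it comes from a rational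
    function on the quotient, whose divisor is [D]. *)
Lemma principal_weight D : D \in @principal A <-> weight D = 0.
Proof.
split=> [/asboolP[f /(div_of_elt Q)[c c0 e]]|w0].
  apply: weight_unique; have -> : div_elt D = (kk c^-1)%:F * incF f.
    rewrite e mulrA -tofracM -rmorphM mulVf // rmorph1 tofrac1 mul1r //.
  exact/semiFZ/semiF_incF.
have [g e] : exists g, div_elt D = incF g.
  by apply: semiF0_incF; rewrite -w0; apply: weightP.
apply/asboolP; exists g; apply: (@elt_div_of _ _ _ Q g 1); rewrite ?oner_neq0 //.
by rewrite rmorph1 tofrac1 mul1r.
Qed.

Lemma divisor_of_semi w s : s != 0 -> semi w s ->
  exists D, exists2 c, c != 0 & s%:F = (kk c)%:F * div_elt D.
Proof.
move=> s0 hs; apply: semi_div_elt => // i.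
have [|c e] := @sq_genP _ _ _ Q s _ i; first by move=> t; exists (chi w t).
exists c => //; apply: contraNneq s0 => c0; rewrite -(act_eq0 i).
by rewrite e c0 rmorph0 mul0r.
Qed.

Lemma weight_surj w : exists D, weight D = w.
Proof.
have [s s0 hs] := ws_semi_ex W w; have [D [c c0 e]] := divisor_of_semi s0 hs.
exists D; apply: weight_unique; have -> : div_elt D = (kk c^-1)%:F * s%:F.
  by rewrite e mulrA -tofracM -rmorphM mulVf // rmorph1 tofrac1 mul1r.
exact/semiFZ/semiF_tofrac.
Qed.

Lemma cl_eqP (D E : WDiv A) : cl D = cl E <-> D - E \in @principal A.
Proof. by rewrite /cl Quotient.idealrBE; split=> /eqP. Qed.

Lemma cl_repr (x : Cl A) : cl (repr x) = x.
Proof. by rewrite /cl reprK. Qed.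

Definition cl_weight (x : Cl A) : M := weight (repr x).

Lemma cl_weightE D : cl_weight (cl D) = weight D.
Proof.
apply/eqP; rewrite -subr_eq0 -weightB; apply/eqP/principal_weight/cl_eqP.
exact: cl_repr.
Qed.

Lemma cl_weight_zmod : zmod_morphism cl_weight.
Proof.
move=> x y; rewrite -[x]cl_repr -[y]cl_repr.
have -> : cl (repr x) - cl (repr y) = cl (repr x - repr y).
  by rewrite /cl raddfB.
by rewrite !cl_weightE weightB.
Qed.

HB.instance Definition _ := GRing.isZmodMorphism.Build (Cl A) M cl_weight cl_weight_zmod.

Lemma cl_weight_bij : bijective cl_weight.
Proof.
pose g w := cl (sval (cid (weight_surj w))).
have gK : cancel g cl_weight by move=> w; rewrite cl_weightE; apply: (svalP (cid (weight_surj w))).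
exists g => // x; have := gK (cl_weight x); move: (g _) => y.
rewrite -[x]cl_repr -[y]cl_repr !cl_weightE => /eqP.
by rewrite -subr_eq0 -weightB => /eqP/principal_weight/cl_eqP.
Qed.

Lemma semiF_indep (r : seq M) (f : M -> FS) : uniq r ->
  (forall w, semiF w (f w)) -> \sum_(w <- r) f w = 0 ->
  forall w, w \in r -> f w = 0.
Proof.
move=> ur hf; apply: (@eigen_indep k FS (@tofrac S \o kk) _ _
  (fun t => actF (gen t)) chi (@ws_chi_inj _ _ _ _ _ W)) => // t d x /=.
by rewrite rmorphM /= actF_tofrac sq_act_const.
Qed.
End ClassGroup.

(** * The Cox ring *)

Section CharacterExtension.
Variables (k : closedFieldType) (G : zmodType).

(** A subgroup given as a predicate, with a character on it given as a total function whose values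
    outside the subgroup are meaningless. *)
Definition partial_char (B : G -> Prop) (c : G -> k) : Prop :=
  [/\ B 0, forall x y, B x -> B y -> B (x - y), forall x, B x -> c x != 0
    & forall x y, B x -> B y -> c (x + y) = c x * c y].

Section Closure.
Variables (B : G -> Prop) (c : G -> k).
Hypothesis Bc : partial_char B c.

Lemma pcharB x y : B x -> B y -> B (x - y).
Proof. by case: Bc => _ h _ _; apply: h. Qed.

Lemma pcharN x : B x -> B (- x).
Proof. by rewrite -[- x]sub0r; case: Bc => B0 _ _ _; apply: pcharB. Qed.

Lemma pcharD x y : B x -> B y -> B (x + y).
Proof. by move=> Bx By; rewrite -[y]opprK; apply: pcharB => //; apply: pcharN. Qed.

Lemma pchar_neq0 x : B x -> c x != 0.
Proof. by case: Bc => _ _ h _; apply: h. Qed.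

Lemma pcharM x y : B x -> B y -> c (x + y) = c x * c y.
Proof. by case: Bc => _ _ _ h; apply: h. Qed.

Lemma pchar0 : c 0 = 1.
Proof.
have [B0 _ _ _] := Bc; have := pcharM B0 B0; rewrite addr0 => /eqP.
by rewrite -{1}[c 0]mulr1 (inj_eq (mulfI (pchar_neq0 B0))) => /eqP.
Qed.

Lemma pcharV x : B x -> c (- x) = (c x)^-1.
Proof.
move=> Bx; apply: (mulIf (pchar_neq0 Bx)).
by rewrite mulVf ?pchar_neq0 // -pcharM ?addNr ?pchar0 //; apply: pcharN.
Qed.

Lemma pcharX x (n : int) : B x -> B (x *~ n) /\ c (x *~ n) = c x ^ n.
Proof.
have [B0 _ _ _] := Bc => Bx.
have nat_case m : B (x *+ m) /\ c (x *+ m) = c x ^+ m.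
  elim: m => [|m [IH e]]; first by rewrite mulr0n expr0 pchar0.
  by rewrite mulrS exprS pcharM // e; split=> //; apply: pcharD.
case: n => m; first exact: nat_case.
have [h e] := nat_case m.+1; rewrite NegzE mulrNz; split; first exact: pcharN.
by rewrite pcharV // e.
Qed.

(** The value to assign to a new element [e]: if [d] is the least positive integer with [d] times
    [e] in the subgroup, a [d]-th root of the given value there; if there is none, 1. *)
Lemma pchar_root e : exists2 z, z != 0 & forall n : int, B (e *~ n) -> c (e *~ n) = z ^ n.
Proof.
have [ex|nex] := pselect (exists n, (0 < n)%N && `[< B (e *+ n) >]).
  case: (ex_minnP ex) => d /andP[d0 /asboolP Bd] mind.
  have [z ez] : exists z, z ^+ d = c (e *+ d).
    (* Only the constant coefficient is nonzero, so the equation solved is z^d = c(d e). *)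
    have [z hz] := solve_monicpoly (fun i => if i == 0%N then c (e *+ d) else 0) d0.
    exists z; rewrite hz; case: d d0 {Bd mind hz} => // d _.
    rewrite big_ord_recl /= expr0 mulr1 big1 ?addr0 // => i _; by rewrite mul0r.
  have z0 : z != 0.
    by apply: contraTneq (pchar_neq0 Bd) => z0; rewrite -ez z0 expr0n gtn_eqF // eqxx.
  exists z => // n Bn; have en := divz_eq n d.
  have dn0 : d%:Z != 0 by rewrite -lt0n.
  have [Bq cq] := pcharX (n %/ d)%Z Bd.
  have Br : B (e *~ (n %% d)%Z).
    have -> : e *~ (n %% d)%Z = e *~ n - e *+ d *~ (n %/ d)%Z.
      by rewrite pmulrn -mulrzA -mulrzBr; congr (_ *~ _); rewrite /modz mulrC.
    exact: pcharB.
  (* A nonzero remainder would be a positive multiple smaller than [d]. *)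
  have r0 : (n %% d)%Z = 0.
    have := modz_ge0 n dn0; have := ltz_pmod n (d := d).
    case: (n %% d)%Z Br => // r Br /(_ d0) rd _; case: r Br rd => // r Br rd.
    have : (d <= r.+1)%N by apply: mind; rewrite ltn0Sn; apply/asboolP.
    by rewrite leqNgt -ltz_nat rd.
  rewrite en r0 addr0 mulrC mulrzA -pmulrn cq -ez.
  by rewrite -exprz_exp.
exists 1; rewrite ?oner_neq0 // => n Bn; rewrite exp1rz.
have pos m : B (e *+ m) -> m = 0%N.
  move=> Bm; apply/eqP; rewrite -leqn0 leqNgt; apply/negP => m0.
  by apply: nex; exists m; rewrite m0; apply/asboolP.
case: n Bn => n; first by move=> /pos ->; rewrite mulr0z pchar0.
by rewrite NegzE mulrNz => /pcharN; rewrite opprK => /pos.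
Qed.

(** On [x] with [x - n e] in [B] the extension is [c (x - n e) * z ^ n]; the property of [z] from
    [pchar_root] makes this independent of the chosen [n]. *)
Lemma pchar_extend e : exists B' c', [/\ partial_char B' c', forall x, B x -> B' x,
  B' e & forall x, B x -> c' x = c x].
Proof.
have [B0 _ _ _] := Bc; have [z z0 hz] := pchar_root e.
pose B' x := exists n : int, B (x - e *~ n).
pose c' x := c (x - e *~ xget 0 (fun n : int => B (x - e *~ n)))
               * z ^ xget 0 (fun n : int => B (x - e *~ n)).
have c'E x n : B (x - e *~ n) -> c' x = c (x - e *~ n) * z ^ n.
  move=> Bn; rewrite /c'; case: xgetP => [m _ Bm|/(_ n)//].
  have Bnm : B (e *~ (m - n)).
    by rewrite mulrzBr -[e *~ m](subrK x) -opprB -addrA addrC; apply: pcharB.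
  have -> : x - e *~ n = (x - e *~ m) + e *~ (m - n).
    by rewrite mulrzBr addrA subrK.
  by rewrite (pcharM Bm Bnm) (hz _ Bnm) -mulrA -expfzDr // subrK.
exists B', c'; split.
- split.
  + by exists 0; rewrite mulr0z subr0.
  + move=> x y [n Bx] [m By]; exists (n - m).
    have -> : x - y - e *~ (n - m) = (x - e *~ n) - (y - e *~ m).
      by rewrite mulrzBr !opprB addrACA [- y + _]addrC addrACA.
    exact: pcharB.
  + by move=> x [n Bx]; rewrite (c'E x n Bx) mulf_neq0 ?expfz_neq0 ?pchar_neq0.
  + move=> x y [n Bx] [m By].
    have e1 : x + y - e *~ (n + m) = (x - e *~ n) + (y - e *~ m).
      by rewrite mulrzDr opprD addrACA.
    have Bxy : B (x + y - e *~ (n + m)) by rewrite e1; apply: pcharD.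
    rewrite (c'E _ _ Bxy) (c'E _ _ Bx) (c'E _ _ By) e1 (pcharM Bx By) expfzDr //; ring.
- by move=> x Bx; exists 0; rewrite mulr0z subr0.
- by exists 1; rewrite mulr1z subrr.
- move=> x Bx; have Bx0 : B (x - e *~ 0) by rewrite mulr0z subr0.
  by rewrite (c'E _ _ Bx0) mulr0z subr0 expr0z mulr1.
Qed.
End Closure.

Lemma char_extension (s : seq G) (B : G -> Prop) (c : G -> k) : partial_char B c ->
  exists B' c', [/\ partial_char B' c', forall x, B x -> B' x,
    forall x, x \in s -> B' x & forall x, B x -> c' x = c x].
Proof.
elim: s B c => [|e s IH] B c Bc; first by exists B, c.
have [B1 [c1 [h1 BB1 B1e cc1]]] := pchar_extend Bc e.
have [B2 [c2 [h2 B12 B2s c12]]] := IH B1 c1 h1.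
exists B2, c2; split=> // [x /BB1/B12//|x|x Bx].
  by rewrite in_cons => /orP[/eqP ->|/B2s//]; apply: B12.
by rewrite c12 ?cc1 //; apply: BB1.
Qed.
End CharacterExtension.

Section CoxRing.
Variables (k : closedFieldType) (S A : idomainType) (Q : small_quotient k S A).
Variables (M : zmodType) (W : weight_system Q M) (cd : cox_data A).
Local Notation kk := (sq_const Q).
Local Notation FS := {fraction S}.
Local Notation FA := {fraction A}.
Local Notation FK := (galg FA (WDiv A)).
Local Notation "a %:F" := (tofrac a).
Local Notation incF := (incF Q).
Local Notation div_elt := (div_elt Q).
Local Notation weight := (weight W).
Local Notation K := (cox_grp cd).
Local Notation chi := (chi cd).
Let fS := sq_factorial Q.

Lemma constF_inj c d : (kk c)%:F = (kk d)%:F -> c = d.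
Proof. by move/eqP; rewrite tofrac_eq => /eqP /fmorph_inj. Qed.

(** On principal divisors in K both [chi E] and [div_elt E] are multiplicative and have the same
    divisor, so their quotient is a character with constant values. It is extended to K through the
    finitely many generators of K. *)
Lemma twist_exists : exists c : WDiv A -> k,
  [/\ forall D, D \in K -> c D != 0,
      forall D E, D \in K -> E \in K -> c (D + E) = c D * c E
    & forall E, E \in K -> E \in @principal A ->
        incF (chi E) = (kk (c E))%:F * div_elt E].
Proof.
pose c0 E := xget 1 (fun c => incF (chi E) = (kk c)%:F * div_elt E).
have c0E E : E \in K -> E \in @principal A ->
    c0 E != 0 /\ incF (chi E) = (kk (c0 E))%:F * div_elt E.
  move=> EK Epr; have ch := chi_div EK Epr; have [c cn e] := div_of_elt Q ch.
  rewrite /c0; case: xgetP => [d _ e'|/(_ c)//]; split=> //.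
  have [f0 _] := ch; apply: contraNneq f0 => d0; rewrite -(incF_eq0 Q) e' d0.
  by rewrite rmorph0 rmorph0 mul0r.
pose B E := E \in K /\ E \in @principal A.
have Bc : partial_char B c0.
  split; [by split; apply: rpred0|by move=> x y [xK xp] [yK yp]; split; apply: rpredB| |].
    by move=> x [xK xp]; have [] := c0E x xK xp.
  move=> x y [xK xp] [yK yp]; have [_ ex] := c0E x xK xp; have [_ ey] := c0E y yK yp.
  have [_] := c0E (x + y) (rpredD xK yK) (rpredD xp yp).
  rewrite chiD // rmorphM /= ex ey div_eltD mulrACA => /esym.
  move/(mulIf (mulf_neq0 (div_elt_neq0 Q x) (div_elt_neq0 Q y))).
  by rewrite -tofracM -rmorphM => /constF_inj.
have [s [sK hs]] := cox_grp_fg cd.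
have [B' [c [Bc' BB' sB cc]]] := char_extension s Bc.
have KB D : D \in K -> B' D.
  move=> /hs[n ->]; apply: big_ind; first by case: Bc'.
    by move=> x y; apply: (pcharD Bc').
  by move=> i _; have [] := pcharX Bc' (n i) (sB s`_i (mem_nth _ (ltn_ord i))).
exists c; split.
- by move=> D /KB; apply: pchar_neq0.
- by move=> D E /KB BD /KB; apply: (pcharM Bc').
- by move=> E EK Epr; rewrite cc //; have [] := c0E E EK Epr.
Qed.

Definition twist := sval (cid twist_exists).

Lemma twist_neq0 D : D \in K -> twist D != 0.
Proof. by have [h _ _] := svalP (cid twist_exists); apply: h. Qed.

(* A homomorphism from K to the units of Frac S that extends chi and assigns  *)
(* to each divisor an element defining it on Spec S.                          *)
Definition cox_elt D : FS := (kk (twist D))%:F * div_elt D.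

Lemma cox_elt_neq0 D : D \in K -> cox_elt D != 0.
Proof. by move=> /twist_neq0 h; rewrite mulf_neq0 ?div_elt_neq0 // tofrac_eq0 const_eq0. Qed.

Lemma cox_eltD D E : D \in K -> E \in K -> cox_elt (D + E) = cox_elt D * cox_elt E.
Proof.
move=> DK EK; have [_ h _] := svalP (cid twist_exists).
by rewrite /cox_elt /twist h // div_eltD rmorphM tofracM mulrACA.
Qed.

Lemma cox_elt_chi E : E \in K -> E \in @principal A -> cox_elt E = incF (chi E).
Proof. by have [_ _ h] := svalP (cid twist_exists) => EK Ep; rewrite h. Qed.

Lemma cox_elt0 : cox_elt 0 = 1.
Proof.
have h := cox_eltD (rpred0 K) (rpred0 K); rewrite addr0 in h.
apply: (mulIf (cox_elt_neq0 (rpred0 K))); by rewrite mul1r -h.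
Qed.

Lemma cox_eltN D : D \in K -> cox_elt (- D) = (cox_elt D)^-1.
Proof.
move=> DK; apply: (mulIf (cox_elt_neq0 DK)).
by rewrite mulVf ?cox_elt_neq0 // -cox_eltD ?rpredN // addNr cox_elt0.
Qed.

Lemma semiF_cox_elt D : semiF W (weight D) (cox_elt D).
Proof. exact/semiFZ/weightP. Qed.

Lemma fval_cox_elt (P : primeDiv A) q D : D \in K -> prime_elt q -> over Q q P ->
  fval q (cox_elt D) = coeff P D.
Proof.
move=> DK qp qP; have t0 := twist_neq0 DK.
rewrite fvalM ?div_elt_neq0 ?tofrac_eq0 ?const_eq0 // (fval_div_elt D qp qP).
by rewrite fval_tofrac ?const_eq0 // (val_unit fS qp (const_unit Q t0)) add0r.
Qed.

(** Evaluates the monomial of degree [D] at [cox_elt D]. It is multiplicative on elements supported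
    in K, where [cox_elt] is a homomorphism. *)
Definition ev (x : FK) : FS := \sum_(D <- dom x) incF (coeff D x) * cox_elt D.

Lemma ev_sub (l : seq (WDiv A)) x : uniq l -> {subset dom x <= l} ->
  ev x = \sum_(D <- l) incF (coeff D x) * cox_elt D.
Proof.
move=> ul sub; rewrite [RHS](bigID (mem (dom x))) /= [X in _ + X]big1 => [|D].
  rewrite addr0 -big_filter; apply: perm_big; apply: uniq_perm.
  - exact: uniq_dom.
  - by rewrite filter_uniq.
  - by move=> D; rewrite mem_filter; have [/sub->|] := boolP (D \in dom x).
by rewrite mem_dom negbK => /eqP ->; rewrite rmorph0 mul0r.
Qed.

Lemma evB x y : ev (x - y) = ev x - ev y.
Proof.
pose l := undup (dom x ++ dom y ++ dom (x - y)).
have hl (z : FK) : {subset dom z <= dom x ++ dom y ++ dom (x - y)} -> {subset dom z <= l}.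
  by move=> h P /h; rewrite mem_undup.
rewrite (@ev_sub l x) ?(@ev_sub l y) ?(@ev_sub l (x - y)) ?undup_uniq //.
- by rewrite -sumrB; apply: eq_bigr => D _; rewrite coeffB rmorphB /= mulrBl.
all: by apply: hl => P h; rewrite !mem_cat h ?orbT.
Qed.

Lemma ev0 : ev 0 = 0.
Proof. by rewrite -[X in ev X](subrr 0) evB subrr. Qed.

Lemma evD x y : ev (x + y) = ev x + ev y.
Proof. by rewrite -[y]opprK evB -[- y]sub0r evB ev0 sub0r opprK opprB subr0. Qed.

Lemma ev_sum (J : Type) (r : seq J) (G : J -> FK) :
  ev (\sum_(j <- r) G j) = \sum_(j <- r) ev (G j).
Proof. exact: (big_morph ev evD ev0). Qed.

Lemma ev_gmon f D : ev (gmon f D) = incF f * cox_elt D.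
Proof.
rewrite (@ev_sub [:: D]) //; first by rewrite big_seq1 coeffU eqxx mulr1.
move=> E; rewrite mem_dom coeffU inE; move=> /eqP h; apply/eqP; apply: contrapT => nE; apply: h.
by rewrite (_ : (D == E) = false) ?mulr0 //; apply/eqP => e; apply: nE; rewrite e.
Qed.

Lemma ev1 : ev 1 = 1.
Proof. by rewrite [ev 1](ev_gmon 1 0) cox_elt0 mulr1 rmorph1. Qed.

Lemma evM (x y : FK) : {subset dom x <= K} -> {subset dom y <= K} -> ev (x * y) = ev x * ev y.
Proof.
move=> xK yK; rewrite [x * y]/(galg_mul x y) /galg_mul ev_sum mulr_suml.
rewrite big_seq [RHS]big_seq; apply: eq_bigr => D /xK DK; rewrite ev_sum mulr_sumr.
rewrite big_seq [RHS]big_seq; apply: eq_bigr => E /yK EK.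
by rewrite [ev _]ev_gmon rmorphM /= cox_eltD // mulrACA.
Qed.

(** A generator 1 - chi(E) X^(-E) is killed because [cox_elt E] equals chi(E) for principal [E]. *)
Lemma ev_stalkI P x : stalkI cd P x -> ev x = 0.
Proof.
move=> [l [hl ->]]; rewrite ev_sum big_seq big1 // => p /hl[[a _ [pK _]] EK Ep].
have gK := stalkS_gen P EK Ep; case: gK => b _ [gK _].
rewrite evM // evB ev1 ev_gmon cox_eltN // cox_elt_chi // mulfV ?subrr ?mulr0 //.
by rewrite -cox_elt_chi // cox_elt_neq0.
Qed.

Lemma gmonM f g D E : gmon f D * gmon g E = gmon (f * g) (D + E) :> FK.
Proof. exact: galg_mulUU. Qed.

Lemma gmon0 D : gmon 0 D = 0 :> FK.
Proof. by apply/eqP/freeg_eqP => E; rewrite coeffU coeff0 mul0r. Qed.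

Lemma gmon_sum (J : Type) (r : seq J) (p : pred J) (G : J -> FA) D :
  gmon (\sum_(j <- r | p j) G j) D = \sum_(j <- r | p j) gmon (G j) D :> FK.
Proof.
have gD f g : gmon (f + g) D = gmon f D + gmon g D :> FK.
  by apply/eqP/freeg_eqP => E; rewrite coeffD !coeffU mulrDl.
exact: (big_morph (fun f => gmon f D : FK) gD (gmon0 D)).
Qed.

Lemma stalkI_sum P (J : eqType) (r : seq J) (p : pred J) (G : J -> FK) :
  (forall j, j \in r -> p j -> stalkI cd P (G j)) ->
  stalkI cd P (\sum_(j <- r | p j) G j).
Proof.
move=> h; rewrite big_seq_cond; apply: (big_ind (stalkI cd P)).
- exact: stalkI0.
- exact: stalkID.
- by move=> j /andP[]; apply: h.
Qed.

Lemma weight_principal D E : weight D = weight E -> D - E \in @principal A.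
Proof. by move=> e; apply/(principal_weight W); rewrite weightB e subrr. Qed.

Lemma chi_mulN E : E \in K -> E \in @principal A -> chi E * chi (- E) = 1.
Proof.
move=> EK Ep; apply: (@incF_inj _ _ _ Q); rewrite rmorphM /= -!cox_elt_chi ?rpredN //.
by rewrite cox_eltN // mulfV ?cox_elt_neq0 // rmorph1.
Qed.

(* Modulo 1 - chi(E) X^(-E) all monomials of one class can be moved to a single *)
(* degree D0, where ev is injective.                                            *)
Lemma ev0_stalkI P x : stalkS cd P x -> ev x = 0 -> stalkI cd P x.
Proof.
move=> [a aP [xK hx]] ex0; pose r := undup [seq weight D | D <- dom x].
have part (V : nmodType) (G : WDiv A -> V) :
    \sum_(D <- dom x) G D = \sum_(w <- r) \sum_(D <- dom x | weight D == w) G D.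
  by apply: sum_fibers => [|w]; rewrite ?undup_uniq ?mem_undup.
have -> : x = \sum_(D <- dom x) gmon (coeff D x) D by rewrite freeg_sumE.
rewrite part; apply: stalkI_sum => w; rewrite mem_undup => /mapP[D0 D0x ew] _.
(* Terms of different weight are linearly independent, so the value of each weight part vanishes by
   itself. *)
have gw : \sum_(D <- dom x | weight D == w) incF (coeff D x) * cox_elt D = 0.
  pose g v := \sum_(D <- dom x | weight D == v) incF (coeff D x) * cox_elt D.
  have hg v : semiF W v (g v).
    apply: big_ind => [|f1 f2|D /eqP <-]; [exact: semiF0|exact: semiFD|].
    rewrite -[weight D]add0r; apply: semiFM; [exact: semiF_incF|exact: semiF_cox_elt].
  have hs : \sum_(v <- r) g v = 0 by rewrite -part.
  by apply: (semiF_indep (undup_uniq _) hg hs); rewrite mem_undup ew map_f.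
have D0K := xK D0 D0x.
have prK D : D \in dom x -> weight D == w -> D - D0 \in K /\ D - D0 \in @principal A.
  move=> Dx /eqP wD; split; first by rewrite rpredB // xK.
  by apply: weight_principal; rewrite wD.
(* The coefficient acquired when the monomial of degree [D] is moved to degree [D0]. *)
pose b D := coeff D x * chi (D - D0).
have bsum : \sum_(D <- dom x | weight D == w) b D = 0.
  apply: (@incF_inj _ _ _ Q); apply: (mulIf (cox_elt_neq0 D0K)).
  rewrite rmorph0 mul0r -[RHS]gw rmorph_sum mulr_suml big_seq_cond [RHS]big_seq_cond.
  apply: eq_bigr => D /andP[Dx wD]; have [EK Ep] := prK D Dx wD.
  by rewrite rmorphM /= -cox_elt_chi // -mulrA -cox_eltD // subrK.
have -> : \sum_(D <- dom x | weight D == w) gmon (coeff D x) D =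
    \sum_(D <- dom x | weight D == w) (gmon (coeff D x) D - gmon (b D) D0 : FK).
  by rewrite sumrB -gmon_sum bsum gmon0 subr0.
apply: stalkI_sum => D Dx wD; have [EK Ep] := prK D Dx wD.
(* Explicitly, f X^D - b X^D0 = -b X^D0 (1 - chi(D0 - D) X^(D - D0)), since b chi(D0 - D) = f. *)
exists [:: (- gmon (b D) D0, - (D - D0))]; split.
  move=> p; rewrite inE => /eqP -> /=; split; rewrite ?rpredN //.
  exists a => //; rewrite -sub0r; apply: sectSB; first exact: sectS0.
  apply: sectSU => //; rewrite -(subKr D D0); apply: sheafOM; first exact: hx.
  by move=> c0 R _; have [_ e] := chi_div EK Ep; rewrite coeffN e subrr.
rewrite big_seq1 /= mulrBr mulr1 mulNr opprK gmonM opprK [D0 + _]addrC subrK /b.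
by rewrite -mulrA chi_mulN // mulr1 addrC.
Qed.
End CoxRing.

Section LocalFractions.
Variable S : idomainType.
Hypothesis fS : factorial_ring S.
Local Notation "a %:F" := (tofrac a).

(** Membership in the localization at [q]. It is visibly stable under sums, and so it carries
    nonnegativity of [fval q] over to sums. *)
Definition local_frac (q : S) (f : {fraction S}) : Prop :=
  exists a b, ~ dv q b /\ f = a%:F / b%:F.

Lemma fval_ge0_local q f : prime_elt q -> f != 0 -> 0 <= fval q f -> local_frac q f.
Proof.
move=> qp f0; have [a [b [b0 e cab]]] := frac_coprime fS f.
have a0 : a != 0 by move: f0; rewrite e frac_eq0.
rewrite e fval_div // => h; exists a, b; split=> // qb.
have qa : ~ dv q a by move=> /cab; apply.
have := (val_dv fS qp b0).2 qb; rewrite ltnNge => /negP; apply.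
by move: h; rewrite (val_ndv fS qp a0 qa) sub0r oppr_ge0.
Qed.

Lemma ndv_neq0 (q b : S) : ~ dv q b -> b != 0.
Proof. by move=> qb; apply: contra_notN qb => /eqP ->; apply: dv0. Qed.

Lemma local_fval_ge0 q f : prime_elt q -> f != 0 -> local_frac q f -> 0 <= fval q f.
Proof.
move=> qp f0 [a [b [qb e]]]; have b0 := ndv_neq0 qb.
have a0 : a != 0 by move: f0; rewrite e frac_eq0.
by rewrite e fval_div // (val_ndv fS qp b0 qb) subr0.
Qed.

Lemma local_frac0 (q : S) : prime_elt q -> local_frac q 0.
Proof. by move=> qp; exists 0, 1; split; [apply: prime_dv1|rewrite tofrac0 mul0r]. Qed.

Lemma local_fracD (q : S) (f g : {fraction S}) : prime_elt q -> local_frac q f -> local_frac q g ->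
  local_frac q (f + g).
Proof.
move=> qp [a [b [qb ->]]] [c [d [qd ->]]]; exists (a * d + c * b), (b * d).
split; first by move=> /(prime_dvM qp)[].
by rewrite addf_div ?tofrac_eq0 ?(ndv_neq0 qb) ?(ndv_neq0 qd) // tofracD !tofracM.
Qed.
End LocalFractions.

Section GenericPoint.
Variable A : idomainType.

Lemma zero_idealr : idealr_closed (fun a : A => a == 0).
Proof.
split; [exact: eqxx|by rewrite -topredE /= oner_neq0|].
by move=> a x y /eqP -> /eqP ->; rewrite -topredE /= mulr0 addr0.
Qed.

Lemma zero_prime : prime_idealr_closed (fun a : A => a == 0).
Proof. by move=> x y; rewrite -!topredE /= mulf_eq0. Qed.

(** It lies in every nonempty principal open set, so germs at any point can be compared with the
    germ here. *)
Definition generic_point : Defs.point A := Point zero_idealr zero_prime.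

Lemma popen_generic a (P : Defs.point A) : popen a P -> popen a generic_point.
Proof.
move=> aP; rewrite /popen; apply: contra aP; rewrite -topredE /= => /eqP ->.
exact: pt_0.
Qed.
End GenericPoint.

Section CoxSections.
Variables (k : closedFieldType) (S A : idomainType) (Q : small_quotient k S A).
Variables (M : zmodType) (W : weight_system Q M) (cd : cox_data A).
Local Notation inc := (sq_inc Q).
Local Notation FA := {fraction A}.
Local Notation FK := (galg FA (WDiv A)).
Local Notation "a %:F" := (tofrac a).
Local Notation incF := (incF Q).
Local Notation weight := (weight W).
Local Notation ev := (ev Q cd).
Local Notation cox_elt := (cox_elt Q cd).
Local Notation gpt := (generic_point A).
Let fS := sq_factorial Q.

(** Near [P] a single local section represents both the germ at [P] and the generic one, and [ev]
    does not see the ideal by which they differ from it. *)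
Lemma ev_germ B s (P : Defs.point A) : local_sect cd B s -> ev (s P) = ev (s gpt).
Proof.
move=> /(_ P)[a aP [t [_ _ ht]]].
have e P' : popen a P' -> ev (s P') = ev t.
  by move=> /ht/(ev_stalkI Q)/eqP; rewrite evB subr_eq0 => /eqP.
by rewrite !e //; apply: popen_generic aP.
Qed.

Lemma ev_sect_local (U : set (Defs.point A)) t (P : primeDiv A) q :
  sectS cd U t -> U P -> prime_elt q -> over Q q P -> local_frac q (ev t).
Proof.
move=> [tK ht] UP qp qP; rewrite [ev t]big_seq; apply: big_ind => [|f g|D Dt].
- exact: local_frac0.
- exact: local_fracD.
have f0 : coeff D t != 0 by rewrite -mem_dom.
have g0 := cox_elt_neq0 Q (tK D Dt).
apply: fval_ge0_local => //; first by rewrite mulf_neq0 // incF_eq0.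
rewrite fvalM ?incF_eq0 // (fval_cox_elt (tK D Dt) qp qP).
by rewrite -(ord_fval qp qP f0); apply: ht.
Qed.

(** Every prime [q] of [S] lies over a prime divisor; a local section near that divisor shows that
    the value has no pole along [q]. An element of Frac S without poles lies in [S]. *)
Lemma theta_exists (s : cox_family cd) : exists u : S, u%:F = ev (cox_germ s gpt).
Proof.
have [e0|n0] := eqVneq (ev (cox_germ s gpt)) 0; first by exists 0; rewrite e0 tofrac0.
have /asboolP hs := valP s.
have [q qp|u _ e] := fval_ge0_int fS n0; last by exists u.
apply: local_fval_ge0 => //; rewrite -(ev_germ (div_under Q qp) hs).
have [a aP [t [tS _ ht]]] := hs (div_under Q qp).
have := ev_stalkI Q (ht _ aP) => /eqP; rewrite evB subr_eq0 => /eqP ->.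
exact: ev_sect_local tS aP qp (over_under Q qp).
Qed.

Definition theta (s : cox_family cd) : S := sval (cid (theta_exists s)).

Lemma thetaE s : (theta s)%:F = ev (cox_germ s gpt).
Proof. exact: svalP (cid (theta_exists s)). Qed.

Lemma theta_eq s u : ev (cox_germ s gpt) = u%:F -> theta s = u.
Proof. by rewrite -thetaE => /eqP; rewrite tofrac_eq => /eqP. Qed.

Lemma thetaB s t : theta (s - t) = theta s - theta t.
Proof. by apply: theta_eq; rewrite tofracB !thetaE -evB. Qed.

Lemma theta1 : theta 1 = 1.
Proof. by apply: theta_eq; rewrite tofrac1 -(ev1 Q cd). Qed.

Lemma thetaM s t : theta (s * t) = theta s * theta t.
Proof.
apply: theta_eq; rewrite tofracM !thetaE -evM //.
  by have /asboolP/(@local_sect_stalk _ _ _ _ gpt)[a _ []] := valP s.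
by have /asboolP/(@local_sect_stalk _ _ _ _ gpt)[a _ []] := valP t.
Qed.

Lemma theta_null s : theta s = 0 <-> s \in @cox_null A cd.
Proof.
have /asboolP hs := valP s; split=> [e0|/asboolP h].
  apply/asboolP => P; apply: (ev0_stalkI W); first exact: local_sect_stalk hs.
  by rewrite (ev_germ P hs) -thetaE e0 tofrac0.
by apply: theta_eq; rewrite (ev_stalkI Q (h gpt)) tofrac0.
Qed.

Lemma theta_semi s w : local_sect cd (fun D => cl D = w) (cox_germ s) ->
  semi W (cl_weight W w) (theta s).
Proof.
move=> hs; apply/semiF_tofrac; rewrite thetaE.
have [a aP [t [tS tw ht]]] := hs gpt.
have /eqP := ev_stalkI Q (ht _ aP); rewrite evB subr_eq0 => /eqP ->.
rewrite [ev t]big_seq; apply: big_ind => [|f g|D Dt]; [exact: semiF0|exact: semiFD|].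
rewrite -(tw D Dt) cl_weightE -[weight D]add0r.
by apply: semiFM; [apply: semiF_incF|apply: semiF_cox_elt].
Qed.

(** Choose [D] in K of class [w]. The quotient of [u] by [cox_elt D] has weight zero, hence is some
    [f] in Frac A, and f X^D is a section of the sheaf everywhere because [u] has no poles. *)
Lemma section_of_semi w u : semi W (cl_weight W w) u ->
  exists2 s : cox_family cd, local_sect cd (fun D => cl D = w) (cox_germ s) & theta s = u.
Proof.
move=> hu; have [D DK eD] := cox_grp_onto cd (repr w).
have {eD} eD : cl D = w by rewrite eD cl_repr.
have H0 := cox_elt_neq0 Q DK.
have [f ef] : exists f, u%:F / cox_elt D = incF f.
  apply: (@semiF0_incF _ _ _ _ _ W); rewrite -(subrr (weight D)); apply: semiFM.
    by apply/semiF_tofrac; rewrite -cl_weightE eD.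
  exact/semiFV/semiF_cox_elt.
have uE : u%:F = incF f * cox_elt D by rewrite -ef divfK.
have gS U : sectS cd U (gmon f D).
  apply: sectSU => // f0 P _; have qp := prime_of_prime Q P.
  have qP := @over_prime_of _ _ _ Q P.
  rewrite (ord_fval qp qP f0) -(fval_cox_elt DK qp qP) -fvalM ?incF_eq0 // -uE.
  rewrite fval_tofrac // -(tofrac_eq0 u) uE mulf_neq0 // incF_eq0 //.
have hs B : B D -> local_sect cd B (fun=> gmon f D).
  move=> BD P; exists 1; first exact: popen1.
  exists (gmon f D); split=> // [E|P' _]; last by rewrite subrr; apply: stalkI0.
  rewrite mem_dom coeffU => /eqP h; suff -> : E = D by [].
  by apply: contrapT => nE; apply: h; rewrite (_ : (D == E) = false) ?mulr0 //; apply/eqP => e; apply: nE.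
have sc : (fun=> gmon f D : FK) \in cox_sect cd by apply/asboolP; apply: hs.
exists (CoxFamily sc); first exact: hs.
by apply: theta_eq => /=; rewrite ev_gmon uE.
Qed.

Lemma theta_const a sa : theta (@CoxFamily _ cd (fun=> gmon (tofrac a) 0) sa) = inc a.
Proof. by apply: theta_eq => /=; rewrite ev_gmon cox_elt0 mulr1 incF_tofrac. Qed.
End CoxSections.

(** * Presentations of the Cox ring *)

Section Presentation.
Variables (k : closedFieldType) (S A : idomainType) (Q : small_quotient k S A).
Variables (M : zmodType) (W : weight_system Q M).
Local Notation kk := (sq_const Q).
Local Notation inc := (sq_inc Q).
Local Notation act := (@sq_act _ _ _ Q).
Local Notation gen := (@sq_gen _ _ _ Q).
Local Notation actF := (@actF _ _ _ Q).
Local Notation "a %:F" := (tofrac a).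
Variables (iota : k -> A) (n : nat) (deg : 'I_n -> M) (f : {mpoly k[n]}).
Variable (e : {rmorphism {mpoly k[n]} -> S}).
Hypotheses (inc_iota : forall c, inc (iota c) = kk c) (eC : forall c, e c%:MP = kk c).
Hypotheses (e_semi : forall j, semi W (deg j) (e 'X_j)) (ef : e f = 0).
Hypothesis e_ker : forall p, e p = 0 -> p \in principal_ideal f.
(* The conditions say that s and its translates by generators are fixed by the commutators *)
(* of the generators; sums of semi-invariants satisfy them.                                *)
Hypothesis e_onto : forall s,
  (forall t u, act (gen t) (act (gen u) s) = act (gen u) (act (gen t) s)) ->
  (forall v t u, act (gen t) (act (gen u) (act (gen v) s)) =
     act (gen u) (act (gen t) (act (gen v) s))) ->
  exists p, e p = s.
Local Notation I := (principal_ideal f).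

Lemma semi_onto w s : semi W w s -> exists p, e p = s.
Proof.
by move=> hs; apply: e_onto => [t u|v t u]; rewrite !(hs, rmorphM, sq_act_const); ring.
Qed.

(** The value of a section is a sum of semi-invariant terms in Frac S, on each of which the
    generators commute; the terms need not lie in [S], so commutation is checked in the fraction
    field. *)
Lemma theta_onto (cd : cox_data A) (s : cox_family cd) : exists p, e p = theta Q s.
Proof.
have comm v x : semiF W v x ->
    (forall t u, actF (gen t) (actF (gen u) x) = actF (gen u) (actF (gen t) x)) /\
    (forall r t u, actF (gen t) (actF (gen u) (actF (gen r) x)) =
       actF (gen u) (actF (gen t) (actF (gen r) x))).
  move=> h; have ax d t : actF (gen t) ((kk d)%:F * x) = (kk (d * ws_chi W v t))%:F * x.
    by rewrite [LHS]rmorphM /= actF_tofrac sq_act_const h rmorphM tofracM mulrA.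
  have -> : x = (kk 1)%:F * x by rewrite rmorph1 tofrac1 mul1r.
  by split=> [t u|r t u]; rewrite !ax mulrAC.
have hs D : semiF W (0 + weight W D)
    (incF Q (coeff D (cox_germ s (generic_point A))) * cox_elt Q cd D).
  by apply: semiFM; [apply: semiF_incF|apply: semiF_cox_elt].
apply: e_onto => [t u|v t u]; apply/eqP; rewrite -tofrac_eq -!actF_tofrac thetaE /ev; apply/eqP.
  rewrite !raddf_sum; apply: eq_bigr => D _; exact: (comm _ _ (hs D)).1.
rewrite !raddf_sum; apply: eq_bigr => D _; exact: (comm _ _ (hs D)).2.
Qed.

Lemma semi_monomial m : semi W (mnm_weight deg m) (e 'X_[m]).
Proof.
apply/semiF_tofrac; rewrite mpolyXE_id rmorph_prod rmorph_prod /mnm_weight.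
apply: (big_ind2 (fun x w => semiF W w x)) => [|x v y w|j _]; [exact: semiF1|exact: semiFM|].
by rewrite rmorphXn rmorphXn; apply/semiFX/semiF_tofrac.
Qed.

Lemma semi_term p m : semi W (mnm_weight deg m) (e (p@_m *: 'X_[m])).
Proof.
apply/semiF_tofrac; rewrite -mul_mpolyC rmorphM rmorphM eC; apply: semiFZ.
exact/semiF_tofrac/semi_monomial.
Qed.

Definition weight_part p w : {mpoly k[n]} :=
  \sum_(m <- msupp p | mnm_weight deg m == w) p@_m *: 'X_[m].

Lemma weight_part_supp p w m : m \in msupp (weight_part p w) -> mnm_weight deg m = w.
Proof.
apply: contraTeq => hm; rewrite mcoeff_msupp negbK /weight_part raddf_sum big1 //= => m' /eqP wm'.
by rewrite mcoeffZ mcoeffX; case: eqP => [em|]; rewrite ?mulr0 //; rewrite -em wm' eqxx in hm.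
Qed.

Lemma semi_homogeneous p w : (forall m, m \in msupp p -> mnm_weight deg m = w) ->
  semi W w (e p).
Proof.
move=> h; apply/semiF_tofrac; rewrite [p]mpolyE !rmorph_sum big_seq.
apply: big_ind => [|x y|m /h <-]; [exact: semiF0|exact: semiFD|].
exact/semiF_tofrac/semi_term.
Qed.

(** [p] itself need not be homogeneous, but the images of its parts of weights other than [w] vanish
    by independence of weights. *)
Lemma semi_weight_part p w : semi W w (e p) -> e p = e (weight_part p w).
Proof.
move=> hp; pose r := undup (w :: [seq mnm_weight deg m | m <- msupp p]).
have psum : \sum_(v <- r) weight_part p v = p.
  rewrite [RHS]mpolyE; apply/esym/sum_fibers; first exact: undup_uniq.
  by move=> v hv; rewrite mem_undup in_cons hv orbT.
(* The weight parts of [e p], with [e p] subtracted at [w]: these are semi-invariants of distinct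
   weights summing to zero. *)
pose g v := (e (weight_part p v))%:F - (if v == w then (e p)%:F else 0).
have hg v : semiF W v (g v).
  have hpart : semiF W v (e (weight_part p v))%:F.
    by apply/semiF_tofrac/semi_homogeneous => m; apply: weight_part_supp.
  rewrite /g; case: eqP => [->|_]; last by rewrite subr0.
  apply: semiFD; first by apply/semiF_tofrac/semi_homogeneous => m; apply: weight_part_supp.
  by rewrite -mulN1r -tofrac1 -tofracN -(rmorph1 kk) -rmorphN; apply/semiFZ/semiF_tofrac.
have gsum : \sum_(v <- r) g v = 0.
  rewrite sumrB -!rmorph_sum psum -big_mkcond /= -big_filter.
  rewrite (_ : [seq i <- r | i == w] = [:: w]) ?big_seq1 ?subrr //.
  apply: perm_small_eq => //; apply: uniq_perm; rewrite ?filter_uniq ?undup_uniq //.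
  by move=> v; rewrite mem_filter !inE mem_undup inE; case: eqP => // ->; rewrite eqxx.
have := semiF_indep (undup_uniq _) hg gsum; move/(_ w).
rewrite mem_undup mem_head => /(_ isT) /eqP.
by rewrite /g eqxx subr_eq0 tofrac_eq => /eqP.
Qed.

Lemma in_ideal p : p \in I <-> e p = 0.
Proof. by split=> [/asboolP[q ->]|/e_ker//]; rewrite rmorphM ef mulr0. Qed.

Lemma quot_pi_eq p q : quot_pi I p = quot_pi I q <-> e p = e q.
Proof.
split=> h; last first.
  by apply/(quot_eqP I)/in_ideal; rewrite rmorphB h subrr.
have /in_ideal : p - q \in I by apply/(quot_eqP I); apply: h.
by rewrite rmorphB => /eqP; rewrite subr_eq0 => /eqP.
Qed.

Section Isomorphism.
Variable cd : cox_data A.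
Local Notation N := (@cox_null A cd).

Lemma cox_pi_eq (s t : cox_family cd) : quot_pi N s = quot_pi N t <-> theta Q s = theta Q t.
Proof.
split=> h; last first.
  by apply/(quot_eqP N)/(theta_null W); rewrite thetaB h subrr.
have /(theta_null W) : s - t \in N by apply/(quot_eqP N); apply: h.
by rewrite thetaB => /eqP; rewrite subr_eq0 => /eqP.
Qed.

Definition cox_poly (s : cox_family cd) : {mpoly k[n]} := sval (cid (theta_onto s)).

Lemma cox_polyE s : e (cox_poly s) = theta Q s.
Proof. exact: svalP (cid (theta_onto s)). Qed.

Definition cox_map (x : cox_ring cd) : quot_ring I := quot_pi I (cox_poly (repr x)).

Lemma cox_piP (x : cox_ring cd) : exists s, x = quot_pi N s.
Proof. exact: quot_piP. Qed.

Lemma cox_map_pi s p : e p = theta Q s -> cox_map (quot_pi N s) = quot_pi I p.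
Proof.
move=> ep; apply/quot_pi_eq; rewrite cox_polyE ep; apply/cox_pi_eq.
exact: reprK.
Qed.

Lemma cox_map_zmod : zmod_morphism cox_map.
Proof.
move=> x y; have [s ->] := cox_piP x; have [t ->] := cox_piP y.
rewrite (cox_map_pi (cox_polyE s)) (cox_map_pi (cox_polyE t)) -!rmorphB.
by apply: cox_map_pi; rewrite rmorphB !cox_polyE thetaB.
Qed.

Lemma cox_map_monoid : monoid_morphism cox_map.
Proof.
split=> [|x y].
  by rewrite -(rmorph1 (quot_pi I)); apply: (@cox_map_pi 1); rewrite rmorph1 theta1.
have [s ->] := cox_piP x; have [t ->] := cox_piP y.
rewrite (cox_map_pi (cox_polyE s)) (cox_map_pi (cox_polyE t)) -!rmorphM.
by apply: cox_map_pi; rewrite rmorphM !cox_polyE thetaM.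
Qed.

HB.instance Definition _ := GRing.isZmodMorphism.Build (cox_ring cd) (quot_ring I) cox_map cox_map_zmod.
HB.instance Definition _ := GRing.isMonoidMorphism.Build (cox_ring cd) (quot_ring I) cox_map cox_map_monoid.

Lemma cox_map_inj : injective cox_map.
Proof.
move=> x y; have [s ->] := cox_piP x; have [t ->] := cox_piP y.
rewrite !(cox_map_pi (cox_polyE _)) => /quot_pi_eq; rewrite !cox_polyE.
by move/cox_pi_eq.
Qed.

Lemma cl_of_weight w : exists x : Cl A, cl_weight W x = w.
Proof. by have [D <-] := weight_surj W w; exists (cl D); rewrite cl_weightE. Qed.

Lemma cox_map_surj y : exists x, cox_map x = y.
Proof.
have [p ->] : exists p, y = quot_pi I p by exact: quot_piP.
suff [s es] : exists s : cox_family cd, theta Q s = e p.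
  by exists (quot_pi N s); apply: cox_map_pi.
rewrite [p]mpolyE rmorph_sum; apply: (big_ind (fun u => exists s : cox_family cd, theta Q s = u)).
- by exists 0; apply: theta_eq; rewrite tofrac0 -(ev0 Q cd).
- move=> _ _ [s <-] [t <-]; exists (s - (0 - t)); rewrite !thetaB.
  have -> : theta Q (0 : cox_family cd) = 0 by apply: theta_eq; rewrite tofrac0 -(ev0 Q cd).
  by rewrite sub0r opprK.
- move=> m _; have [x ex] := cl_of_weight (mnm_weight deg m).
  have h := semi_term p m; rewrite -ex in h.
  by have [s _ hs] := section_of_semi cd h; exists s.
Qed.

Lemma cox_map_bij : bijective cox_map.
Proof.
exists (fun y => sval (cid (cox_map_surj y))) => [x|y]; last exact: svalP (cid (cox_map_surj y)).
by apply: cox_map_inj; apply: svalP (cid (cox_map_surj (cox_map x))).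
Qed.

Lemma cox_map_const c : cox_map (cox_const cd (iota c)) = quot_pi I c%:MP.
Proof. by apply: cox_map_pi; rewrite theta_const inc_iota. Qed.

Lemma cox_map_degree w x : cox_degree w x <-> @quot_degree k n M deg f (cl_weight W w) (cox_map x).
Proof.
split=> [[s hs ->]|[p hp ep]].
  have [p epE] := theta_onto s; have sp := theta_semi W hs; rewrite -epE in sp.
  exists (weight_part p (cl_weight W w)); first by move=> m; apply: weight_part_supp.
  by apply: cox_map_pi; rewrite -semi_weight_part.
have [s hs es] := section_of_semi cd (semi_homogeneous hp).
exists s => //; apply: cox_map_inj; rewrite ep; apply/esym/cox_map_pi.
by rewrite es.
Qed.
End Isomorphism.

(** The degrees of the variables generate [M] even as a monoid: a polynomial mapping to a
    semi-invariant of weight [w] must contain a monomial of that degree. *)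
Lemma weight_of_degrees w : exists m : 'X_{1..n}, mnm_weight deg m = w.
Proof.
have [s s0 hs] := ws_semi_ex W w; have [p ep] := semi_onto hs.
have : weight_part p w != 0.
  apply: contraNneq s0 => e0; by rewrite -ep (@semi_weight_part p w) ?e0 ?rmorph0 ?ep.
rewrite -msupp_eq0; case E: (msupp _) => [//|m l] _; exists m.
by apply: (@weight_part_supp p); rewrite E mem_head.
Qed.

(** K is generated by one divisor for each variable, of the weight of that variable. For principal
    [E], [chi] takes the rational function whose image is [div_elt Q E]; it inherits
    multiplicativity from [div_elt]. *)
Lemma cox_data_exists : inhabited (cox_data A).
Proof.
pose D j := sval (cid (weight_surj W (deg j))).
have wD j : weight W (D j) = deg j := svalP (cid (weight_surj W (deg j))).
pose s := [seq D j | j <- enum 'I_n].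
pose K : {pred WDiv A} :=
  fun E => `[< exists c : 'I_(size s) -> int, E = \sum_(i < size s) s`_i *~ c i >].
have Kz : zmod_closed K.
  split=> [|x y /asboolP[c ->] /asboolP[d ->]]; apply/asboolP.
    by exists (fun=> 0); rewrite big1 // => i _; rewrite mulr0z.
  by exists (fun i => c i - d i); rewrite -sumrB; apply: eq_bigr => i _; rewrite mulrzBr.
pose Kc := GRing.isZmodClosed.Build (WDiv A) K Kz.
pose KZ : zmodClosed (WDiv A) := HB.pack K Kc.
pose ch (E : WDiv A) := xget 1 (fun g => incF Q g = div_elt Q E).
have chE E : E \in @principal A -> incF Q (ch E) = div_elt Q E.
  move=> /(principal_weight W) w0; rewrite /ch; case: xgetP => [g _ //|nex].
  have [|g eg] := @semiF0_incF _ _ _ _ _ W (div_elt Q E).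
    by rewrite -w0; apply: weightP.
  by case: (nex g); rewrite eg.
have sK : {subset s <= KZ}.
  move=> x /(nthP 0)[i hi <-]; apply/asboolP; exists (fun j => (j == Ordinal hi)%:Z).
  rewrite (bigD1 (Ordinal hi)) //= eqxx mulr1z big1 ?addr0 // => j /negPf ->.
  by rewrite mulr0z.
constructor; apply: (@CoxData A KZ _ _ ch).
- by exists s; split=> // E /asboolP.
- move=> E; have [m em] := weight_of_degrees (weight W E).
  exists (\sum_j D j *+ m j).
    by apply: rpred_sum => j _; apply: rpredMn; apply: sK; rewrite map_f ?mem_enum.
  apply/cl_eqP/(weight_principal (W := W)); rewrite -em /mnm_weight.
  apply: (big_ind2 (fun x w => weight W x = w)) => [|x v y w <- <-|j _].
  + by apply/principal_weight; apply: rpred0.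
  + by rewrite weightD.
  + elim: (m j) => [|i IH]; first by rewrite !mulr0n; apply/principal_weight; apply: rpred0.
    by rewrite !mulrS weightD IH wD.
- move=> E _ Ep; apply: (@elt_div_of _ _ _ Q _ 1); first exact: oner_neq0.
  by rewrite chE // rmorph1 tofrac1 mul1r.
- move=> E E' _ Ep _ Ep'; apply: (@incF_inj _ _ _ Q).
  by rewrite rmorphM /= !chE ?div_eltD // rpredD.
Qed.

Lemma presentation_class_group_and_cox_ring : class_group_and_cox_ring iota deg f.
Proof.
exists (cl_weight W : {additive Cl A -> M}); first exact: cl_weight_bij.
split; first exact: cox_data_exists.
move=> cd; exists (@cox_map cd : {rmorphism cox_ring cd -> quot_ring I}); split.
- exact: cox_map_bij.
- exact: cox_map_const.
- exact: cox_map_degree.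
Qed.
End Presentation.

(** * Finite matrix groups *)

Section LinearSubstitution.
Variables (C : fieldType) (n : nat).
Implicit Types (g h : 'M[C]_n) (s : {mpoly C[n]}).

Definition lsubst g : {mpoly C[n]} -> {mpoly C[n]} := comp_mpoly (lin_subst g).
HB.instance Definition _ g := GRing.RMorphism.on (lsubst g).

Lemma lsubstC g c : lsubst g c%:MP = c%:MP.
Proof. exact: comp_mpolyC. Qed.

Lemma lsubstX g i : lsubst g 'X_i = \sum_j g i j *: 'X_j.
Proof. by rewrite /lsubst comp_mpolyXU -tnth_nth tnth_mktuple. Qed.

Lemma lsubstZ g c s : lsubst g (c *: s) = c *: lsubst g s.
Proof. exact: comp_mpolyZ. Qed.

(** Pulling functions back reverses the order, so the matrices act on polynomials from the right. *)
Lemma lsubstM g h s : lsubst (g *m h) s = lsubst h (lsubst g s).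
Proof.
apply: (@mpoly_rmorph_ext _ _ _ (lsubst (g *m h)) (lsubst h \o lsubst g)) => [c|i] /=.
  by rewrite !lsubstC.
rewrite !lsubstX rmorph_sum /=; under [RHS]eq_bigr => j _ do rewrite lsubstZ lsubstX scaler_sumr.
rewrite exchange_big; apply: eq_bigr => j _; rewrite mxE scaler_suml.
by apply: eq_bigr => l _; rewrite scalerA.
Qed.

Lemma lsubst1 s : lsubst 1%:M s = s.
Proof.
apply: (@mpoly_rmorph_ext _ _ _ (lsubst 1%:M) idfun) => [c|i] /=; first exact: lsubstC.
rewrite lsubstX (bigD1 i) //= mxE eqxx scale1r big1 ?addr0 // => j ji.
by rewrite mxE eq_sym (negPf ji) scale0r.
Qed.

Lemma lsubstK g : g \in unitmx -> cancel (lsubst g) (lsubst (invmx g)).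
Proof. by move=> gu s; rewrite -lsubstM mulmxV // lsubst1. Qed.

Lemma lsubstKV g : g \in unitmx -> cancel (lsubst (invmx g)) (lsubst g).
Proof. by move=> gu s; rewrite -lsubstM mulVmx // lsubst1. Qed.
End LinearSubstitution.

Section MatrixGroups.
Variables (C : fieldType) (n : nat) (gs : seq 'M[C]_n).
Hypothesis gU : {subset gs <= unitmx}.
Local Notation G := (gen_group gs).

Lemma gen_group_unit h : G h -> h \in unitmx.
Proof.
elim=> [|h1 h2 _ IH /gU u2|h1 h2 _ IH /gU u2]; first exact: unitmx1.
- by rewrite unitmx_mul IH.
- by rewrite unitmx_mul IH unitmx_inv.
Qed.

Lemma gen_groupM h1 h2 : G h1 -> G h2 -> G (h1 *m h2).
Proof.
move=> G1; elim=> [|h g _ IH gin|h g _ IH gin]; first by rewrite mulmx1.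
- by rewrite mulmxA; apply: GenM.
- by rewrite mulmxA; apply: GenV.
Qed.

Lemma gen_group_mem h : h \in gs -> G h.
Proof. by move=> hs; rewrite -[h]mul1mx; apply: GenM hs; apply: Gen1. Qed.

Lemma gen_group_memV h : h \in gs -> G (invmx h).
Proof. by move=> hs; rewrite -[invmx h]mul1mx; apply: GenV hs; apply: Gen1. Qed.

Lemma gen_groupV h : G h -> G (invmx h).
Proof.
have invM (a b : 'M[C]_n) : a \in unitmx -> b \in unitmx -> invmx (a *m b) = invmx b *m invmx a.
  move=> ua ub; have uab : a *m b \in unitmx by rewrite unitmx_mul ua.
  apply: (can_inj (mulKmx uab)).
  by rewrite mulmxV // mulmxA mulmxK // mulmxV.
elim=> [|h1 h2 G1 IH h2s|h1 h2 G1 IH h2s].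
- by rewrite invmx1; apply: Gen1.
- rewrite (invM _ _ (gen_group_unit G1) (gU h2s)).
  by apply: gen_groupM => //; apply: gen_group_memV.
- have u2 : invmx h2 \in unitmx by rewrite unitmx_inv gU.
  rewrite (invM _ _ (gen_group_unit G1) u2) invmxK.
  by apply: gen_groupM => //; apply: gen_group_mem.
Qed.

Lemma gen_invariant s : (forall h, h \in gs -> lsubst h s = s) ->
  forall h, G h -> lsubst h s = s.
Proof.
move=> hs h; elim=> [|h1 h2 _ IH h2s|h1 h2 _ IH h2s]; first exact: lsubst1.
- by rewrite lsubstM IH hs.
- by rewrite lsubstM IH -{1}(hs h2 h2s) lsubstK // gU.
Qed.

Lemma gen_semi_invariant s : (forall h, h \in gs -> exists c, lsubst h s = c%:MP * s) ->
  forall h, G h -> exists c, lsubst h s = c%:MP * s.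
Proof.
move=> hs h; elim=> [|h1 h2 _ [c ec] h2s|h1 h2 _ [c ec] h2s].
- by exists 1; rewrite lsubst1 mpolyC1 mul1r.
- have [d ed] := hs h2 h2s; exists (c * d).
  by rewrite lsubstM ec rmorphM /= lsubstC ed mpolyCM mulrA.
- have [d ed] := hs h2 h2s.
  have [s0|s0] := eqVneq s 0; first by exists 0; rewrite s0 rmorph0 mulr0.
  have d0 : d != 0.
    apply: contraNneq s0 => d0; rewrite -(lsubstK (gU h2s) s) ed d0.
    by rewrite mpolyC0 mul0r rmorph0.
  exists (c * d^-1); rewrite lsubstM ec rmorphM /= lsubstC mpolyCM -mulrA; congr (_ * _).
  have e : s = d^-1%:MP * lsubst h2 s by rewrite ed mulrA -mpolyCM mulVf // mpolyC1 mul1r.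
  by rewrite {1}e rmorphM /= lsubstC lsubstK // gU.
Qed.
End MatrixGroups.

Section MatrixQuotient.
Variables (C : numClosedFieldType) (n : nat) (g : bool -> 'M[C]_n.+1).
Local Notation S := {mpoly C[n.+1]}.
Local Notation gs := [:: g true; g false].
Local Notation G := (gen_group gs).
Local Notation A := (inv_ring G).
Hypothesis gU : forall b, g b \in unitmx.
Variable L : seq 'M[C]_n.+1.
Hypothesis GL : forall h, G h -> h \in L.
Hypothesis small : forall s : S, s != 0 ->
  (forall b, exists c, lsubst (g b) s = c%:MP * s) ->
  forall q, prime_elt q -> exists2 u, ~ dv q u & forall b, lsubst (g b) (s * u) = s * u.

Lemma gsU : {subset gs <= unitmx}.
Proof. by move=> h; rewrite !inE => /orP[|] /eqP ->. Qed.

Lemma gs_mem b : g b \in gs.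
Proof. by case: b; rewrite !inE eqxx ?orbT. Qed.

Lemma gs_ind (P : 'M[C]_n.+1 -> Prop) : (forall b, P (g b)) -> forall h, h \in gs -> P h.
Proof. by move=> hP h; rewrite !inE => /orP[|] /eqP ->. Qed.

(** [L] is any list containing the group. Filtering it by membership turns the group into a finite
    type without listing its elements. *)
Definition group_list := undup [seq h <- L | `[< G h >]].

Lemma mem_group_list h : h \in group_list <-> G h.
Proof.
rewrite mem_undup mem_filter; split=> [/andP[/asboolP]//|Gh].
by rewrite GL // andbT; apply/asboolP.
Qed.

Local Notation I := (seq_sub group_list).

Lemma groupP (i : I) : G (ssval i).
Proof. exact/mem_group_list/ssvalP. Qed.

Lemma group_unit (i : I) : ssval i \in unitmx.
Proof. apply: (gen_group_unit gsU); exact: groupP. Qed.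

Definition gelt h (Gh : G h) : I := SeqSub ((mem_group_list h).2 Gh).

Lemma mpoly_unit_const (u : S) : u \is a GRing.unit -> exists c, u = c%:MP.
Proof. by move=> /andP[/eqP e _]; exists (u@_0%MM). Qed.

Lemma matrix_inc_inj : injective (\val : A -> S).
Proof. exact: val_inj. Qed.

Lemma matrix_incP (s : S) : (forall b, lsubst (g b) s = s) -> exists a : A, s = \val a.
Proof.
move=> hs; have sG : s \in Defs.invariant G.
  apply/asboolP; apply: (gen_invariant gsU); exact: (@gs_ind (fun h => lsubst h s = s)).
by exists (InvRing sG).
Qed.

Lemma matrix_act_inc (i : I) (a : A) : lsubst (ssval i) (\val a) = \val a.
Proof. by have /asboolP := valP a; apply; apply: groupP. Qed.

Lemma matrix_mulI (j : I) :
  injective (fun i : I => gelt (gen_groupM (groupP i) (groupP j))).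
Proof.
move=> i1 i2 /(congr1 (@ssval _ _)) /= e; apply: val_inj => /=.
exact: can_inj (mulmxK (group_unit j)) _ _ e.
Qed.

Lemma matrix_genP (s : S) : (forall b, exists c, lsubst (g b) s = c%:MP * s) ->
  forall i : I, exists c, lsubst (ssval i) s = c%:MP * s.
Proof.
move=> hs i; apply: (gen_semi_invariant gsU); last exact: groupP.
exact: (@gs_ind (fun h => exists c, lsubst h s = c%:MP * s)).
Qed.

Definition matrix_quotient : small_quotient C S A := SmallQuotient
  (sq_const := @mpolyC n.+1 C) (sq_inc := \val : {rmorphism A -> S})
  (sq_act := fun i : I => lsubst (ssval i) : {rmorphism S -> S})
  (sq_gen := fun b => gelt (gen_group_mem (gs_mem b)))
  (sq_mul := fun i j : I => gelt (gen_groupM (groupP i) (groupP j)))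
  (sq_one := gelt (Gen1 _)) (sq_inv := fun i : I => gelt (gen_groupV gsU (groupP i)))
  (@mpoly_factorial C n.+1) matrix_inc_inj mpoly_unit_const
  (fun i c => lsubstC (ssval i) c) (fun i => lsubstK (group_unit i))
  (fun i => lsubstKV (group_unit i)) (@lsubst1 C n.+1)
  (fun i j s => lsubstM (ssval i) (ssval j) s) matrix_mulI matrix_incP matrix_act_inc
  matrix_genP small.
End MatrixQuotient.

Section MatrixPresentation.
Variables (C : numClosedFieldType) (n : nat) (g : bool -> 'M[C]_n.+1).
Local Notation S := {mpoly C[n.+1]}.
Local Notation gs := [:: g true; g false].
Local Notation G := (gen_group gs).
Hypothesis gU : forall b, g b \in unitmx.
Variable L : seq 'M[C]_n.+1.
Hypothesis GL : forall h, G h -> h \in L.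
Variables (M : zmodType) (chi : M -> bool -> C).
Hypothesis chi_neq0 : forall w b, chi w b != 0.
Hypothesis chiD : forall v w b, chi (v + w) b = chi v b * chi w b.
Hypothesis chi_inj : forall v w, chi v =1 chi w -> v = w.
Variables (r : nat) (deg : 'I_r -> M) (f : {mpoly C[r]}) (e : {rmorphism {mpoly C[r]} -> S}).
Hypotheses (eC : forall c, e c%:MP = c%:MP) (ef : e f = 0).
Hypothesis e_semi : forall j b, lsubst (g b) (e 'X_j) = (chi (deg j) b)%:MP * e 'X_j.
Hypothesis e_ker : forall p, e p = 0 -> p \in principal_ideal f.
Hypothesis e_onto : forall s,
  lsubst (g true) (lsubst (g false) s) = lsubst (g false) (lsubst (g true) s) ->
  (forall b, lsubst (g true) (lsubst (g false) (lsubst (g b) s)) =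
     lsubst (g false) (lsubst (g true) (lsubst (g b) s))) ->
  exists p, e p = s.
Hypothesis e_coprime : forall w q, prime_elt q ->
  exists2 m, mnm_weight deg m = w & ~ dv q (e 'X_[m]).

Lemma chi_0 b : chi 0 b = 1.
Proof.
have := chiD 0 0 b; rewrite addr0 => /eqP.
by rewrite -{1}[chi 0 b]mulr1 (inj_eq (mulfI (chi_neq0 0 b))) => /eqP.
Qed.

Lemma lsubst_monomial m b :
  lsubst (g b) (e 'X_[m]) = (chi (mnm_weight deg m) b)%:MP * e 'X_[m].
Proof.
rewrite mpolyXE_id !rmorph_prod /mnm_weight.
apply: (big_ind3 (fun x w y => x = (chi w b)%:MP * y)) => [|x v y x' w y' -> ->|j _].
- by rewrite chi_0 mpolyC1 mulr1.
- by rewrite chiD mpolyCM; ring.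
rewrite !rmorphXn /= e_semi; elim: (m j) => [|i IH].
  by rewrite mulr0n !expr0 chi_0 mpolyC1 mulr1.
by rewrite !exprS IH mulrS chiD mpolyCM; ring.
Qed.

Lemma semi_onto_poly s : (forall b, exists c, lsubst (g b) s = c%:MP * s) ->
  exists p, e p = s.
Proof.
move=> hs; have [c ec] := hs true; have [d ed] := hs false.
have comm x : lsubst (g true) (lsubst (g false) (x%:MP * s)) =
    lsubst (g false) (lsubst (g true) (x%:MP * s)).
  by rewrite !rmorphM /= ec ed !rmorphM /= ec ed !lsubstC; ring.
apply: e_onto; first by have := comm 1; rewrite mpolyC1 mul1r.
by move=> b; have [x ->] := hs b; apply: comm.
Qed.

(** Lift [s] along [e] and split it into weight parts. Since [s] is an eigenvector, independence
    gives (chi v b - al b) part v = 0 for all [v], and any nonzero part shows that the eigenvalues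
    of [s] are a character from [M]. *)
Lemma semi_has_weight s : s != 0 -> (forall b, exists c, lsubst (g b) s = c%:MP * s) ->
  exists w, forall b, lsubst (g b) s = (chi w b)%:MP * s.
Proof.
move=> s0 hs; have [p ep] := semi_onto_poly hs.
pose al b := sval (cid (hs b)).
have alE b : lsubst (g b) s = (al b)%:MP * s := svalP (cid (hs b)).
pose l := undup [seq mnm_weight deg m | m <- msupp p].
pose part v := \sum_(m <- msupp p | mnm_weight deg m == v) (p@_m)%:MP * e 'X_[m].
have partE v b : lsubst (g b) (part v) = (chi v b)%:MP * part v.
  rewrite /part rmorph_sum mulr_sumr; apply: eq_bigr => m /eqP wm.
  by rewrite rmorphM /= lsubstC lsubst_monomial wm; ring.
have sE : s = \sum_(v <- l) part v.
  rewrite -ep [p in LHS]mpolyE rmorph_sum -(sum_fibers (h := mnm_weight deg)) ?undup_uniq //.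
    by apply: eq_bigr => m _; rewrite -mul_mpolyC rmorphM eC.
  by move=> v; rewrite mem_undup.
have eig v b : v \in l -> (chi v b - al b)%:MP * part v = 0.
  move=> vl; pose h w := (chi w b - al b)%:MP * part w.
  have hlC (b' : bool) d (x : S) : lsubst (g b') (d%:MP * x) = d%:MP * lsubst (g b') x.
    by rewrite rmorphM /= lsubstC.
  apply: (@eigen_indep _ S (@mpolyC n.+1 C) _ _ (fun b => lsubst (g b)) chi chi_inj hlC l h) => //.
  - exact: undup_uniq.
  - by move=> w t /=; rewrite /h rmorphM /= lsubstC partE; ring.
  rewrite /h; under eq_bigr => w _ do rewrite mpolyCB mulrBl -partE.
  by rewrite sumrB -mulr_sumr -rmorph_sum -sE /= alE subrr.
have [v vl pv] : exists2 v, v \in l & part v != 0.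
  apply: contrapT => h; case/eqP: s0; rewrite sE big_seq big1 // => v vl.
  by apply/eqP; apply: contrapT => /negP pv; apply: h; exists v.
exists v => b; rewrite alE; congr (_%:MP * _); apply/eqP; rewrite eq_sym -subr_eq0.
by have /eqP := eig v b vl; rewrite mulf_eq0 (negPf pv) orbF mpolyC_eq0.
Qed.

Lemma matrix_small s : s != 0 -> (forall b, exists c, lsubst (g b) s = c%:MP * s) ->
  forall q, prime_elt q -> exists2 u, ~ dv q u & forall b, lsubst (g b) (s * u) = s * u.
Proof.
move=> s0 hs q qp; have [w hw] := semi_has_weight s0 hs.
have [m wm qm] := e_coprime (- w) qp; exists (e 'X_[m]) => // b.
rewrite rmorphM /= hw lsubst_monomial wm mulrACA -mpolyCM -chiD subrr chi_0.
by rewrite mpolyC1 mul1r.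
Qed.

Local Notation Q := (matrix_quotient gU GL matrix_small).

Lemma matrix_semi_ex w : exists2 s : S, s != 0
  & forall b, @sq_act _ _ _ Q (sq_gen b) s = sq_const Q (chi w b) * s.
Proof.
(* The hypothesis [e_coprime] speaks about a prime; any prime factor of the first variable will
   do. *)
have [||q qp _] := @prime_dvP S (@mpoly_factorial C n.+1) ('X_ord0).
- by rewrite -msize_poly_eq0 msizeX.
- by apply/negP => /mpoly_unit_const[c /(congr1 (fun p => msize p))]; rewrite msizeX mdeg1 msizeC; case: eqP.
have [m wm qm] := e_coprime w qp; exists (e 'X_[m]); first exact: (ndv_neq0 qm).
by move=> b; rewrite -wm; apply: lsubst_monomial.
Qed.

Definition matrix_weights : weight_system Q M :=
  WeightSystem (Q := Q) chi_neq0 chiD chi_inj matrix_semi_ex semi_has_weight.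

Theorem matrix_class_group_and_cox_ring :
  class_group_and_cox_ring (@inv_const C n.+1 G) deg f.
Proof.
apply: (presentation_class_group_and_cox_ring (W := matrix_weights) (e := e)) => //.
by move=> s hs hs2; apply: e_onto => [|b]; [apply: (hs true false)|apply: (hs2 b true false)].
Qed.
End MatrixPresentation.

Section FiniteMonomialGroups.
Variables (C : numClosedFieldType) (n : nat).
Implicit Types (g h m P : 'M[C]_n).

Definition monomial_mx (s : 'I_n -> 'I_n) (c : 'I_n -> C) : 'M[C]_n :=
  \matrix_(i, j) (c j *+ (i == s j)).

Lemma mul_monomial_mx m s c i j : (m *m monomial_mx s c) i j = m i (s j) * c j.
Proof.
rewrite mxE (bigD1 (s j)) //= mxE eqxx mulr1n big1 ?addr0 // => l /negPf ls.
by rewrite mxE ls mulr0n mulr0.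
Qed.

Lemma roots_of_unity N : (0 < N)%N -> exists E : seq C, forall z, z ^+ N = 1 -> z \in E.
Proof.
move=> N0; have [E eE] := closed_field_poly_normal ('X^N - 1 : {poly C}).
exists E => z zN; have : root ('X^N - 1) z by rewrite rootE !hornerE zN subrr.
rewrite eE (monicP (monicXnsubC 1 N0)) ?scale1r ?root_prod_XsubC //.
Qed.

Lemma matrices_over_seq (E : seq C) : exists L : seq 'M[C]_n,
  forall m, m \in L <-> forall i j, m i j \in E.
Proof.
pose mk (p : {ffun 'I_n * 'I_n -> seq_sub E}) : 'M[C]_n := \matrix_(i, j) ssval (p (i, j)).
exists [seq mk p | p <- enum {ffun 'I_n * 'I_n -> seq_sub E}] => m; split.
  by move=> /mapP[p _ ->] i j; rewrite mxE; apply: ssvalP.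
move=> h; apply/mapP; exists [ffun x => SeqSub (h x.1 x.2)]; first by rewrite mem_enum.
by apply/matrixP => i j; rewrite mxE ffunE.
Qed.

(** Right multiplication by a generator maps the finite list injectively into itself, hence onto
    itself, so the list is also stable under the inverse of the generator. *)
Lemma gen_group_finite (gs : seq 'M[C]_n) (L : seq 'M[C]_n) :
  {subset gs <= unitmx} -> 1%:M \in L ->
  (forall m h, m \in L -> h \in gs -> m *m h \in L) ->
  forall h, gen_group gs h -> h \in L.
Proof.
move=> gU L1 Lmul.
have LV m h : m \in L -> h \in gs -> m *m invmx h \in L.
  move=> mL hs; have hu := gU h hs; pose L' := undup L.
  have inj : injective (fun x : 'M[C]_n => x *m h).
    by move=> x y e; rewrite -(mulmxK hu x) e mulmxK.
  have sub : {subset [seq x *m h | x <- L'] <= L'}.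
    by move=> _ /mapP[x xL ->]; rewrite mem_undup Lmul //; rewrite mem_undup in xL.
  have [||_ e] := uniq_min_size _ sub.
  - by rewrite map_inj_uniq ?undup_uniq.
  - by rewrite size_map.
  have : m \in [seq x *m h | x <- L'] by rewrite e mem_undup.
  by move=> /mapP[x]; rewrite mem_undup => xL ->; rewrite mulmxK.
by move=> h; elim=> [//|h1 h2 _ IH h2s|h1 h2 _ IH h2s]; [apply: Lmul|apply: LV].
Qed.

(** After conjugation by [P] all entries of group elements stay among 0 and the [N]-th roots of
    unity, and there are finitely many such matrices. *)
Lemma monomial_group_finite (gs : seq 'M[C]_n) P N : (0 < N)%N -> P \in unitmx ->
  {subset gs <= unitmx} ->
  (forall h, h \in gs -> exists s c, (forall j, c j ^+ N = 1) /\
     P *m h = monomial_mx s c *m P) ->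
  exists L : seq 'M[C]_n, forall h, gen_group gs h -> h \in L.
Proof.
move=> N0 Pu gU hgs; have [E hE] := roots_of_unity N0.
(* [E] may contain other numbers; the filter makes the set stable under multiplication by roots of
   unity. *)
pose E' := 0 :: [seq z <- E | z ^+ N == 1].
have E'M z w : z \in E' -> w ^+ N = 1 -> z * w \in E'.
  rewrite !in_cons => /orP[/eqP->|]; first by rewrite mul0r eqxx.
  rewrite !mem_filter => /andP[/eqP zN _] wN.
  by rewrite exprMn zN wN mulr1 eqxx hE ?orbT // exprMn zN wN mulr1.
have [L0 hL0] := matrices_over_seq E'.
exists [seq invmx P *m m *m P | m <- L0]; apply: gen_group_finite => //.
  apply/mapP; exists 1%:M; last by rewrite mulmx1 mulVmx.
  apply/hL0 => i j; rewrite mxE; case: (i == j); last by rewrite mulr0n in_cons eqxx.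
  by rewrite mulr1n in_cons mem_filter expr1n eqxx hE ?orbT // expr1n.
move=> _ h /mapP[m mL ->] hs; have [s [c [cN e]]] := hgs h hs.
apply/mapP; exists (m *m monomial_mx s c).
  apply/hL0 => i j; rewrite mul_monomial_mx; apply: E'M => //.
  by move/hL0: mL; apply.
by rewrite -!mulmxA e.
Qed.
End FiniteMonomialGroups.

(** * Invariants of diagonal groups *)

Section SmallOrdinals.
Variables (V : Type) (idx : V) (op : Monoid.law idx).

Lemma big_ord3 (F : 'I_3 -> V) :
  \big[op/idx]_i F i = op (F (inord 0)) (op (F (inord 1)) (F (inord 2))).
Proof.
rewrite !big_ord_recl big_ord0 Monoid.mulm1.
by congr (op (F _) (op (F _) (F _))); apply: val_inj; rewrite /= inordK.
Qed.

Lemma big_ord4 (F : 'I_4 -> V) : \big[op/idx]_i F i =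
  op (F (inord 0)) (op (F (inord 1)) (op (F (inord 2)) (F (inord 3)))).
Proof.
rewrite !big_ord_recl big_ord0 Monoid.mulm1.
by congr (op (F _) (op (F _) (op (F _) (F _)))); apply: val_inj; rewrite /= inordK.
Qed.
End SmallOrdinals.

Lemma ord3P (P : 'I_3 -> Prop) : P (inord 0) -> P (inord 1) -> P (inord 2) -> forall i, P i.
Proof.
move=> P0 P1 P2 i; rewrite -(inord_val i).
by case: i => [[|[|[|//]]] hi] /=.
Qed.

Lemma ord4P (P : 'I_4 -> Prop) : P (inord 0) -> P (inord 1) -> P (inord 2) -> P (inord 3) ->
  forall i, P i.
Proof.
move=> P0 P1 P2 P3 i; rewrite -(inord_val i).
by case: i => [[|[|[|[|//]]]] hi] /=.
Qed.

Section MonomialMaps.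
Variables (C : fieldType) (r n : nat).

Lemma comp_tupleX (t : 'I_r -> {mpoly C[n]}) i : 'X_i \mPo [tuple t i | i < r] = t i.
Proof. by rewrite comp_mpolyXU -tnth_nth tnth_mktuple. Qed.

Variables (e : {rmorphism {mpoly C[r]} -> {mpoly C[n]}}).
Variables (th : 'X_{1..r} -> 'X_{1..n}) (la : 'X_{1..n} -> 'X_{1..r}) (f : {mpoly C[r]}).
Hypotheses (eC : forall c, e c%:MP = c%:MP) (eX : forall m, e 'X_[m] = 'X_[th m]).

Lemma monomial_map_onto s : (forall m, m \in msupp s -> th (la m) = m) ->
  exists p, e p = s.
Proof.
move=> h; exists (\sum_(m <- msupp s) s@_m *: 'X_[la m]).
rewrite rmorph_sum [RHS]mpolyE big_seq [RHS]big_seq; apply: eq_bigr => m /h thm.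
by rewrite -!mul_mpolyC rmorphM /= eC eX thm.
Qed.

(* Every polynomial is congruent modulo f to the image of e p under the linear *)
(* extension of the normal form map la, cut off at a sufficiently large degree. *)
Lemma monomial_map_ker p : (forall m, 'X_[m] - 'X_[la (th m)] \in principal_ideal f) ->
  e p = 0 -> p \in principal_ideal f.
Proof.
move=> hf ep; pose d := (\sum_(m <- msupp p) (mdeg (th m)).+1)%N.
pose D (s : {mpoly C[n]}) : {mpoly C[r]} := \sum_(m : 'X_{1..n < d}) s@_m *: 'X_[la m].
have D0 : D 0 = 0 by rewrite /D big1 // => m _; rewrite mcoeff0 scale0r.
have DD s t : D (s + t) = D s + D t.
  by rewrite /D -big_split; apply: eq_bigr => m _; rewrite mcoeffD scalerDl.
have DX c m : m \in msupp p -> D (c *: 'X_[th m]) = c *: 'X_[la (th m)].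
  move=> mp; have dm : (mdeg (th m) < d)%N.
    by rewrite /d (big_rem m) //= addSn ltnS leq_addr.
  rewrite /D (bigD1 (BMultinom dm)) //= mcoeffZ mcoeffX eqxx mulr1 big1 ?addr0 // => i im.
  rewrite mcoeffZ mcoeffX; case: eqP => [e2|_]; last by rewrite mulr0 scale0r.
  by case/eqP: im; apply: val_inj.
have De : D (e p) = \sum_(m <- msupp p) p@_m *: 'X_[la (th m)].
  rewrite {1}[p]mpolyE rmorph_sum (big_morph D DD D0) big_seq [RHS]big_seq.
  by apply: eq_bigr => m mp; rewrite -mul_mpolyC rmorphM eC eX mul_mpolyC DX.
rewrite -[p]subr0 -D0 -ep De {1}[p]mpolyE -sumrB.
apply: rpred_sum => m _; rewrite -scalerBr -mul_mpolyC; exact: ideal_mull.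
Qed.
End MonomialMaps.

Lemma subrXX_ideal (R : comPzRingType) (x y : R) n : x ^+ n - y ^+ n \in principal_ideal (x - y).
Proof. by apply/asboolP; rewrite subrXX mulrC; eexists. Qed.

Section ToricPresentations.
Variable C : fieldType.
Local Notation X i := ('X_(inord i) : {mpoly C[4]}).
Local Notation x i := ('X_(inord i) : {mpoly C[3]}).

Definition mnm3 (a b c : nat) : 'X_{1..3} := [multinom nth 0%N [:: a; b; c] i | i < 3].
Definition mnm4 (a b c d : nat) : 'X_{1..4} := [multinom nth 0%N [:: a; b; c; d] i | i < 4].

Lemma mnm3E a b c : ((mnm3 a b c (inord 0) = a) * (mnm3 a b c (inord 1) = b)
  * (mnm3 a b c (inord 2) = c))%type.
Proof. by rewrite !mnmE !inordK. Qed.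

Lemma mnm4E a b c d : ((mnm4 a b c d (inord 0) = a) * (mnm4 a b c d (inord 1) = b)
  * (mnm4 a b c d (inord 2) = c) * (mnm4 a b c d (inord 3) = d))%type.
Proof. by rewrite !mnmE !inordK. Qed.

Lemma mnm3_ext (m m' : 'X_{1..3}) : m (inord 0) = m' (inord 0) -> m (inord 1) = m' (inord 1) ->
  m (inord 2) = m' (inord 2) -> m = m'.
Proof. by move=> h0 h1 h2; apply/mnmP; apply: ord3P. Qed.

Lemma mpolyX3 (m : 'X_{1..3}) :
  'X_[m] = x 0 ^+ m (inord 0) * (x 1 ^+ m (inord 1) * x 2 ^+ m (inord 2)).
Proof. by rewrite mpolyXE_id big_ord3. Qed.

Lemma mpolyX4 (m : 'X_{1..4}) : 'X_[m] = X 0 ^+ m (inord 0) *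
  (X 1 ^+ m (inord 1) * (X 2 ^+ m (inord 2) * X 3 ^+ m (inord 3))).
Proof. by rewrite mpolyXE_id big_ord4. Qed.

Lemma seq4X (R : Type) (x0 : R) (l : seq R) (i : nat) : (i < 4)%N ->
  nth x0 l (inord i : 'I_4) = nth x0 l i.
Proof. by move=> i4; rewrite inordK. Qed.

Lemma mpolyX_mnm3 a b c : 'X_[mnm3 a b c] = x 0 ^+ a * (x 1 ^+ b * x 2 ^+ c).
Proof. by rewrite mpolyX3; congr (_ ^+ _ * (_ ^+ _ * _ ^+ _)); rewrite mnm3E. Qed.

Lemma mpolyX_mnm4 a b c d :
  'X_[mnm4 a b c d] = X 0 ^+ a * (X 1 ^+ b * (X 2 ^+ c * X 3 ^+ d)).
Proof.
by rewrite mpolyX4; congr (_ ^+ _ * (_ ^+ _ * (_ ^+ _ * _ ^+ _))); rewrite mnm4E.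
Qed.

Lemma mnm4_eta (m : 'X_{1..4}) : m = mnm4 (m (inord 0)) (m (inord 1)) (m (inord 2)) (m (inord 3)).
Proof. by apply/mnmP; apply: ord4P; rewrite mnm4E. Qed.

(* x^n, y^n, xy, z generate the invariants of diag(zeta, zeta^-1, 1), zeta of order n. *)
Definition axis_map n : {mpoly C[4]} -> {mpoly C[3]} :=
  comp_mpoly [tuple nth 0 [:: x 0 ^+ n; x 1 ^+ n; x 0 * x 1; x 2] i | i < 4].
HB.instance Definition _ n := GRing.RMorphism.on (axis_map n).

Definition axis_mnm n (m : 'X_{1..4}) : 'X_{1..3} :=
  mnm3 (n * m (inord 0) + m (inord 2)) (n * m (inord 1) + m (inord 2)) (m (inord 3)).
(** The common part of the exponents of x and y is carried by xy, the excess by x^n or y^n.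
    Truncated subtraction makes one of the first two exponents 0, so normal forms contain no product
    of the first two variables. *)
Definition axis_nf n (m : 'X_{1..3}) : 'X_{1..4} :=
  mnm4 ((m (inord 0) - m (inord 1)) %/ n) ((m (inord 1) - m (inord 0)) %/ n)
    (minn (m (inord 0)) (m (inord 1))) (m (inord 2)).

Lemma axis_mapX n i : (i < 4)%N ->
  axis_map n (X i) = nth 0 [:: x 0 ^+ n; x 1 ^+ n; x 0 * x 1; x 2] i.
Proof. by move=> i4; rewrite /axis_map comp_tupleX seq4X. Qed.

Lemma axis_map_mnm n m : axis_map n 'X_[m] = 'X_[axis_mnm n m].
Proof.
rewrite mpolyX4 /axis_mnm mpolyX_mnm3; move: (m (inord 0)) (m (inord 1)) (m (inord 2)) (m (inord 3)) => a b c d.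
rewrite 3!rmorphM 4!rmorphXn /= (@axis_mapX n 0) // (@axis_mapX n 1) // (@axis_mapX n 2) //.
rewrite (@axis_mapX n 3) //=; move: (x 0) (x 1) (x 2) => u v w.
by rewrite !exprD !exprM exprMn; ring.
Qed.

Lemma axis_ker n p : (0 < n)%N -> axis_map n p = 0 ->
  p \in principal_ideal (X 0 * X 1 - X 2 ^+ n).
Proof.
move=> n0; apply: (monomial_map_ker (la := axis_nf n) _ (axis_map_mnm n)) => [c|m].
  exact: comp_mpolyC.
rewrite (mnm4_eta m); move: (m (inord 0)) (m (inord 1)) (m (inord 2)) (m (inord 3)) => i j k l.
have -> : axis_nf n (axis_mnm n (mnm4 i j k l)) = mnm4 (i - j) (j - i) (n * minn i j + k) l.
  rewrite /axis_nf /axis_mnm !mnm4E !mnm3E !subnDr -!mulnBr !mulKn //.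
  by rewrite -addn_minl minnMr.
have ei : i = (minn i j + (i - j))%N by rewrite /minn; case: ltnP; lia.
have ej : j = (minn i j + (j - i))%N by rewrite /minn; case: ltnP; lia.
(* With [t] the minimum of [i] and [j], the difference is a multiple of (UV)^t - (W^n)^t. *)
suff key t u v : 'X_[mnm4 (t + u) (t + v) k l] - 'X_[mnm4 u v (n * t + k) l]
    \in principal_ideal (X 0 * X 1 - X 2 ^+ n).
  by have := key (minn i j) (i - j)%N (j - i)%N; rewrite -ei -ej.
rewrite !mpolyX_mnm4; move: (X 0) (X 1) (X 2) (X 3) => U V W Z.
have -> : U ^+ (t + u) * (V ^+ (t + v) * (W ^+ k * Z ^+ l)) -
    U ^+ u * (V ^+ v * (W ^+ (n * t + k) * Z ^+ l)) =
    U ^+ u * V ^+ v * W ^+ k * Z ^+ l * ((U * V) ^+ t - (W ^+ n) ^+ t).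
  by rewrite exprMn -exprM !exprD; ring.
exact/ideal_mull/subrXX_ideal.
Qed.

Lemma axis_onto n s : (0 < n)%N ->
  (forall m, m \in msupp s -> m (inord 0) = m (inord 1) %[mod n]) ->
  exists p, axis_map n p = s.
Proof.
move=> n0 hs; apply: (monomial_map_onto (la := axis_nf n) _ (axis_map_mnm n)) => [c|m].
  exact: comp_mpolyC.
move=> /hs/eqP e; apply: mnm3_ext; rewrite !mnm3E !mnm4E //.
  case: (leqP (m (inord 0)) (m (inord 1))) => h; last first.
    rewrite mulnC divnK; [lia|by rewrite -eqn_mod_dvd // ltnW].
  by rewrite (_ : _ - _ = 0)%N ?div0n ?muln0 //; lia.
case: (leqP (m (inord 0)) (m (inord 1))) => h.
  rewrite mulnC divnK; [lia|by rewrite -eqn_mod_dvd // eq_sym].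
by rewrite (_ : _ - _ = 0)%N ?div0n ?muln0 //; lia.
Qed.

(* x^2, y^2, z^2, xyz generate the invariants of the diagonal Klein four-group. *)
Definition klein_map : {mpoly C[4]} -> {mpoly C[3]} :=
  comp_mpoly [tuple nth 0 [:: x 0 ^+ 2; x 1 ^+ 2; x 2 ^+ 2; x 0 * x 1 * x 2] i | i < 4].
HB.instance Definition _ := GRing.RMorphism.on klein_map.

Definition klein_mnm (m : 'X_{1..4}) : 'X_{1..3} :=
  mnm3 (2 * m (inord 0) + m (inord 3)) (2 * m (inord 1) + m (inord 3))
    (2 * m (inord 2) + m (inord 3)).
(** For an invariant monomial the three exponents have the same parity; that parity, read off from
    the first exponent, is the exponent of xyz. *)
Definition klein_nf (m : 'X_{1..3}) : 'X_{1..4} :=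
  mnm4 (m (inord 0) %/ 2) (m (inord 1) %/ 2) (m (inord 2) %/ 2) (m (inord 0) %% 2).

Lemma klein_mapX i : (i < 4)%N ->
  klein_map (X i) = nth 0 [:: x 0 ^+ 2; x 1 ^+ 2; x 2 ^+ 2; x 0 * x 1 * x 2] i.
Proof. by move=> i4; rewrite /klein_map comp_tupleX seq4X. Qed.

Lemma klein_map_mnm m : klein_map 'X_[m] = 'X_[klein_mnm m].
Proof.
rewrite mpolyX4 /klein_mnm mpolyX_mnm3; move: (m (inord 0)) (m (inord 1)) (m (inord 2)) (m (inord 3)) => a b c d.
rewrite 3!rmorphM 4!rmorphXn /= (@klein_mapX 0) // (@klein_mapX 1) // (@klein_mapX 2) //.
rewrite (@klein_mapX 3) //=; move: (x 0) (x 1) (x 2) => u v w.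
by rewrite (exprD u (2 * a)) (exprD v (2 * b)) (exprD w (2 * c)) !exprM !exprMn; ring.
Qed.

Lemma klein_ker p : klein_map p = 0 ->
  p \in principal_ideal (X 0 * X 1 * X 2 - X 3 ^+ 2).
Proof.
apply: (monomial_map_ker (la := klein_nf) _ klein_map_mnm) => [c|m].
  exact: comp_mpolyC.
rewrite (mnm4_eta m); move: (m (inord 0)) (m (inord 1)) (m (inord 2)) (m (inord 3)) => i j k l.
have -> : klein_nf (klein_mnm (mnm4 i j k l)) =
    mnm4 (i + l %/ 2) (j + l %/ 2) (k + l %/ 2) (l %% 2).
  by rewrite /klein_nf /klein_mnm !mnm4E !mnm3E ![(2 * _)%N]mulnC !divnMDl // modnMDl.
rewrite {1}(divn_eq l 2); move: (l %/ 2)%N (l %% 2)%N => t u {l}.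
rewrite !mpolyX_mnm4; move: (X 0) (X 1) (X 2) (X 3) => U V W Z.
have -> : U ^+ i * (V ^+ j * (W ^+ k * Z ^+ (t * 2 + u))) -
    U ^+ (i + t) * (V ^+ (j + t) * (W ^+ (k + t) * Z ^+ u)) =
    - (U ^+ i * V ^+ j * W ^+ k * Z ^+ u) * ((U * V * W) ^+ t - (Z ^+ 2) ^+ t).
  by rewrite (exprD Z (t * 2)) exprM !exprMn !exprD; ring.
exact/ideal_mull/subrXX_ideal.
Qed.

Lemma klein_onto s : (forall m, m \in msupp s ->
    m (inord 0) = m (inord 1) %[mod 2] /\ m (inord 0) = m (inord 2) %[mod 2]) ->
  exists p, klein_map p = s.
Proof.
move=> hs; apply: (monomial_map_onto (la := klein_nf) _ klein_map_mnm) => [c|m].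
  exact: comp_mpolyC.
move=> /hs[e1 e2]; apply: mnm3_ext; rewrite !mnm3E !mnm4E mulnC.
- by rewrite -divn_eq.
- by rewrite e1 -divn_eq.
- by rewrite e2 -divn_eq.
Qed.
End ToricPresentations.

(** * Coprimality of polynomials and invariants of diagonal matrices *)

Section MpolyPrimes.
Variables (C : fieldType) (n : nat).
Implicit Types (q d s : {mpoly C[n]}).

(** A prime dividing a nonzero [d] of degree at most one is [d] up to a constant, so whatever it
    divides vanishes on the zeros of [d]. Coprimality is then refuted or shown by evaluating at one
    point. *)
Lemma prime_dv_linear q d s v : prime_elt q -> d != 0 -> (msize d <= 2)%N -> dv q d -> dv q s ->
  d.@[v] = 0 -> s.@[v] = 0.
Proof.
move=> qp d0 sd [c ec] [y ey]; have [q0 qu _] := qp.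
have c0 : c != 0 by apply: contraNneq d0 => c0; rewrite ec c0 mul0r.
have sq : (1 < msize q)%N.
  rewrite ltnNge; apply: contraNN qu => /msize1_polyC e; move: q0.
  by rewrite e mpolyC_eq0 => ?; rewrite rmorph_unit ?unitfE.
have sc : (msize c <= 1)%N.
  move: sd sq; rewrite ec msizeM //; move: (msize c) (msize q) => a b.
  by case: b => [|[|b]] //; rewrite !addnS /= !ltnS; lia.
have e : c = (c@_0%MM)%:MP := msize1_polyC sc.
move=> dv0; move: dv0; rewrite ec mevalM e mevalC => /eqP; rewrite mulf_eq0.
have -> : (c@_0%MM == 0) = false by apply: contraNF c0 => /eqP h; rewrite e h mpolyC0.
by move=> /eqP qv; rewrite ey mevalM qv mulr0.
Qed.

Lemma mpolyX_coprime (i j : 'I_n) : i != j -> coprime_elt ('X_i : {mpoly C[n]}) 'X_j.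
Proof.
move=> ij q qp qi qj; have := @prime_dv_linear q 'X_i 'X_j (fun l => (l == j)%:R) qp.
rewrite -msize_poly_eq0 msizeX mdeg1 !mevalXU eqxx (negPf ij) => /(_ isT isT qi qj erefl)/eqP.
by rewrite oner_eq0.
Qed.

Lemma lsubst_diag_mnm (d : 'rV[C]_n) m :
  lsubst (diag_mx d) 'X_[m] = (\prod_i d 0 i ^+ m i) *: 'X_[m].
Proof.
have dX i : lsubst (diag_mx d) 'X_i = (d 0 i)%:MP * 'X_i.
  rewrite lsubstX (bigD1 i) //= mxE eqxx mulr1n big1 ?addr0 ?mul_mpolyC // => j /negPf ji.
  by rewrite mxE eq_sym ji mulr0n scale0r.
rewrite [in LHS]mpolyXE_id rmorph_prod -mul_mpolyC rmorph_prod [in RHS]mpolyXE_id -big_split.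
by apply: eq_bigr => i _; rewrite !rmorphXn /= dX exprMn.
Qed.

Lemma lsubst_diag_coeff (d : 'rV[C]_n) s m :
  (lsubst (diag_mx d) s)@_m = (\prod_i d 0 i ^+ m i) * s@_m.
Proof.
rewrite {1}[s]mpolyE rmorph_sum raddf_sum /=.
under eq_bigr => j _ do rewrite lsubstZ lsubst_diag_mnm scalerA mcoeffZ mcoeffX.
have [ms|ms] := boolP (m \in msupp s).
  rewrite (bigD1_seq m) ?msupp_uniq //= eqxx mulr1 [X in _ + X]big1 => [|j /negPf jm].
    by rewrite addr0 mulrC.
  by rewrite jm mulr0.
rewrite big_seq big1 => [|j js]; first by rewrite memN_msupp_eq0 ?mulr0.
by case: eqP => [e|_]; rewrite ?mulr0 //; rewrite -e js in ms.
Qed.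

Lemma lsubst_diag_fixed (d : 'rV[C]_n) s m : lsubst (diag_mx d) s = s -> m \in msupp s ->
  \prod_i d 0 i ^+ m i = 1.
Proof.
move=> e; rewrite mcoeff_msupp => sm; apply: (mulIf sm).
by rewrite -lsubst_diag_coeff e mul1r.
Qed.

Lemma lsubst_prime g q : g \in unitmx -> prime_elt q -> prime_elt (lsubst g q).
Proof.
move=> gu; exact: (@iso_prime _ _ (lsubst g) (lsubst (invmx g)) (lsubstK gu) (lsubstKV gu)).
Qed.

Lemma lsubst_dv g q s : g \in unitmx -> dv q (lsubst g s) -> dv (lsubst (invmx g) q) s.
Proof.
move=> gu; have ku := lsubstKV (g := invmx g); rewrite unitmx_inv invmxK in ku.
rewrite -{2}(lsubstK gu s) => /(@iso_dv _ _ (lsubst (invmx g)) (lsubst g) (lsubstKV gu)).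
by [].
Qed.

Lemma coprime_monomials r (e : {rmorphism {mpoly C[r]} -> {mpoly C[n]}}) (m1 m2 : 'X_{1..r}) q :
  (forall i j, m1 i != 0%N -> m2 j != 0%N -> coprime_elt (e 'X_i) (e 'X_j)) -> prime_elt q ->
  dv q (e 'X_[m1]) -> ~ dv q (e 'X_[m2]).
Proof.
move=> cop qp h1 h2.
have factor m : dv q (e 'X_[m]) -> exists2 i, m i != 0%N & dv q (e 'X_i).
  rewrite mpolyXE_id rmorph_prod => h0.
  have [i h] := @prime_dv_prodfin _ q _ (fun i : 'I_r => e ('X_i ^+ m i)) qp h0.
  rewrite rmorphXn in h.
  exists i; last exact: prime_dvX h.
  by apply: contra_notN (prime_dv1 qp) => /eqP m0; rewrite m0 expr0 in h.
have [i mi qi] := factor m1 h1; have [j mj qj] := factor m2 h2.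
exact: (cop i j mi mj q qp qi qj).
Qed.
End MpolyPrimes.

Section DihedralMatrices.
Variable C : fieldType.
Local Notation x i := ('X_(inord i) : {mpoly C[3]}).

Definition perm3 (sw : bool) (i : 'I_3) : 'I_3 :=
  inord (nth 0%N (if sw then [:: 1; 0; 2] else [:: 0; 1; 2]) i)%N.

Definition dihedral_mx (sw : bool) (a b c : C) : 'M[C]_3 :=
  \matrix_(i, j) (nth 0 [:: a; b; c] i *+ (j == perm3 sw i)).

Lemma perm3K sw : involutive (perm3 sw).
Proof. by case: sw => i; elim/ord3P: i; rewrite /perm3 !inordK. Qed.

Lemma dihedral_mx_subst sw a b c i :
  lsubst (dihedral_mx sw a b c) 'X_i = (nth 0 [:: a; b; c] i)%:MP * 'X_(perm3 sw i).
Proof.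
rewrite lsubstX (bigD1 (perm3 sw i)) //= mxE eqxx mulr1n big1 ?addr0 ?mul_mpolyC // => j /negPf ji.
by rewrite mxE ji mulr0n scale0r.
Qed.

Lemma dihedral_mx_subst3 sw a b c :
  [/\ lsubst (dihedral_mx sw a b c) (x 0) = a%:MP * (if sw then x 1 else x 0),
      lsubst (dihedral_mx sw a b c) (x 1) = b%:MP * (if sw then x 0 else x 1)
    & lsubst (dihedral_mx sw a b c) (x 2) = c%:MP * x 2].
Proof. by rewrite !dihedral_mx_subst /perm3 !inordK //=; case: sw. Qed.

(** Hence a polynomial on which a diagonal and a swapping generator commute is fixed by diag(r, 1/r,
    1). *)
Lemma dihedral_commutator (r a b c a' b' c' : C) : r != 0 -> a = r * b ->
  dihedral_mx false a b c *m dihedral_mx true a' b' c' =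
  diag_mx (\row_i nth 0 [:: r; r^-1; 1] i) *m
    (dihedral_mx true a' b' c' *m dihedral_mx false a b c).
Proof.
move=> r0 ->.
have mulE sw sw' p q s p' q' s' i j :
    (dihedral_mx sw p q s *m dihedral_mx sw' p' q' s') i j =
    nth 0 [:: p; q; s] i * (nth 0 [:: p'; q'; s'] (perm3 sw i) *+ (j == perm3 sw' (perm3 sw i))).
  rewrite mxE (bigD1 (perm3 sw i)) //= !mxE eqxx mulr1n big1 ?addr0 // => l /negPf li.
  by rewrite mxE li mulr0n mul0r.
apply/matrixP => i j; rewrite mul_diag_mx mxE !mulE mxE.
have -> : perm3 true (perm3 false i) = perm3 false (perm3 true i).
  by elim/ord3P: i; rewrite /perm3 !inordK.
move: (j == _) => t; rewrite !mulrnAr; congr (_ *+ _).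
by elim/ord3P: i; rewrite /perm3 !inordK //=; field.
Qed.
End DihedralMatrices.

Lemma dihedral_mx_monomial (C : numClosedFieldType) sw (a b c : C) N :
  a ^+ N = 1 -> b ^+ N = 1 -> c ^+ N = 1 ->
  exists s d, (forall j, d j ^+ N = 1) /\ dihedral_mx sw a b c = monomial_mx s d.
Proof.
(* [monomial_mx] lists the nonzero entries by column, [dihedral_mx] by row, so they are permuted. *)
move=> aN bN cN; exists (perm3 sw), (fun j => nth 0 [:: a; b; c] (perm3 sw j)); split.
  by apply: ord3P; case: sw; rewrite /perm3 !inordK.
apply/matrixP => i j; rewrite !mxE.
have -> : (j == perm3 sw i) = (i == perm3 sw j).
  by apply/eqP/eqP => ->; rewrite perm3K.
by case: eqP => [->|_]; rewrite ?perm3K ?mulr0n.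
Qed.

(** * Groups of dihedral type *)

Lemma mpolyC_natV (C : numFieldType) n k : (0 < k)%N -> k%:R^-1%:MP * k%:R = 1 :> {mpoly C[n]}.
Proof. by move=> k0; rewrite -(rmorph_nat (@mpolyC n C)) -mpolyCM mulVf // pnatr_eq0 -lt0n. Qed.

Section DihedralPresentation.
Variables (C : numClosedFieldType) (n : nat) (kappa : C) (jP jQ jW jZ : 'I_4).
Hypotheses (n0 : (0 < n)%N) (k0 : kappa != 0) (ju : uniq [:: jP; jQ; jW; jZ]).
Local Notation X i := ('X_(inord i) : {mpoly C[4]}).
Local Notation x i := ('X_(inord i) : {mpoly C[3]}).

Lemma index4P (P : 'I_4 -> Prop) : P jP -> P jQ -> P jW -> P jZ -> forall j, P j.
Proof.
move=> hP hQ hW hZ j; have : j \in [:: jP; jQ; jW; jZ].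
  have sub : {subset [:: jP; jQ; jW; jZ] <= enum 'I_4} by move=> i _; rewrite mem_enum.
  by have [|_ ->] := uniq_min_size ju sub; rewrite ?size_enum_ord ?mem_enum.
by rewrite !inE => /or4P[] /eqP ->.
Qed.

(** The order of the T_j varies from case to case. [jP], [jQ], [jW], [jZ] are the positions of the
    difference and the sum of x^n and y^n, of xy, and of z. *)
Definition select4 (T : Type) (u v w t : T) (j : 'I_4) : T :=
  if j == jP then u else if j == jQ then v else if j == jW then w else t.

Lemma select4E (T : Type) (u v w t : T) : [/\ select4 u v w t jP = u,
  select4 u v w t jQ = v, select4 u v w t jW = w & select4 u v w t jZ = t].
Proof.
move: ju; rewrite /= !inE !negb_or => /and4P[/and3P[PQ PW PZ] /andP[QW QZ] WZ _].
by rewrite /select4 !eqxx ![jQ == _]eq_sym ![jW == _]eq_sym ![jZ == _]eq_sym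
  !(negPf PQ, negPf PW, negPf PZ, negPf QW, negPf QZ, negPf WZ).
Qed.

Definition dihedral_gen : 'I_4 -> {mpoly C[3]} :=
  select4 (kappa^-1%:MP * (x 0 ^+ n - x 1 ^+ n)) (x 0 ^+ n + x 1 ^+ n) (x 0 * x 1) (x 2).

Definition dihedral_genE : [/\ dihedral_gen jP = kappa^-1%:MP * (x 0 ^+ n - x 1 ^+ n),
  dihedral_gen jQ = x 0 ^+ n + x 1 ^+ n, dihedral_gen jW = x 0 * x 1
  & dihedral_gen jZ = x 2] := select4E _ _ _ _.

Definition dihedral_map : {mpoly C[4]} -> {mpoly C[3]} :=
  comp_mpoly [tuple dihedral_gen i | i < 4].
HB.instance Definition _ := GRing.RMorphism.on dihedral_map.

Lemma dihedral_mapC c : dihedral_map c%:MP = c%:MP.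
Proof. exact: comp_mpolyC. Qed.

Lemma dihedral_mapX j : dihedral_map 'X_j = dihedral_gen j.
Proof. exact: comp_tupleX. Qed.

Definition axis_mx : 'M[C]_4 := \matrix_(i, l) (select4 [:: kappa^-1; - kappa^-1; 0; 0]
  [:: 1; 1; 0; 0] [:: 0; 0; 1; 0] [:: 0; 0; 0; 1] i)`_l.
Local Notation to_axis := (lsubst axis_mx).

Lemma to_axisX : [/\ to_axis 'X_jP = kappa^-1%:MP * (X 0 - X 1), to_axis 'X_jQ = X 0 + X 1,
  to_axis 'X_jW = X 2 & to_axis 'X_jZ = X 3].
Proof.
have [eP eQ eW eZ] := select4E [:: kappa^-1; - kappa^-1; 0; 0]
  [:: 1; 1; 0; 0] [:: 0; 0; 1; 0] [:: 0; 0; 0; 1].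
rewrite !lsubstX !big_ord4 !mxE eP eQ eW eZ !inordK //= !scale0r !scale1r ?(addr0, add0r).
by split=> //; rewrite scaleNr mul_mpolyC scalerBr.
Qed.

Lemma axis_mx_unit : axis_mx \in unitmx.
Proof.
(* Twice the inverse, from 2 x^n = Q + kappa P and 2 y^n = Q - kappa P. *)
pose B : 'M[C]_4 := \matrix_(l, j) (select4 [:: kappa; - kappa; 0; 0]
  [:: 1; 1; 0; 0] [:: 0; 0; 2; 0] [:: 0; 0; 0; 2] j)`_l.
suff e : axis_mx *m (2^-1 *: B) = 1%:M by have [] := mulmx1_unit e.
have [p1 p2 p3 p4] := select4E [:: kappa^-1; - kappa^-1; 0; 0]
  [:: 1; 1; 0; 0] [:: 0; 0; 1; 0] [:: 0; 0; 0; 1].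
have [q1 q2 q3 q4] := select4E [:: kappa; - kappa; 0; 0]
  [:: 1; 1; 0; 0] [:: 0; 0; 2; 0] [:: 0; 0; 0; 2].
rewrite -scalemxAr; apply/matrixP => i j; rewrite !mxE big_ord4 !mxE !inordK //.
have : 2 != 0 :> C by rewrite pnatr_eq0.
move: ju; rewrite /= !inE !negb_or => /and4P[/and3P[PQ PW PZ] /andP[QW QZ] WZ _] h2.
move: j; apply: (@index4P (fun i => forall j, _)) i => j; move: j; apply: index4P.
all: rewrite ?(p1, p2, p3, p4) ?(q1, q2, q3, q4) ?eqxx 1?[jQ == _]eq_sym 1?[jW == _]eq_sym 1?[jZ == _]eq_sym.
all: rewrite ?(negPf PQ, negPf PW, negPf PZ, negPf QW, negPf QZ, negPf WZ) /=.
all: by field; rewrite ?k0 ?h2.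
Qed.

Lemma kappa_mpolyC m : kappa^-1%:MP * kappa%:MP = 1 :> {mpoly C[m]}.
Proof. by rewrite -mpolyCM mulVf. Qed.

Lemma dihedral_map_axis p : dihedral_map p = axis_map n (to_axis p).
Proof.
have [tP tQ tW tZ] := to_axisX; have [gP gQ gW gZ] := dihedral_genE.
apply: (@mpoly_rmorph_ext _ _ _ dihedral_map (axis_map n \o lsubst axis_mx)) => [c|] /=.
  by rewrite dihedral_mapC lsubstC [RHS]comp_mpolyC.
have aC (c : C) : axis_map n c%:MP = c%:MP by apply: comp_mpolyC.
have [a0 a1 a2 a3] := And4 (@axis_mapX C n 0 isT) (@axis_mapX C n 1 isT)
  (@axis_mapX C n 2 isT) (@axis_mapX C n 3 isT).
apply: index4P => /=; rewrite dihedral_mapX.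
- by rewrite gP tP rmorphM rmorphB /= aC a0 a1.
- by rewrite gQ tQ rmorphD /= a0 a1.
- by rewrite gW tW a2.
- by rewrite gZ tZ a3.
Qed.

(** The identity 4uv = (u+v)^2 - (u-v)^2 for u = x^n, v = y^n. The scalar [kappa] rescales the
    difference u - v so that other coefficients of its square can be matched. *)
Definition dihedral_rel : {mpoly C[4]} :=
  4 * 'X_jW ^+ n + (kappa ^+ 2)%:MP * 'X_jP ^+ 2 - 'X_jQ ^+ 2.

Lemma to_axis_rel : to_axis dihedral_rel = - 4 * (X 0 * X 1 - X 2 ^+ n).
Proof.
have [tP tQ tW tZ] := to_axisX; have hk := kappa_mpolyC 4.
rewrite /dihedral_rel rmorphB rmorphD !rmorphM !rmorphXn rmorph_nat /= lsubstC tP tQ tW.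
move: hk; move: (kappa^-1%:MP) (kappa%:MP) (X 0) (X 1) (X 2 ^+ n) => l k u v w hk.
transitivity (4 * w + (l * k) ^+ 2 * (u - v) ^+ 2 - (u + v) ^+ 2); first by ring.
by rewrite hk; ring.
Qed.

Lemma dihedral_map_rel : dihedral_map dihedral_rel = 0.
Proof.
rewrite dihedral_map_axis to_axis_rel rmorphM rmorphB rmorphM rmorphXn /=.
rewrite (@axis_mapX C n 0) // (@axis_mapX C n 1) // (@axis_mapX C n 2) //=.
by rewrite exprMn subrr mulr0.
Qed.

Lemma dihedral_ker p : dihedral_map p = 0 -> p \in principal_ideal dihedral_rel.
Proof.
rewrite dihedral_map_axis => /(axis_ker n0)/asboolP[q e].
apply/asboolP; exists (- 4^-1%:MP * lsubst (invmx axis_mx) q); apply: (can_inj (lsubstK axis_mx_unit)).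
rewrite e rmorphM rmorphM rmorphN /= (lsubstKV axis_mx_unit) lsubstC to_axis_rel.
have h4 := @mpolyC_natV C 4 4 isT.
move: h4; move: (X 0 * X 1 - X 2 ^+ n) (4^-1%:MP) => w t h4.
by transitivity ((t * 4) * (q * w)); [rewrite h4 mul1r|ring].
Qed.

Lemma dihedral_onto s r : n.-primitive_root r ->
  lsubst (diag_mx (\row_i nth 0 [:: r; r^-1; 1] i)) s = s -> exists p, dihedral_map p = s.
Proof.
move=> rp hs; have r0 : r != 0.
  apply/eqP => e; have := prim_expr_order rp; rewrite e expr0n gtn_eqF // => /eqP.
  by rewrite eq_sym oner_eq0.
have [p <-] : exists p, axis_map n p = s.
  apply: axis_onto => // m /(lsubst_diag_fixed hs); rewrite big_ord3 !mxE !inordK //= expr1n mulr1.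
  rewrite exprVn => /eqP; rewrite -[1](mulfV (expf_neq0 (m (inord 1)) r0)).
  rewrite (inj_eq (mulIf _)) ?invr_eq0 ?expf_neq0 //.
  by rewrite (eq_prim_root_expr rp) => /eqP.
by exists (lsubst (invmx axis_mx) p); rewrite dihedral_map_axis (lsubstKV axis_mx_unit).
Qed.

(** For two generators in x and y, a common prime would divide both x and y. Pairs of a sum or
    difference with z are separated by evaluation. *)
Lemma dihedral_gen_coprime i j : i != j -> coprime_elt (dihedral_gen i) (dihedral_gen j).
Proof.
have [gP gQ gW gZ] := dihedral_genE.
have var l m : (l < 3)%N -> (m < 3)%N -> l != m -> coprime_elt (x l) (x m).
  by move=> l3 m3 lm; apply: mpolyX_coprime; rewrite -val_eqE /= !inordK.
have dvXn (q s : {mpoly C[3]}) : dv q s -> dv q (s ^+ n).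
  by case: (n) n0 => // m _ h; rewrite exprS; apply: dv_mulr.
have unit_dvM (c : C) (q s : {mpoly C[3]}) : c != 0 -> dv q (c%:MP * s) -> dv q s.
  move=> c0 [w e]; exists (c^-1%:MP * w).
  by rewrite -mulrA -e mulrA -mpolyCM mulVf // mpolyC1 mul1r.
have kP q : dv q (dihedral_gen jP) -> dv q (x 0 ^+ n - x 1 ^+ n).
  by rewrite gP; apply: unit_dvM; rewrite invr_neq0.
have sumW q (s : C) : prime_elt q -> s != 0 ->
    dv q (x 0 ^+ n + s%:MP * x 1 ^+ n) -> ~ dv q (x 0 * x 1).
  move=> qp s0 h /(prime_dvM qp)[h0|h1]; apply: (var 0%N 1%N _ _ _ q qp) => //.
    have := dvB h (dvXn _ _ h0); rewrite addrC addKr => /(unit_dvM _ _ _ s0).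
    exact: prime_dvX.
  have := dvB h (dv_mull s%:MP (dvXn _ _ h1)); rewrite addrK.
  exact: prime_dvX.
have sumZ q (s : C) : prime_elt q -> dv q (x 0 ^+ n + s%:MP * x 1 ^+ n) -> ~ dv q (x 2).
  (* At the point (1, 0, 0) the variable z vanishes while x^n + s y^n is 1. *)
  move=> qp h h2; have := @prime_dv_linear _ _ q (x 2) _ (fun l => (l == inord 0)%:R) qp _ _ h2 h.
  rewrite -msize_poly_eq0 msizeX mdeg1 mevalD mevalM !rmorphXn /= !mevalXU -!val_eqE /= !inordK //=.
  by rewrite expr1n expr0n gtn_eqF // mulr0 addr0 => /(_ isT isT erefl)/eqP; rewrite oner_eq0.
have eP : x 0 ^+ n - x 1 ^+ n = x 0 ^+ n + (-1)%:MP * x 1 ^+ n by rewrite mpolyCN mpolyC1 mulN1r.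
have eQ : x 0 ^+ n + x 1 ^+ n = x 0 ^+ n + 1%:MP * x 1 ^+ n by rewrite mpolyC1 mul1r.
have N1 : (-1 : C) != 0 by rewrite oppr_eq0 oner_neq0.
have sym (a b : {mpoly C[3]}) : coprime_elt a b -> coprime_elt b a.
  by move=> h q qp qa qb; apply: (h q).
have cPQ : coprime_elt (dihedral_gen jP) (dihedral_gen jQ).
  move=> q qp /kP qP; rewrite gQ => qQ.
  have h : dv q (x 0).
    apply: (prime_dvX (n := n) qp); apply: (@unit_dvM 2); first by rewrite pnatr_eq0.
    by have := dvD qP qQ; rewrite addrACA addNr addr0 -mulr2n -[_ ^+ n *+ 2]mulr_natl -(rmorph_nat (@mpolyC 3 C)).
  by apply: (sumW q 1 qp (oner_neq0 _)); [rewrite -eQ|apply: dv_mulr].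
have cPW : coprime_elt (dihedral_gen jP) (dihedral_gen jW).
  by move=> q qp /kP; rewrite gW eP; apply: sumW.
have cPZ : coprime_elt (dihedral_gen jP) (dihedral_gen jZ).
  by move=> q qp /kP; rewrite gZ eP; apply: sumZ.
have cQW : coprime_elt (dihedral_gen jQ) (dihedral_gen jW).
  by move=> q qp; rewrite gQ gW eQ; apply: sumW; rewrite ?oner_neq0.
have cQZ : coprime_elt (dihedral_gen jQ) (dihedral_gen jZ).
  by move=> q qp; rewrite gQ gZ eQ; apply: sumZ.
have cWZ : coprime_elt (dihedral_gen jW) (dihedral_gen jZ).
  by move=> q qp; rewrite gW gZ => /(prime_dvM qp)[h|h]; apply: var qp h.
move: i j; apply: index4P; apply: index4P; rewrite ?eqxx // => _ //; exact: sym.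
Qed.

Lemma dihedral_gen_semi sw a b c : a ^+ n = b ^+ n ->
  let h := dihedral_mx sw a b c in
  [/\ lsubst h (dihedral_gen jP) = ((-1) ^+ sw * a ^+ n)%:MP * dihedral_gen jP,
      lsubst h (dihedral_gen jQ) = (a ^+ n)%:MP * dihedral_gen jQ,
      lsubst h (dihedral_gen jW) = (a * b)%:MP * dihedral_gen jW
    & lsubst h (dihedral_gen jZ) = c%:MP * dihedral_gen jZ].
Proof.
move=> ab h; have [gP gQ gW gZ] := dihedral_genE.
have [h0 h1 h2] := dihedral_mx_subst3 sw a b c.
have hX0 : lsubst h (x 0 ^+ n) = (a ^+ n)%:MP * (if sw then x 1 ^+ n else x 0 ^+ n).
  by rewrite rmorphXn /= h0 exprMn rmorphXn; case: (sw).
have hX1 : lsubst h (x 1 ^+ n) = (a ^+ n)%:MP * (if sw then x 0 ^+ n else x 1 ^+ n).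
  by rewrite rmorphXn /= h1 exprMn ab rmorphXn; case: (sw).
rewrite gP gQ gW gZ; split=> //.
- rewrite rmorphM rmorphB /= lsubstC hX0 hX1 mpolyCM.
  by case: (sw); rewrite ?expr1 ?expr0 ?mpolyCN ?mpolyC1; ring.
- by rewrite rmorphD /= hX0 hX1; case: (sw); ring.
- by rewrite rmorphM /= h0 h1 mpolyCM; case: (sw); ring.
Qed.
End DihedralPresentation.

Section DihedralCase.
Variables (C : numClosedFieldType) (g : bool -> 'M[C]_3) (P : 'M[C]_3) (d : bool).
Variables (n N : nat) (a b c a' b' c' r kappa : C) (jP jQ jW jZ : 'I_4).
Hypotheses (Pu : P \in unitmx) (N0 : (0 < N)%N) (rp : n.-primitive_root r) (k0 : kappa != 0).
Hypothesis ju : uniq [:: jP; jQ; jW; jZ].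
Hypotheses (gd : P *m g d = dihedral_mx false a b c *m P)
           (gs : P *m g (~~ d) = dihedral_mx true a' b' c' *m P).
Hypotheses (abcN : [/\ a ^+ N = 1, b ^+ N = 1 & c ^+ N = 1])
           (abcN' : [/\ a' ^+ N = 1, b' ^+ N = 1 & c' ^+ N = 1]).
Hypotheses (arb : a = r * b) (ab' : a' ^+ n = b' ^+ n).
Variables (M : zmodType) (chi : M -> bool -> C) (deg : 'I_4 -> M).
Hypothesis chi_neq0 : forall w t, chi w t != 0.
Hypothesis chiD : forall v w t, chi (v + w) t = chi v t * chi w t.
Hypothesis chi_inj : forall v w, chi v =1 chi w -> v = w.
Hypothesis chi_d : [/\ chi (deg jP) d = a ^+ n, chi (deg jQ) d = a ^+ n,
  chi (deg jW) d = a * b & chi (deg jZ) d = c].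
Hypothesis chi_s : [/\ chi (deg jP) (~~ d) = - a' ^+ n, chi (deg jQ) (~~ d) = a' ^+ n,
  chi (deg jW) (~~ d) = a' * b' & chi (deg jZ) (~~ d) = c'].
Hypothesis disjoint_monomials : forall w, exists m1 m2 : 'X_{1..4},
  [/\ mnm_weight deg m1 = w, mnm_weight deg m2 = w
    & forall i j, m1 i != 0%N -> m2 j != 0%N -> i != j].

Let n0 : (0 < n)%N := prim_order_gt0 rp.

Lemma root_neq0 m (z : C) : (0 < m)%N -> z ^+ m = 1 -> z != 0.
Proof.
move=> m0 zm; apply/eqP => z0; move: zm; rewrite z0 expr0n gtn_eqF // => /eqP.
by rewrite eq_sym oner_eq0.
Qed.

Lemma dihedral_mx_unit sw (u v w : C) : u != 0 -> v != 0 -> w != 0 ->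
  dihedral_mx sw u v w \in unitmx.
Proof.
move=> u0 v0 w0; pose h := dihedral_mx sw (if sw then v^-1 else u^-1) (if sw then u^-1 else v^-1) w^-1.
suff e : dihedral_mx sw u v w *m h = 1%:M by have [] := mulmx1_unit e.
apply/matrixP => i j; rewrite mxE (bigD1 (perm3 sw i)) //= !mxE eqxx mulr1n perm3K.
rewrite big1 ?addr0 => [|l /negPf li]; last by rewrite mxE li mulr0n mul0r.
rewrite eq_sym mulrnAr; congr (_ *+ _).
by elim/ord3P: i; case: sw h; rewrite /perm3 !inordK //= mulfV.
Qed.

(** [d] tells which generator is the diagonal one, as the generator lists come in either order. *)
Lemma gen_bool (Q : bool -> Prop) : Q d -> Q (~~ d) -> forall t, Q t.
Proof. by case: d => Qd Qs []. Qed.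

Lemma dihedral_unit t : g t \in unitmx.
Proof.
have [aN bN cN] := abcN; have [aN' bN' cN'] := abcN'.
have conj h k : h \in unitmx -> P *m k = h *m P -> k \in unitmx.
  move=> hu e; have : P *m k \in unitmx by rewrite e unitmx_mul hu.
  by rewrite unitmx_mul => /andP[].
move: t; apply: gen_bool; [apply: conj gd|apply: conj gs];
  by apply: dihedral_mx_unit; apply: (root_neq0 N0).
Qed.

Lemma dihedral_finite : exists L : seq 'M[C]_3,
  forall h, gen_group [:: g true; g false] h -> h \in L.
Proof.
have [aN bN cN] := abcN; have [aN' bN' cN'] := abcN'.
have mono t : exists s e, (forall j, e j ^+ N = 1) /\ P *m g t = monomial_mx s e *m P.
  move: t; apply: gen_bool.
    have [s [e [eN h]]] := dihedral_mx_monomial false aN bN cN.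
    by exists s, e; rewrite -h.
  have [s [e [eN h]]] := dihedral_mx_monomial true aN' bN' cN'.
  by exists s, e; rewrite -h.
apply: (monomial_group_finite N0 Pu) => h; rewrite !inE => /orP[|] /eqP -> //;
  exact: dihedral_unit.
Qed.

Definition dihedral_pres : {mpoly C[4]} -> {mpoly C[3]} :=
  lsubst P \o dihedral_map n kappa jP jQ jW.
HB.instance Definition _ := GRing.RMorphism.on dihedral_pres.

Lemma dihedral_pres_semi j t :
  lsubst (g t) (dihedral_pres 'X_j) = (chi (deg j) t)%:MP * dihedral_pres 'X_j.
Proof.
have [aN bN cN] := abcN; have [aN' bN' cN'] := abcN'.
have an : a ^+ n = b ^+ n by rewrite arb exprMn (prim_expr_order rp) mul1r.
have red h k l i : P *m k = h *m P -> lsubst h (dihedral_gen n kappa jP jQ jW i) =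
    l%:MP * dihedral_gen n kappa jP jQ jW i ->
    lsubst k (dihedral_pres 'X_i) = l%:MP * dihedral_pres 'X_i.
  move=> e hl; rewrite /dihedral_pres /= dihedral_mapX -lsubstM e lsubstM hl.
  by rewrite rmorphM /= lsubstC.
have [dP dQ dW dZ] := dihedral_gen_semi kappa ju false c an.
have [sP sQ sW sZ] := dihedral_gen_semi kappa ju true c' ab'.
rewrite mul1r in dP; rewrite mulN1r in sP.
have [eP eQ eW eZ] := chi_d; have [fP fQ fW fZ] := chi_s.
move: t; apply: gen_bool.
  have hred l i := @red _ _ l i gd; move: j; apply: (index4P ju); apply: hred.
  - by rewrite eP.
  - by rewrite eQ.
  - by rewrite eW.
  - by rewrite eZ.
have hred l i := @red _ _ l i gs; move: j; apply: (index4P ju); apply: hred.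
- by rewrite fP.
- by rewrite fQ.
- by rewrite fW.
- by rewrite fZ.
Qed.

(** In the coordinates given by [P], [dihedral_commutator] factors the diagonal matrix diag(r, 1/r,
    1) out of one of the two products; the other factor acts invertibly, so the transported
    polynomial is fixed by diag(r, 1/r, 1). *)
Lemma dihedral_pres_onto s :
  lsubst (g true) (lsubst (g false) s) = lsubst (g false) (lsubst (g true) s) ->
  exists p, dihedral_pres p = s.
Proof.
move=> hs; have {hs} hs : lsubst (g d) (lsubst (g (~~ d)) s) = lsubst (g (~~ d)) (lsubst (g d) s).
  by case: (d); [exact: hs|exact: esym hs].
pose s' := lsubst (invmx P) s; have ss' : s = lsubst P s' by rewrite lsubstKV.
have r0 := root_neq0 n0 (prim_expr_order rp).
pose hd := dihedral_mx false a b c; pose hs1 := dihedral_mx true a' b' c'.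
have gd' : P *m g d = hd *m P := gd; have gs' : P *m g (~~ d) = hs1 *m P := gs.
have comm := dihedral_commutator c a' b' c' r0 arb; rewrite -/hd -/hs1 in comm.
have hu : hs1 *m hd \in unitmx.
  have [aN bN cN] := abcN; have [aN' bN' cN'] := abcN'.
  by rewrite unitmx_mul; apply/andP; split; apply: dihedral_mx_unit; apply: (root_neq0 N0).
clearbody hd hs1; have e1 : lsubst (hs1 *m hd) s' = lsubst (hd *m hs1) s'.
  apply: (can_inj (lsubstK Pu)); rewrite -[LHS]lsubstM -[RHS]lsubstM -2!mulmxA -gd' -gs'.
  by rewrite !mulmxA -gs' -gd' -!mulmxA !lsubstM -ss'.
have [p ep] : exists p, dihedral_map n kappa jP jQ jW p = s'.
  apply: (dihedral_onto n0 k0 ju rp).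
  rewrite comm (lsubstM _ (hs1 *m hd)) in e1; exact: (esym (can_inj (lsubstK hu) e1)).
by exists p; rewrite /dihedral_pres /= ep -ss'.
Qed.

Lemma dihedral_presE p : dihedral_pres p = lsubst P (dihedral_map n kappa jP jQ jW p).
Proof. by []. Qed.

Lemma dihedral_presC x : dihedral_pres x%:MP = x%:MP.
Proof. by rewrite dihedral_presE dihedral_mapC lsubstC. Qed.

Lemma dihedral_pres_rel : dihedral_pres (dihedral_rel n kappa jP jQ jW) = 0.
Proof. by rewrite dihedral_presE (dihedral_map_rel n k0 ju) rmorph0. Qed.

Lemma dihedral_pres_ker p : dihedral_pres p = 0 ->
  p \in principal_ideal (dihedral_rel n kappa jP jQ jW).
Proof.
move=> e; apply: (dihedral_ker n0 k0 ju).
by rewrite -[LHS](lsubstK Pu) -dihedral_presE e rmorph0.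
Qed.

Lemma dihedral_pres_coprime i j : i != j ->
  coprime_elt (dihedral_pres 'X_i) (dihedral_pres 'X_j).
Proof.
move=> ij z zp; rewrite !dihedral_presE !dihedral_mapX.
move=> /(lsubst_dv Pu) h1 /(lsubst_dv Pu) h2.
apply: (dihedral_gen_coprime n0 k0 ju ij _ h1 h2).
by apply: lsubst_prime => //; rewrite unitmx_inv.
Qed.

Theorem dihedral_case :
  class_group_and_cox_ring (@inv_const C 3 (gen_group [:: g true; g false])) deg
    (dihedral_rel n kappa jP jQ jW).
Proof.
have [L GL] := dihedral_finite.
apply: (matrix_class_group_and_cox_ring (e := dihedral_pres) dihedral_unit GL
  chi_neq0 chiD chi_inj).
- exact: dihedral_presC.
- exact: dihedral_pres_rel.
- exact: dihedral_pres_semi.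
- exact: dihedral_pres_ker.
- by move=> s hs _; apply: dihedral_pres_onto.
move=> w q qp; have [m1 [m2 [w1 w2 disj]]] := disjoint_monomials w.
have [h1|h1] := pselect (dv q (dihedral_pres 'X_[m1])); last by exists m1.
exists m2 => //; apply: coprime_monomials qp h1 => i j mi mj.
exact/dihedral_pres_coprime/disj.
Qed.
End DihedralCase.

(** * Characters with values in the roots of unity *)

Section CharactersZm.
Variables (C : fieldType) (m r : nat) (rho : bool -> 'I_r -> C).
Hypothesis m1 : (1 < m)%N.
Hypothesis rhom : forall b i, rho b i ^+ m = 1.

Lemma zm_lt (z : 'Z_m) : (z < m)%N.
Proof. by have := ltn_ord z; move: (z : nat) => k; rewrite Zp_cast. Qed.

(** An element of (Z/m)^r as a character: [rho b i] is the value at generator [b] of the character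
    that the i-th row of the degree matrix records. *)
Definition zm_char (w : 'cV['Z_m]_r) (b : bool) : C := \prod_i rho b i ^+ (w i ord0 : nat).

Lemma zm_char_neq0 w b : zm_char w b != 0.
Proof.
apply/prodf_neq0 => i _; apply: expf_neq0; apply/eqP => e; have := rhom b i.
by rewrite e expr0n gtn_eqF 1?ltnW // => /eqP; rewrite eq_sym oner_eq0.
Qed.

Lemma zm_charD v w b : zm_char (v + w) b = zm_char v b * zm_char w b.
Proof.
rewrite /zm_char -big_split; apply: eq_bigr => i _; rewrite mxE /= -exprD.
by rewrite -[RHS](expr_mod _ (rhom b i)); congr (_ ^+ (_ %% _)); apply: Zp_cast.
Qed.

Hypothesis rho_prim : forall i, exists b, m.-primitive_root (rho b i) /\
  forall j, j != i -> rho b j = 1.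

(** The i-th entry is recovered from a generator at which row [i] takes a primitive root of unity
    and all other rows are trivial. *)
Lemma zm_char_inj v w : zm_char v =1 zm_char w -> v = w.
Proof.
move=> h; apply/eqP; rewrite -subr_eq0; apply/eqP/matrixP => i k; rewrite ord1 {k}.
transitivity (0 : 'Z_m); last by rewrite mxE.
have [b [bi bj]] := rho_prim i.
have : zm_char (v - w) b = 1.
  apply: (mulIf (zm_char_neq0 w b)).
  by rewrite -zm_charD subrK mul1r h.
rewrite /zm_char (bigD1 i) //= big1 ?mulr1 => [|j ji]; last by rewrite bj ?expr1n.
move/eqP; rewrite -(prim_order_dvd bi) => /dvdnP[q e]; apply: val_inj.
have h0 := zm_lt ((v - w) i ord0); rewrite e in h0; transitivity (q * m)%N; first exact: e.
case: q h0 {e} => [|q]; first by rewrite mul0n.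
by rewrite mulSn -[X in (_ < X)%N -> _]addn0 ltn_add2l.
Qed.

Variable Qn : seq (seq nat).
Local Notation Q := [seq [seq k%:R : 'Z_m | k <- l] | l <- Qn].
Local Notation deg := (fun j => col j (seqmx r 4 Q)).

Lemma zm_colE (j : 'I_4) i : (col j (seqmx r 4 Q)) i ord0 = (nth 0%N (nth [::] Qn i) j)%:R.
Proof.
rewrite !mxE; case: (ltnP i (size Qn)) => hi.
  rewrite (nth_map [::]) //; case: (ltnP j (size (nth [::] Qn i))) => hj.
    by rewrite (nth_map 0%N).
  by rewrite [LHS]nth_default ?size_map // [nth 0%N _ _]nth_default.
by rewrite !(nth_default [::]) ?size_map // [LHS]nth_nil nth_nil.
Qed.

Lemma zm_char_col (j : 'I_4) b :
  zm_char (deg j) b = \prod_i rho b i ^+ nth 0%N (nth [::] Qn i) j.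
Proof.
apply: eq_bigr => i _; rewrite zm_colE.
by rewrite val_Zp_nat // (expr_mod _ (rhom b i)).
Qed.

(* Monomials are encoded by their lists of exponents, so that the weights of a table of *)
(* monomials can be checked by computation.                                            *)
Definition row_weight (i : nat) (p : seq nat) :=
  (sumn [seq nth 0 (nth [::] Qn i) j * nth 0 p j | j <- iota 0 4] %% m)%N.

Definition has_weight (ks p : seq nat) : bool :=
  all (fun i => row_weight i p == nth 0%N ks i) (iota 0 r).

(** [D] marks the pairs of variables whose images are known to be coprime: all distinct pairs for
    the dihedral types, only T_3 with T_4 for G_7. *)
Definition separated_exps (D : rel nat) (p q : seq nat) : bool :=
  all (fun i => all (fun j => [|| nth 0 p i == 0, nth 0 q j == 0 | D i j])%N (iota 0 4)) (iota 0 4).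

Variable D : rel nat.

Hypothesis weights : forall ks, size ks = r -> all (fun k => k < m)%N ks ->
  exists p q, [&& has_weight ks p, has_weight ks q & separated_exps D p q].

Lemma zm_separated_monomials w : exists m1 m2 : 'X_{1..4},
  [/\ mnm_weight deg m1 = w, mnm_weight deg m2 = w
    & forall i j, m1 i != 0%N -> m2 j != 0%N -> D i j].
Proof.
pose ks := [seq (w i ord0 : nat) | i <- enum 'I_r].
have ksE (i : 'I_r) : nth 0%N ks i = w i ord0.
  by rewrite (nth_map i) ?size_enum_ord // nth_ord_enum.
have [||p [q /and3P[hp hq pq]]] := weights (ks := ks).
- by rewrite size_map size_enum_ord.
- by apply/allP => _ /mapP[i _ ->]; apply: zm_lt.
have weight_of s : has_weight ks s -> mnm_weight deg [multinom nth 0%N s i | i < 4] = w.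
  move=> hs; apply/matrixP => i k; rewrite ord1 {k} /mnm_weight summxE.
  have := allP hs i; rewrite mem_iota /= add0n ltn_ord => /(_ isT)/eqP.
  rewrite ksE => e; rewrite -[w i ord0]natr_Zp -e.
  rewrite /row_weight Zp_nat_mod //.
  rewrite (eq_bigr (fun j : 'I_4 => (nth 0%N (nth [::] Qn i) j * nth 0%N s j)%N%:R)); last first.
    by move=> j _; rewrite mulmxnE zm_colE mnmE -mulrnA.
  by rewrite -natr_sum big_ord4 /= !inordK // addn0.
exists [multinom nth 0%N p i | i < 4], [multinom nth 0%N q i | i < 4]; split.
- exact: weight_of.
- exact: weight_of.
move=> i j; rewrite !mnmE => /negPf pi /negPf qj.
have := allP pq i; rewrite mem_iota add0n ltn_ord => /(_ isT) h; have := allP h j.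
by rewrite mem_iota add0n ltn_ord pi qj; apply.
Qed.
End CharactersZm.

Section SmallMatrices.
Variable C : numClosedFieldType.

Lemma osum_seqmx (a b c d e : C) :
  osum (seqmx 2 2 [:: [:: a; b]; [:: c; d]]) e =
  seqmx 3 3 [:: [:: a; b; 0]; [:: c; d; 0]; [:: 0; 0; e]].
Proof.
apply/matrixP => i j; case: (@split_ordP 2 1 i) => k ->; case: (@split_ordP 2 1 j) => l ->.
- rewrite [LHS]block_mxEul !mxE /=.
  by case: k => [[|[|//]] ?]; case: l => [[|[|//]] ?].
- rewrite [LHS]block_mxEur !mxE /= !ord1.
  by case: k => [[|[|//]] ?].
- rewrite [LHS]block_mxEdl !mxE /= !ord1.
  by case: l => [[|[|//]] ?].
- by rewrite [LHS]block_mxEdr !mxE /= !ord1.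
Qed.

Lemma dihedral_mxE sw (a b c : C) : dihedral_mx sw a b c =
  seqmx 3 3 (if sw then [:: [:: 0; a; 0]; [:: b; 0; 0]; [:: 0; 0; c]]
             else [:: [:: a; 0; 0]; [:: 0; b; 0]; [:: 0; 0; c]]).
Proof.
apply/matrixP => i j; rewrite !mxE -val_eqE /=.
by move: j; elim/ord3P: i => j; elim/ord3P: j; rewrite /perm3; case: sw; rewrite !inordK.
Qed.

Lemma osum_diag (a b c : C) : osum (diag2 a b) c = dihedral_mx false a b c.
Proof. by rewrite /diag2 osum_seqmx dihedral_mxE. Qed.

Lemma osum_swap (a b c : C) :
  osum (seqmx 2 2 [:: [:: 0; a]; [:: b; 0]]) c = dihedral_mx true a b c.
Proof. by rewrite osum_seqmx dihedral_mxE. Qed.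

Lemma neqN1 : (-1 : C) != 1.
Proof.
apply/eqP => e; have : (1 + 1 : C) == 0 by rewrite -{1}e addNr.
by rewrite -mulr2n pnatr_eq0.
Qed.

Lemma prim_rootN1 : 2.-primitive_root (-1 : C).
Proof.
apply/andP; split=> //; apply/forallP => -[[|[|//]] hi] /=; rewrite unity_rootE.
  by rewrite expr1 (negPf neqN1).
by rewrite sqrrN expr1n !eqxx.
Qed.

Lemma prim_rooti : 4.-primitive_root ('i : C).
Proof.
have i2 : ('i : C) ^+ 2 = -1 := sqrCi C.
have n1 : (-1 : C) != 1 by exact: neqN1.
have i4 : ('i : C) ^+ 4 = 1 by rewrite (exprM _ 2 2) i2 sqrrN expr1n.
have i1 : ('i : C) != 1 by apply: contraNneq n1 => e; rewrite -i2 e expr1n.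
apply/andP; split=> //; apply/forallP => -[[|[|[|[|//]]]] hi] /=; rewrite unity_rootE.
- by rewrite expr1 (negPf i1).
- by rewrite i2 (negPf n1).
- rewrite (_ : (_ == 1) = false) //; apply: contraNF i1 => /eqP e.
  by rewrite -i4 exprS e mulr1.
- by rewrite i4 !eqxx.
Qed.
End SmallMatrices.

Section DihedralCox.
Variables (C : numClosedFieldType) (g1 g2 : 'M[C]_3) (P : 'M[C]_3) (d : bool).
Variables (n N : nat) (a b c a' b' c' r kappa : C) (pP pQ pW pZ : nat).
Local Notation g := (fun t => if t then g1 else g2).
Hypotheses (Pu : P \in unitmx) (N0 : (0 < N)%N) (rp : n.-primitive_root r) (k0 : kappa != 0).
Hypotheses (p4 : all (fun p => p < 4)%N [:: pP; pQ; pW; pZ]) (pu : uniq [:: pP; pQ; pW; pZ]).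
Hypotheses (gd : P *m g d = dihedral_mx false a b c *m P)
           (gs : P *m g (~~ d) = dihedral_mx true a' b' c' *m P).
Hypotheses (abcN : [/\ a ^+ N = 1, b ^+ N = 1 & c ^+ N = 1])
           (abcN' : [/\ a' ^+ N = 1, b' ^+ N = 1 & c' ^+ N = 1]).
Hypotheses (arb : a = r * b) (ab' : a' ^+ n = b' ^+ n).
Variables (m s : nat) (rl : bool -> seq C) (Qn : seq (seq nat)).
Hypothesis m1 : (1 < m)%N.
Local Notation rho := (fun b (i : 'I_s) => nth 1 (rl b) i).
Hypothesis rhom : forall b i, rho b i ^+ m = 1.
Hypothesis rho_prim : forall i, exists b, m.-primitive_root (rho b i) /\
  forall j, j != i -> rho b j = 1.
Local Notation q := (fun t p => \prod_(i < s) rho t i ^+ nth 0%N (nth [::] Qn i) p).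
Hypothesis chi_d : [/\ q d pP = a ^+ n, q d pQ = a ^+ n, q d pW = a * b & q d pZ = c].
Hypothesis chi_s : [/\ q (~~ d) pP = - a' ^+ n, q (~~ d) pQ = a' ^+ n,
  q (~~ d) pW = a' * b' & q (~~ d) pZ = c'].
Hypothesis weights : forall ks, size ks = s -> all (fun k => k < m)%N ks ->
  exists p q, [&& has_weight m s Qn ks p, has_weight m s Qn ks q & separated_exps (fun i j => i != j) p q].

Theorem dihedral_cl_cox : cl_cox_quotient [:: g1; g2] m s
  [seq [seq k%:R | k <- l] | l <- Qn]
  (dihedral_rel n kappa (inord pP) (inord pQ) (inord pW)).
Proof.
have /and4P[hP hQ hW /andP[hZ _]] := p4.
apply: (@dihedral_case C g P d n N a b c a' b' c' r kappa (inord pP) (inord pQ) (inord pW)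
  (inord pZ) Pu N0 rp k0 _ gd gs abcN abcN' arb ab' _ (zm_char (m := m) rho)).
- have -> : [:: inord pP; inord pQ; inord pW; inord pZ] =
      [seq inord p : 'I_4 | p <- [:: pP; pQ; pW; pZ]] by [].
  rewrite map_inj_in_uniq // => x y /(allP p4) x4 /(allP p4) y4 /(congr1 val).
  by rewrite /= !inordK.
- exact: zm_char_neq0.
- exact: zm_charD.
- exact: zm_char_inj.
- by rewrite !zm_char_col // !inordK.
- by rewrite !zm_char_col // !inordK.
- exact: (zm_separated_monomials m1 weights).
Qed.
End DihedralCox.

(** * The individual groups *)

Section Cases.
Variable C : numClosedFieldType.

Lemma signr_root m : ~~ odd m -> (-1 : C) ^+ m = 1.
Proof. by move=> me; rewrite -signr_odd (negPf me). Qed.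

Lemma opp_root (z : C) k : ~~ odd k -> z ^+ k = 1 -> (- z) ^+ k = 1.
Proof. by move=> ke zk; rewrite exprNn signr_root // zk mulr1. Qed.

Lemma i_root k : (4 %| k)%N -> ('i : C) ^+ k = 1.
Proof. exact: expr_dvd (prim_expr_order (prim_rooti C)). Qed.

Definition separating_exps m r Qn D ks (pq : seq nat * seq nat) :=
  [&& has_weight m r Qn ks pq.1, has_weight m r Qn ks pq.2 & separated_exps D pq.1 pq.2].

(** Entry [k] of the table holds the exponents of two monomials of weight [k]; validity of the table
    is a computation. *)
Definition separating_exps1 m Qn D (l : seq (seq nat * seq nat)) :=
  all (fun k => separating_exps m 1 Qn D [:: k] (nth ([::], [::]) l k)) (iota 0 m).

Definition separating_exps2 Qn (l : seq (seq (seq nat * seq nat))) :=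
  all (fun k1 => all (fun k2 => separating_exps 2 2 Qn (fun i j => i != j) [:: k1; k2]
    (nth ([::], [::]) (nth [::] l k1) k2)) (iota 0 2)) (iota 0 2).

Lemma weights1 m Qn D l : separating_exps1 m Qn D l ->
  forall ks, size ks = 1%N -> all (fun k => k < m)%N ks ->
  exists p q, [&& has_weight m 1 Qn ks p, has_weight m 1 Qn ks q & separated_exps D p q].
Proof.
move=> h [|k [|//]] // _ /=; rewrite andbT => km; have := allP h k.
by rewrite mem_iota add0n km => /(_ isT); case: (nth _ _ _) => p q ?; exists p, q.
Qed.

Lemma weights2 Qn l : separating_exps2 Qn l ->
  forall ks, size ks = 2%N -> all (fun k => k < 2)%N ks -> exists p q,
  [&& has_weight 2 2 Qn ks p, has_weight 2 2 Qn ks q & separated_exps (fun i j => i != j) p q].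
Proof.
move=> h [|k1 [|k2 [|//]]] // _ /=; rewrite andbT => /andP[h1 h2].
have := allP h k1; rewrite mem_iota add0n h1 => /(_ isT) /allP /(_ k2).
by rewrite mem_iota add0n h2 => /(_ isT); case: (nth _ _ _) => p q ?; exists p, q.
Qed.

Section StandardDihedral.
Variables (d : bool) (g1 g2 : 'M[C]_3) (n N : nat) (a b c a' b' c' r : C) (pP pQ pW pZ : nat).
Hypotheses (N0 : (0 < N)%N) (rp : n.-primitive_root r).
Hypotheses (p4 : all (fun p => p < 4)%N [:: pP; pQ; pW; pZ]) (pu : uniq [:: pP; pQ; pW; pZ]).
Hypotheses (gd : (if d then g1 else g2) = dihedral_mx false a b c)
           (gs : (if ~~ d then g1 else g2) = dihedral_mx true a' b' c').
Hypotheses (abcN : [/\ a ^+ N = 1, b ^+ N = 1 & c ^+ N = 1])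
           (abcN' : [/\ a' ^+ N = 1, b' ^+ N = 1 & c' ^+ N = 1]).
Hypotheses (arb : a = r * b) (ab' : a' ^+ n = b' ^+ n).
Variables (Qn : seq (seq nat)) (f : {mpoly C[4]}).
Hypothesis fE : f = 4 * 'X_(inord pW) ^+ n + 'X_(inord pP) ^+ 2 - 'X_(inord pQ) ^+ 2.

Lemma dihedral_cl_cox1 m s (rl : bool -> seq C) : (1 < m)%N ->
  (forall t (i : 'I_s), nth 1 (rl t) i ^+ m = 1) ->
  (forall i : 'I_s, exists t, m.-primitive_root (nth 1 (rl t) i) /\
    forall j : 'I_s, j != i -> nth 1 (rl t) j = 1) ->
  let q t p := \prod_(i < s) nth 1 (rl t) i ^+ nth 0%N (nth [::] Qn i) p in
  [/\ q d pP = a ^+ n, q d pQ = a ^+ n, q d pW = a * b & q d pZ = c] ->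
  [/\ q (~~ d) pP = - a' ^+ n, q (~~ d) pQ = a' ^+ n, q (~~ d) pW = a' * b' & q (~~ d) pZ = c'] ->
  (forall ks, size ks = s -> all (fun k => k < m)%N ks -> exists p q,
    [&& has_weight m s Qn ks p, has_weight m s Qn ks q & separated_exps (fun i j => i != j) p q]) ->
  cl_cox_quotient [:: g1; g2] m s [seq [seq k%:R | k <- l] | l <- Qn] f.
Proof.
move=> m1 rhom rho_prim q qd qs weights.
have -> : f = dihedral_rel n 1 (inord pP) (inord pQ) (inord pW).
  by rewrite fE /dihedral_rel expr1n mpolyC1 mul1r.
have gd1 : 1%:M *m (if d then g1 else g2) = dihedral_mx false a b c *m 1%:M.
  by rewrite mul1mx mulmx1.
have gs1 : 1%:M *m (if ~~ d then g1 else g2) = dihedral_mx true a' b' c' *m 1%:M.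
  by rewrite mul1mx mulmx1.
exact: (@dihedral_cl_cox C g1 g2 1%:M d n N a b c a' b' c' r 1 pP pQ pW pZ (unitmx1 _ _) N0 rp
  (oner_neq0 C) p4 pu gd1 gs1 abcN abcN' arb ab' m s rl Qn m1 rhom rho_prim qd qs weights).
Qed.

(** Row 0 of the degree matrix is the sign under the first generator and row 1 the sign under the
    second; the boolean [~~ t] serves as the row number. *)
Lemma dihedral_cl_cox_klein l :
  let q (t : bool) p := (-1) ^+ nth 0%N (nth [::] Qn (~~ t)) p in
  [/\ q d pP = a ^+ n, q d pQ = a ^+ n, q d pW = a * b & q d pZ = c] ->
  [/\ q (~~ d) pP = - a' ^+ n, q (~~ d) pQ = a' ^+ n, q (~~ d) pW = a' * b' & q (~~ d) pZ = c'] ->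
  separating_exps2 Qn l ->
  cl_cox_quotient [:: g1; g2] 2 2 [seq [seq k%:R | k <- l] | l <- Qn] f.
Proof.
move=> q qd qs sep; pose rl t : seq C := if t then [:: -1; 1] else [:: 1; -1].
have qE t p : \prod_(i < 2) nth 1 (rl t) i ^+ nth 0%N (nth [::] Qn i) p = q t p.
  by rewrite !big_ord_recl big_ord0 mulr1; case: t; rewrite /= expr1n ?mulr1 ?mul1r.
apply: (@dihedral_cl_cox1 2 2 rl) => //; rewrite ?qE //; last exact: weights2 sep.
- by case=> [] [[|[|//]] hi]; rewrite /= ?sqrrN expr1n.
- by move=> [[|[|//]] hi]; [exists true|exists false]; split=> [|[[|[|//]] hj]] //; apply: prim_rootN1.
Qed.

(** [u] and [v] are the values of a generating character at the first and second generator; the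
    class group is detected by the second generator. *)
Lemma dihedral_cl_cox_cyclic m (u v : C) l : (1 < m)%N -> u ^+ m = 1 -> m.-primitive_root v ->
  let q (t : bool) p := (if t then u else v) ^+ nth 0%N (nth [::] Qn 0) p in
  [/\ q d pP = a ^+ n, q d pQ = a ^+ n, q d pW = a * b & q d pZ = c] ->
  [/\ q (~~ d) pP = - a' ^+ n, q (~~ d) pQ = a' ^+ n, q (~~ d) pW = a' * b' & q (~~ d) pZ = c'] ->
  separating_exps1 m Qn (fun i j => i != j) l ->
  cl_cox_quotient [:: g1; g2] m 1 [seq [seq k%:R | k <- l] | l <- Qn] f.
Proof.
move=> m1 um vp q qd qs sep; pose rl t : seq C := [:: if t then u else v].
have qE t p : \prod_(i < 1) nth 1 (rl t) i ^+ nth 0%N (nth [::] Qn i) p = q t p.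
  by rewrite big_ord_recl big_ord0 mulr1.
apply: (@dihedral_cl_cox1 m 1 rl) => //; rewrite ?qE //; last exact: weights1 sep.
- by case=> [] [[|//] hi] //=; exact: prim_expr_order.
- by move=> [[|//] hi]; exists false; split=> [|[[|//] hj]].
Qed.
End StandardDihedral.

Let i2 : ('i : C) ^+ 2 = -1 := sqrCi C.
Let signE := (expr0, expr1, expr1n, sqrrN, mulrNN, mulr1, mul1r, @signr_root 4 isT, @signr_root 6 isT,
  @signr_root 10 isT, @signr_root 12 isT).

(** T_1 = xy, T_2 = x^2 - y^2, T_3 = z, T_4 = x^2 + y^2, which are the positions [1 3 0 2]. The
    diagonal generator is listed second, hence [false]. The table gives for each weight two
    monomials without a common variable. The remaining dihedral cases are read in the same way. *)
Lemma class_group_cox_ring_G2 : cl_cox_quotient (gensG2 C) 2 2 [:: [:: 1; 1; 0; 0]; [:: 1; 0; 1; 0]]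
  (4 * T_ 1 ^+ 2 + T_ 2 ^+ 2 - T_ 4 ^+ 2).
Proof.
apply: (@dihedral_cl_cox_klein false _ _ 2 2 1 (-1) (-1) (-1) 1 1 (-1) 1 3 0 2 isT (prim_rootN1 C)
  isT isT (osum_diag _ _ _) (osum_swap _ _ _) _ _ _ _ [:: [:: 1; 1; 0; 0]; [:: 1; 0; 1; 0]]%N _ _
  [:: [:: ([:: 0; 0; 0; 0], [:: 0; 0; 0; 0]); ([:: 0; 0; 1; 0], [:: 1; 1; 0; 0])];
    [:: ([:: 0; 1; 0; 0], [:: 1; 0; 1; 0]); ([:: 1; 0; 0; 0], [:: 0; 1; 1; 0])]]%N) => //.
all: by rewrite /= ?signE.
Qed.

Let iE := (i_root (isT : 4 %| 4)%N, i_root (isT : 4 %| 12)%N,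
  opp_root (isT : ~~ odd 4) (i_root (isT : 4 %| 4)%N),
  opp_root (isT : ~~ odd 12) (i_root (isT : 4 %| 12)%N)).

Lemma class_group_cox_ring_G3 : cl_cox_quotient (gensG3 C) 2 2 [:: [:: 1; 1; 0; 0]; [:: 1; 0; 1; 0]]
  (T_ 1 ^+ 2 - T_ 2 ^+ 2 + 4 * T_ 3 ^+ 2).
Proof.
apply: (@dihedral_cl_cox_klein true _ _ 2 4 'i (- 'i) 1 (-1) 1 1 (-1) 0 1 2 3 isT (prim_rootN1 C)
  isT isT (osum_diag _ _ _) (osum_swap _ _ _) _ _ _ _ [:: [:: 1; 1; 0; 0]; [:: 1; 0; 1; 0]]%N _ _
  [:: [:: ([:: 0; 0; 0; 0], [:: 0; 0; 0; 0]); ([:: 0; 0; 1; 0], [:: 1; 1; 0; 0])];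
    [:: ([:: 0; 1; 0; 0], [:: 1; 0; 1; 0]); ([:: 1; 0; 0; 0], [:: 0; 1; 1; 0])]]%N) => //.
all: rewrite /= ?signE ?iE ?mulrN -?expr2 ?i2 ?mulN1r ?opprK //.
by rewrite [LHS]addrC addrA.
Qed.

Lemma class_group_cox_ring_G4 : cl_cox_quotient (gensG4 C) 2 2 [:: [:: 1; 1; 1; 0]; [:: 1; 0; 0; 1]]
  (T_ 1 ^+ 2 - T_ 3 ^+ 2 + 4 * T_ 4 ^+ 2).
Proof.
apply: (@dihedral_cl_cox_klein true _ _ 2 4 'i (- 'i) (-1) (-1) 1 1 (-1) 0 2 3 1 isT (prim_rootN1 C)
  isT isT (osum_diag _ _ _) (osum_swap _ _ _) _ _ _ _ [:: [:: 1; 1; 1; 0]; [:: 1; 0; 0; 1]]%N _ _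
  [:: [:: ([:: 0; 0; 0; 0], [:: 0; 0; 0; 0]); ([:: 0; 0; 0; 1], [:: 1; 1; 0; 0])];
    [:: ([:: 0; 1; 0; 0], [:: 0; 0; 1; 0]); ([:: 1; 0; 0; 0], [:: 0; 1; 0; 1])]]%N) => //.
all: rewrite /= ?signE ?iE ?mulrN -?expr2 ?i2 ?mulN1r ?opprK //.
by rewrite [LHS]addrC addrA.
Qed.

Lemma class_group_cox_ring_G5 (z : C) (zp : 5.-primitive_root z) :
  cl_cox_quotient (gensG5 z) 2 1 [:: [:: 1; 1; 0; 0]] (4 * T_ 3 ^+ 5 + T_ 2 ^+ 2 - T_ 4 ^+ 2).
Proof.
have z5 := prim_expr_order zp.
(* The ratio of the diagonal entries z and z^4 is z^(-3) = z^2. *)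
have zp2 : 5.-primitive_root (z ^+ 2) by rewrite (prim_root_exp_coprime 2 zp).
apply: (@dihedral_cl_cox_cyclic true _ _ 5 10 z (z ^+ 4) 1 1 1 (-1) (z ^+ 2) 1 3 2 0 isT zp2
  isT isT (osum_diag _ _ _) (osum_swap _ _ _) _ _ _ _ [:: [:: 1; 1; 0; 0]]%N _ _
  2 1 (-1) [:: ([:: 0; 0; 0; 0], [:: 0; 0; 0; 0]); ([:: 1; 0; 0; 0], [:: 0; 1; 0; 0])]%N) => //.
all: rewrite /= -?exprD -?exprM -?exprS ?signE ?(prim_rootN1 C) //.
all: rewrite ?z5 ?(exprM _ 5 2) ?(exprM _ 5 8) ?z5 ?(exprS _ 5) ?z5 ?signE //.
Qed.

Section CubicRoot.
Variable z : C.
Hypothesis zp : 3.-primitive_root z.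
Let z3 : z ^+ 3 = 1 := prim_expr_order zp.
Let a3 : (- z ^+ 2) ^+ 3 = -1.
Proof. by rewrite exprNn -exprM (exprM z 3 2) z3 expr1n mulr1 -signr_odd expr1. Qed.
Let ab1 : - z ^+ 2 * - z = 1. Proof. by rewrite mulrNN -exprSr z3. Qed.
Let abE : - z ^+ 2 = z * - z. Proof. by rewrite mulrN. Qed.
Let sixth k : (6 %| k)%N -> (- z ^+ 2) ^+ k = 1 /\ (- z) ^+ k = 1.
Proof.
move=> k6; have hz : (- z) ^+ 6 = 1 by apply: opp_root => //; apply: expr_dvd z3 _.
split; last exact: expr_dvd hz k6.
by rewrite abE exprMn (expr_dvd hz k6) (@expr_dvd _ 3 _ _ z3) ?mul1r // (dvdn_trans _ k6).
Qed.

Lemma class_group_cox_ring_G6 : cl_cox_quotient (gensG6 z) 2 2 [:: [:: 1; 1; 0; 0]; [:: 1; 0; 1; 0]]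
  (4 * T_ 4 ^+ 3 + T_ 1 ^+ 2 - T_ 2 ^+ 2).
Proof.
have [s1 s2] := @sixth 6 isT.
apply: (@dihedral_cl_cox_klein true _ _ 3 6 (- z ^+ 2) (- z) 1 1 1 (-1) z 0 1 3 2 isT zp
  isT isT (osum_diag _ _ _) (osum_swap _ _ _) _ _ _ _ [:: [:: 1; 1; 0; 0]; [:: 1; 0; 1; 0]]%N _ _
  [:: [:: ([:: 0; 0; 0; 0], [:: 0; 0; 0; 0]); ([:: 0; 0; 1; 0], [:: 1; 1; 0; 0])];
    [:: ([:: 0; 1; 0; 0], [:: 1; 0; 1; 0]); ([:: 1; 0; 0; 0], [:: 0; 1; 1; 0])]]%N) => //.
all: by rewrite /= ?a3 ?ab1 ?signE.
Qed.

Let ni3 : (- 'i : C) ^+ 3 = 'i.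
Proof. by rewrite exprS sqrrN i2 mulrNN mulr1. Qed.
Let iNi : - 'i * - 'i = -1 :> C. Proof. by rewrite mulrNN -expr2. Qed.
Let i3 : ('i : C) ^+ 3 = - 'i. Proof. by rewrite exprS i2 mulrN1. Qed.

(** The characters of BD_3 form a cyclic group of order 4, generated by the one with value -1 at the
    first generator and i at the second. G_9 and G_10 differ only in how z is acted upon. *)
Lemma class_group_cox_ring_G8 : cl_cox_quotient (gensG8 z) 4 1 [:: [:: 3; 1; 2; 0]]
  (4 * T_ 3 ^+ 3 + T_ 1 ^+ 2 - T_ 2 ^+ 2).
Proof.
have [s1 s2] := @sixth 12 isT.
apply: (@dihedral_cl_cox_cyclic true _ _ 3 12 (- z ^+ 2) (- z) 1 (- 'i) (- 'i) 1 z 0 1 2 3 isT zp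
  isT isT (osum_diag _ _ _) (osum_swap _ _ _) _ _ _ _ [:: [:: 3; 1; 2; 0]]%N _ _ 4 (-1) 'i
  [:: ([:: 0; 0; 0; 0], [:: 0; 0; 0; 0]); ([:: 0; 1; 0; 0], [:: 3; 0; 0; 0]);
    ([:: 0; 0; 1; 0], [:: 2; 0; 0; 0]); ([:: 1; 0; 0; 0], [:: 0; 3; 0; 0])]%N) => //.
all: by rewrite /= ?a3 ?ab1 ?ni3 ?i3 ?iNi ?i2 ?iE ?signE ?prim_rooti ?(exprS (-1) 2) ?signE.
Qed.

Lemma class_group_cox_ring_G9 : cl_cox_quotient (gensG9 z) 4 1 [:: [:: 3; 1; 1; 2]]
  (4 * T_ 4 ^+ 3 + T_ 1 ^+ 2 - T_ 3 ^+ 2).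
Proof.
have [s1 s2] := @sixth 12 isT.
apply: (@dihedral_cl_cox_cyclic true _ _ 3 12 (- z ^+ 2) (- z) (-1) (- 'i) (- 'i) 'i z 0 2 3 1 isT zp
  isT isT (osum_diag _ _ _) (osum_swap _ _ _) _ _ _ _ [:: [:: 3; 1; 1; 2]]%N _ _ 4 (-1) 'i
  [:: ([:: 0; 0; 0; 0], [:: 0; 0; 0; 0]); ([:: 0; 1; 0; 0], [:: 0; 0; 1; 0]);
    ([:: 0; 0; 0; 1], [:: 2; 0; 0; 0]); ([:: 1; 0; 0; 0], [:: 0; 3; 0; 0])]%N) => //.
all: by rewrite /= ?a3 ?ab1 ?ni3 ?i3 ?iNi ?i2 ?iE ?signE ?prim_rooti ?(exprS (-1) 2) ?signE.
Qed.

Lemma class_group_cox_ring_G10 : cl_cox_quotient (gensG10 z) 4 1 [:: [:: 3; 1; 2; 2]]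
  (4 * T_ 4 ^+ 3 + T_ 1 ^+ 2 - T_ 2 ^+ 2).
Proof.
have [s1 s2] := @sixth 12 isT.
apply: (@dihedral_cl_cox_cyclic true _ _ 3 12 (- z ^+ 2) (- z) 1 (- 'i) (- 'i) (-1) z 0 1 3 2 isT zp
  isT isT (osum_diag _ _ _) (osum_swap _ _ _) _ _ _ _ [:: [:: 3; 1; 2; 2]]%N _ _ 4 (-1) 'i
  [:: ([:: 0; 0; 0; 0], [:: 0; 0; 0; 0]); ([:: 0; 1; 0; 0], [:: 3; 0; 0; 0]);
    ([:: 0; 0; 1; 0], [:: 0; 0; 0; 1]); ([:: 1; 0; 0; 0], [:: 0; 3; 0; 0])]%N) => //.
all: by rewrite /= ?a3 ?ab1 ?ni3 ?i3 ?iNi ?i2 ?iE ?signE ?prim_rooti ?(exprS (-1) 2) ?signE.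
Qed.
End CubicRoot.
End Cases.

(** * The group G_1 *)

Section CaseS3.
Variables (C : numClosedFieldType) (z : C).
Hypothesis zp : 3.-primitive_root z.

Lemma prim3_eq : z ^+ 2 = - 1 - z.
Proof.
have z3 := prim_expr_order zp; have z1 : z - 1 != 0.
  rewrite subr_eq0; apply/eqP => e; have := prim_order_dvd zp 1.
  by rewrite e expr1n eqxx.
by apply: (mulfI z1); apply/eqP; rewrite -subr_eq0; apply/eqP; ring: z3.
Qed.

(* The first two rows are eigenvectors of the rotation of order 3. *)
Definition s3_coords : 'M[C]_3 :=
  seqmx 3 3 [:: [:: 1; z; 0]; [:: 1; z ^+ 2; 0]; [:: 0; 0; 1]].

Lemma seqmx3_mul (A B : seq (seq C)) i j : (seqmx 3 3 A *m seqmx 3 3 B) i j =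
  (nth [::] A i)`_0 * (nth [::] B 0)`_j + ((nth [::] A i)`_1 * (nth [::] B 1)`_j +
  (nth [::] A i)`_2 * (nth [::] B 2)`_j).
Proof. by rewrite mxE big_ord3 !mxE !inordK. Qed.

Lemma seqmx3_mulE (A B A' B' : seq (seq C)) :
  (forall i j, (i < 3)%N -> (j < 3)%N ->
    (nth [::] A i)`_0 * (nth [::] B 0)`_j + ((nth [::] A i)`_1 * (nth [::] B 1)`_j +
    (nth [::] A i)`_2 * (nth [::] B 2)`_j) =
    (nth [::] A' i)`_0 * (nth [::] B' 0)`_j + ((nth [::] A' i)`_1 * (nth [::] B' 1)`_j +
    (nth [::] A' i)`_2 * (nth [::] B' 2)`_j)) ->
  seqmx 3 3 A *m seqmx 3 3 B = seqmx 3 3 A' *m seqmx 3 3 B'.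
Proof. by move=> h; apply/matrixP => i j; rewrite !seqmx3_mul h. Qed.

Lemma s3_coords_unit : s3_coords \in unitmx.
Proof.
have e := prim3_eq; have z3 := prim_expr_order zp.
(* The inverse scaled by z^2 - z, the determinant of the upper left block. *)
pose B := seqmx 3 3 [:: [:: z ^+ 2; - z; 0]; [:: - 1; 1; 0]; [:: 0; 0; z ^+ 2 - z]].
have d0 : z ^+ 2 - z != 0.
  rewrite subr_eq0; apply/eqP => e2; have := eq_prim_root_expr zp 2 1.
  by rewrite expr1 e2 eqxx.
have : s3_coords *m B = (z ^+ 2 - z)%:M.
  apply/matrixP => i j; rewrite seqmx3_mul mxE.
  move: j; elim/ord3P: i => j; elim/ord3P: j; rewrite -[_ == _ :> 'I_3]val_eqE /= !inordK //=; ring.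
move=> h; have := mulmx1_unit (A := s3_coords) (B := (z ^+ 2 - z)^-1 *: B).
by rewrite -scalemxAr h scale_scalar_mx mulVf // => /(_ erefl)[].
Qed.

Lemma s3_rotation : s3_coords *m osum (seqmx 2 2 [:: [:: 0; -1]; [:: 1; -1]]) 1 =
  dihedral_mx false z (z ^+ 2) 1 *m s3_coords.
Proof.
have e := prim3_eq; have z3 := prim_expr_order zp.
rewrite osum_seqmx dihedral_mxE; apply: seqmx3_mulE => i j.
case: i => [|[|[|//]]] _; case: j => [|[|[|//]]] _ /=; try ring.
all: by ring: e z3.
Qed.

Lemma s3_reflection : s3_coords *m osum (seqmx 2 2 [:: [:: -1; 1]; [:: 0; 1]]) (-1) =
  dihedral_mx true (-1) (-1) (-1) *m s3_coords.
Proof.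
have e := prim3_eq.
rewrite osum_seqmx dihedral_mxE; apply: seqmx3_mulE => i j.
case: i => [|[|[|//]]] _; case: j => [|[|[|//]]] _ /=; try ring.
all: by ring: e.
Qed.

(** In the eigencoordinates u, v of the rotation, T_1 is the third coordinate, T_2 = u^3 + v^3, T_3
    = uv, and T_4 is u^3 - v^3 divided by [kappa]. *)
Lemma class_group_cox_ring_G1 : cl_cox_quotient (gensG1 C) 2 1 [:: [:: 1; 1; 0; 0]]
  (4 * T_ 3 ^+ 3 - T_ 2 ^+ 2 - 27 * T_ 4 ^+ 2).
Proof.
have e := prim3_eq; have z3 := prim_expr_order zp.
(* z - z^2 is a square root of -3, so [kappa] squares to -27, the coefficient of T_4^2 in f. *)
pose kappa := 3 * (z - z ^+ 2).
have k2 : kappa ^+ 2 = -27 by rewrite /kappa; ring: e z3.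
have k0 : kappa != 0.
  by apply/eqP => k0; move: k2 => /eqP; rewrite k0 expr0n eq_sym oppr_eq0 pnatr_eq0.
have z0 : z ^+ 3 = 1 -> z ^+ 6 = 1 by move=> h; rewrite (exprM z 3 2) h expr1n.
(* The ratio of the eigenvalues z and z^2 of the rotation is z^(-1) = z^2. *)
have zp2 : 3.-primitive_root (z ^+ 2) by rewrite (prim_root_exp_coprime 2 zp).
have -> : 4 * T_ 3 ^+ 3 - T_ 2 ^+ 2 - 27 * T_ 4 ^+ 2 =
    dihedral_rel 3 kappa (inord 3) (inord 1) (inord 2) :> {mpoly C[4]}.
  by rewrite /dihedral_rel k2 mpolyCN -(rmorph_nat (@mpolyC 4 C) 27) /T_ /=; ring.
apply: (@dihedral_cl_cox C _ _ s3_coords true 3 6 z (z ^+ 2) 1 (-1) (-1) (-1) (z ^+ 2) kappa 3 1 2 0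
  s3_coords_unit isT zp2 k0 isT isT s3_rotation s3_reflection _ _ _ _ 2 1
  (fun t => if t then [:: 1] else [:: -1]) [:: [:: 1; 1; 0; 0]]%N).
- by split; [exact: z0|rewrite -exprM (exprM z 3 4) z3 expr1n|exact: expr1n].
- by rewrite !signr_root.
- by rewrite -exprD exprS z3 mulr1.
- by [].
- by [].
- by case=> [] [[|//] hi] /=; rewrite ?signr_root ?expr1n.
- by move=> [[|//] hi]; exists false; split=> [|[[|//] hj]] //; apply: prim_rootN1.
- by rewrite !big_ord_recl !big_ord0 /= -?exprS ?z3 ?expr1n ?mulr1.
- rewrite !big_ord_recl !big_ord0 /= !exprS expr0 ?mulr1; split; ring.
- by apply: (@weights1 2 _ _ [:: ([:: 0; 0; 0; 0], [:: 0; 0; 0; 0]);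
    ([:: 1; 0; 0; 0], [:: 0; 1; 0; 0])]%N).
Qed.
End CaseS3.

(** * The group G_7 *)

Section CaseA4.
Variables (C : numClosedFieldType) (z : C).
Hypothesis zp : 3.-primitive_root z.
Local Notation X i := ('X_(inord i) : {mpoly C[4]}).
Local Notation x i := ('X_(inord i) : {mpoly C[3]}).
Local Notation c := (seqmx 3 3 [:: [:: 0; 0; 1]; [:: 1; 0; 0]; [:: 0; 1; 0]] : 'M[C]_3).
Local Notation d := (osum (diag2 (-1) (-1)) 1 : 'M[C]_3).
Local Notation g := (fun t : bool => if t then c else d).

Let z3 : z ^+ 3 = 1 := prim_expr_order zp.
Let z2 : z ^+ 2 = - 1 - z := prim3_eq zp.

Lemma z2_mpolyC m : z%:MP ^+ 2 = - 1 - z%:MP :> {mpoly C[m]}.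
Proof. by rewrite -rmorphXn z2 rmorphB rmorphN1. Qed.

Lemma z3_mpolyC m : z%:MP ^+ 3 = 1 :> {mpoly C[m]}.
Proof. by rewrite -rmorphXn z3 rmorph1. Qed.

(** Rows 0, 2 and 3 are the discrete Fourier transform of x^2, y^2, z^2, which diagonalizes the
    cyclic permutation of the coordinates; row 1 is the invariant xyz. *)
Definition a4_klein_mx : 'M[C]_4 := seqmx 4 4 [:: [:: 1; 1; 1; 0]; [:: 0; 0; 0; 1];
  [:: 1; z ^+ 2; z; 0]; [:: 1; z; z ^+ 2; 0]].
Local Notation to_klein := (lsubst a4_klein_mx).

Lemma to_kleinX : [/\ to_klein (X 0) = X 0 + X 1 + X 2, to_klein (X 1) = X 3,
  to_klein (X 2) = X 0 + z%:MP ^+ 2 * X 1 + z%:MP * X 2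
  & to_klein (X 3) = X 0 + z%:MP * X 1 + z%:MP ^+ 2 * X 2].
Proof.
rewrite !lsubstX !big_ord4 !mxE !inordK //= !scale0r !scale1r ?(addr0, add0r).
by split; rewrite // ?addrA // -!mul_mpolyC rmorphXn.
Qed.

Lemma a4_klein_mx_unit : a4_klein_mx \in unitmx.
Proof.
(* Three times the inverse, given by the inverse Fourier transform. *)
pose B := seqmx 4 4 [:: [:: 1; 0; 1; 1]; [:: 1; 0; z; z ^+ 2]; [:: 1; 0; z ^+ 2; z];
  [:: 0; 3; 0; 0]].
suff e : a4_klein_mx *m B = 3%:M.
  have [] // := mulmx1_unit (A := a4_klein_mx) (B := 3^-1 *: B).
  by rewrite -scalemxAr e scale_scalar_mx mulVf // pnatr_eq0.
apply/matrixP => i j; rewrite mxE big_ord4 !mxE -[i == j]val_eqE /=.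
have W2 := z2; have W3 := z3.
move: j; elim/ord4P: i => j; elim/ord4P: j; rewrite !inordK //=; by ring: W2 W3.
Qed.

Definition a4_rel : {mpoly C[4]} :=
  X 0 ^+ 3 + X 2 ^+ 3 - 3 * X 0 * X 2 * X 3 + X 3 ^+ 3 - 27 * X 1 ^+ 2.

(** a^3 + b^3 + c^3 - 3abc is the product of the three forms a + w b + w^2 c over the cube roots of
    unity w; by Fourier inversion these are 3 times the first three variables, whence the factor
    27. *)
Lemma to_klein_rel : to_klein a4_rel = 27 * (X 0 * X 1 * X 2 - X 3 ^+ 2).
Proof.
have [t0 t1 t2 t3] := to_kleinX.
rewrite /a4_rel !(rmorphB, rmorphD, rmorphM, rmorphXn, rmorph_nat) /= t0 t1 t2 t3.
have := z2_mpolyC 4; have := z3_mpolyC 4.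
move: (z%:MP) (X 0) (X 1) (X 2) (X 3) => w u v s p w3 w2.
ring: w2 w3.
Qed.

Definition a4_pres : {mpoly C[4]} -> {mpoly C[3]} := @klein_map C \o to_klein.
HB.instance Definition _ := GRing.RMorphism.on a4_pres.

Lemma a4_presE p : a4_pres p = klein_map (to_klein p). Proof. by []. Qed.

Lemma a4_presC a : a4_pres a%:MP = a%:MP.
Proof. by rewrite a4_presE lsubstC [LHS]comp_mpolyC. Qed.

Lemma a4_presX : [/\ a4_pres (X 0) = x 0 ^+ 2 + x 1 ^+ 2 + x 2 ^+ 2,
  a4_pres (X 1) = x 0 * x 1 * x 2,
  a4_pres (X 2) = x 0 ^+ 2 + z%:MP ^+ 2 * x 1 ^+ 2 + z%:MP * x 2 ^+ 2
  & a4_pres (X 3) = x 0 ^+ 2 + z%:MP * x 1 ^+ 2 + z%:MP ^+ 2 * x 2 ^+ 2].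
Proof.
have [t0 t1 t2 t3] := to_kleinX; have kC (a : C) : klein_map a%:MP = a%:MP := comp_mpolyC _ _.
have [k0 k1 k2 k3] := And4 (@klein_mapX C 0 isT) (@klein_mapX C 1 isT)
  (@klein_mapX C 2 isT) (@klein_mapX C 3 isT).
rewrite !a4_presE t0 t1 t2 t3 !rmorphD !rmorphM ?rmorphXn /= kC k0 k1 k2 k3.
by split.
Qed.

Lemma a4_pres_rel : a4_pres a4_rel = 0.
Proof.
rewrite a4_presE to_klein_rel rmorphM rmorphB !rmorphM ?rmorphXn /=.
rewrite (@klein_mapX C 0) // (@klein_mapX C 1) // (@klein_mapX C 2) // (@klein_mapX C 3) //=.
ring.
Qed.

Lemma a4_pres_ker p : a4_pres p = 0 -> p \in principal_ideal a4_rel.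
Proof.
rewrite a4_presE => /klein_ker/asboolP[q e]; apply/asboolP.
have h27 := @mpolyC_natV C 4 27 isT.
exists (27^-1%:MP * lsubst (invmx a4_klein_mx) q); apply: (can_inj (lsubstK a4_klein_mx_unit)).
rewrite e [RHS]rmorphM rmorphM /= (lsubstKV a4_klein_mx_unit) lsubstC to_klein_rel.
move: h27; move: (27^-1%:MP) (X 0 * X 1 * X 2 - X 3 ^+ 2) => t w h27.
by transitivity (t * 27 * (q * w)); [rewrite h27 mul1r|ring].
Qed.

Lemma c_subst : [/\ lsubst c (x 0) = x 2, lsubst c (x 1) = x 0 & lsubst c (x 2) = x 1].
Proof.
by rewrite !lsubstX !big_ord3 !mxE !inordK //= !scale1r !scale0r !(addr0, add0r).
Qed.

Lemma d_subst : [/\ lsubst d (x 0) = - x 0, lsubst d (x 1) = - x 1 & lsubst d (x 2) = x 2].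
Proof.
rewrite osum_diag; have [-> -> ->] := dihedral_mx_subst3 false (-1) (-1) (1 : C).
by rewrite mpolyCN mpolyC1 !mulN1r mul1r.
Qed.

Lemma a4_pres_semi j t : lsubst (g t) (a4_pres 'X_j) =
  (if t then z ^+ nth 0%N [:: 0; 0; 2; 1]%N j else 1)%:MP * a4_pres 'X_j.
Proof.
have [p0 p1 p2 p3] := a4_presX; have [c0 c1 c2] := c_subst; have [d0 d1 d2] := d_subst.
have w3 := z3_mpolyC 3.
case: t; elim/ord4P: j; rewrite ?p0 ?p1 ?p2 ?p3 ?inordK //=.
- by rewrite !rmorphD ?rmorphXn /= c0 c1 c2; ring.
- by rewrite !rmorphM /= c0 c1 c2 ?expr0 ?mpolyC1; ring.
- rewrite !rmorphD !rmorphM ?rmorphXn /= lsubstC c0 c1 c2 ?expr1.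
  by move: w3; move: (z%:MP) (x 0) (x 1) (x 2) => w u v s w3; ring: w3.
- rewrite !rmorphD !rmorphM ?rmorphXn /= lsubstC c0 c1 c2 ?expr1.
  by move: w3; move: (z%:MP) (x 0) (x 1) (x 2) => w u v s w3; ring: w3.
- by rewrite !rmorphD ?rmorphXn /= d0 d1 d2 ?mpolyC1; ring.
- by rewrite !rmorphM /= d0 d1 d2 ?mpolyC1; ring.
- by rewrite !rmorphD !rmorphM ?rmorphXn /= lsubstC d0 d1 d2 ?mpolyC1; ring.
- by rewrite !rmorphD !rmorphM ?rmorphXn /= lsubstC d0 d1 d2 ?mpolyC1; ring.
Qed.

Lemma c_mx_unit : c \in unitmx.
Proof.
pose B := seqmx 3 3 [:: [:: 0; 1; 0]; [:: 0; 0; 1]; [:: 1; 0; 0]] : 'M[C]_3.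
suff e : c *m B = 1%:M by have [] := mulmx1_unit e.
apply/matrixP => i j; rewrite seqmx3_mul mxE.
by move: j; elim/ord3P: i => j; elim/ord3P: j; rewrite -[_ == _ :> 'I_3]val_eqE /= !inordK //=; ring.
Qed.

Lemma d_mx_unit : d \in unitmx.
Proof.
by rewrite osum_diag; apply: dihedral_mx_unit; rewrite ?oppr_eq0 oner_neq0.
Qed.

Lemma a4_gen_unit t : g t \in unitmx.
Proof. by case: t; [exact: c_mx_unit|exact: d_mx_unit]. Qed.

Lemma a4_finite : exists L : seq 'M[C]_3, forall h, gen_group [:: g true; g false] h -> h \in L.
Proof.
have n1 := @signr_root C 2 isT.
have mono t : exists s e, (forall j, e j ^+ 2 = 1) /\ 1%:M *m g t = monomial_mx s e *m 1%:M.
  rewrite mul1mx; case: t.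
    exists (fun j : 'I_3 => inord (nth 0%N [:: 1; 2; 0]%N j)), (fun=> 1).
    split=> [j|]; first exact: expr1n.
    apply/matrixP => i j; rewrite mulmx1 !mxE -val_eqE /=.
    by move: j; elim/ord3P: i => j; elim/ord3P: j; rewrite !inordK.
  have [s [e [eN h]]] := dihedral_mx_monomial false n1 n1 (expr1n C 2).
  by exists s, e; rewrite mulmx1 -h osum_diag.
apply: (monomial_group_finite (ltn0Sn 1) (unitmx1 _ _)) => h; rewrite !inE => /orP[|] /eqP ->.
- exact: c_mx_unit.
- exact: d_mx_unit.
- exact: mono true.
- exact: mono false.
Qed.

(** The commutator of the generators is diag(-1, 1, -1), and its conjugate by the cyclic permutation
    is diag(-1, -1, 1). The two generate the Klein four-group. *)
Lemma a4_commutators :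
  d *m c = diag_mx (\row_i nth 0 [:: -1; 1; -1] i) *m (c *m d) /\
  c *m diag_mx (\row_i nth 0 [:: -1; 1; -1] i) = diag_mx (\row_i nth 0 [:: -1; -1; 1] i) *m c.
Proof.
have dE (u v w : C) : diag_mx (\row_i nth 0 [:: u; v; w] i) =
    seqmx 3 3 [:: [:: u; 0; 0]; [:: 0; v; 0]; [:: 0; 0; w]].
  apply/matrixP => i j; rewrite !mxE -val_eqE /=.
  by move: j; elim/ord3P: i => j; elim/ord3P: j; rewrite !inordK.
rewrite osum_diag dihedral_mxE !dE; split; last first.
  by apply: seqmx3_mulE => -[|[|[|//]]] [|[|[|//]]] _ _ /=; ring.
apply/matrixP => i j; rewrite mulmxA seqmx3_mul.
have -> : seqmx 3 3 [:: [:: -1; 0; 0]; [:: 0; 1; 0]; [:: 0; 0; -1]] *m c =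
    seqmx 3 3 [:: [:: 0; 0; -1]; [:: 1; 0; 0]; [:: 0; -1; 0]].
  apply/matrixP => k l; rewrite seqmx3_mul mxE.
  by move: l; elim/ord3P: k => l; elim/ord3P: l; rewrite !inordK //=; ring.
rewrite seqmx3_mul.
by move: j; elim/ord3P: i => j; elim/ord3P: j; rewrite !inordK //=; ring.
Qed.

(** Commutation on [s] makes [s] fixed by the commutator; commutation on [lsubst c s] makes [s]
    fixed by the conjugate of the commutator. So [s] is invariant under the Klein four-group. *)
Lemma a4_pres_onto s : lsubst c (lsubst d s) = lsubst d (lsubst c s) ->
  (forall t, lsubst c (lsubst d (lsubst (g t) s)) = lsubst d (lsubst c (lsubst (g t) s))) ->
  exists p, a4_pres p = s.
Proof.
have [e1 e2] := a4_commutators; have cu := c_mx_unit; have du := d_mx_unit.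
have cdu : c *m d \in unitmx by rewrite unitmx_mul cu.
have fixed u : lsubst c (lsubst d u) = lsubst d (lsubst c u) ->
    lsubst (diag_mx (\row_i nth 0 [:: -1; 1; -1] i)) u = u.
  rewrite -!lsubstM e1 [LHS]lsubstM => h; exact: (can_inj (lsubstK cdu) h).
move=> /fixed h1 /(_ true)/= /fixed; rewrite -lsubstM e2 lsubstM => h2.
have {}h2 := can_inj (lsubstK cu) h2.
have N1 i : (-1 : C) ^+ i = 1 -> ~~ odd i.
  by rewrite -signr_odd; case: (odd i) => //= /eqP; rewrite (negPf (neqN1 C)).
have [p <-] : exists p, klein_map p = s.
  apply: klein_onto => m ms.
  have := lsubst_diag_fixed h1 ms; have := lsubst_diag_fixed h2 ms.
  (* The exponents of x and z, and those of x and y, have even sum, so all three exponents share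
     their parity. *)
  rewrite !big_ord3 !mxE !inordK //= !expr1n !mulr1 !mul1r -!exprD => /N1 o1 /N1 o2.
  by rewrite !modn2; move: o1 o2; rewrite !oddD; do 3 case: (odd _).
by exists (lsubst (invmx a4_klein_mx) p); rewrite a4_presE (lsubstKV a4_klein_mx_unit).
Qed.

(** A common prime [q] divides two combinations of T_3 and T_4, namely y^2 - z^2 and x^2 - z^2 up to
    constants. So it divides y - a z and x - b z for some signs a and b, and these are linear forms
    that are not proportional. *)
Lemma a4_pres_coprime : coprime_elt (a4_pres (X 2)) (a4_pres (X 3)).
Proof.
have [_ _ -> ->] := a4_presX => q qp q2 q3.
have z1 : z - z ^+ 2 != 0.
  rewrite subr_eq0; apply/eqP => e; have := eq_prim_root_expr zp 1 2.
  by rewrite expr1 -e eqxx.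
have unit_dvM (a : C) (s : {mpoly C[3]}) : a != 0 -> dv q (a%:MP * s) -> dv q s.
  move=> a0 [w e]; exists (a^-1%:MP * w).
  by rewrite -mulrA -e mulrA -mpolyCM mulVf // mpolyC1 mul1r.
have h1 : dv q ((x 1 - x 2) * (x 1 + x 2)).
  apply: (unit_dvM _ _ z1); have := dvB q3 q2.
  set u := (Y in dv q Y -> _); set v := (Y in _ -> dv q Y); suff -> : u = v by [].
  by rewrite /u /v rmorphB rmorphXn /=; ring.
have h2 : dv q ((x 0 - x 2) * (x 0 + x 2)).
  apply: (unit_dvM _ _ z1); have := dvB (dv_mull z%:MP q2) (dv_mull (z%:MP ^+ 2) q3).
  set u := (Y in dv q Y -> _); set v := (Y in _ -> dv q Y); suff -> : u = v by [].
  rewrite /u /v rmorphB rmorphXn /=; have := z3_mpolyC 3.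
  by move: (z%:MP) (x 0) (x 1) (x 2) => w a b s w3; ring: w3.
have pm (a b : {mpoly C[3]}) : dv q ((a - b) * (a + b)) ->
    exists2 e : C, e = 1 \/ e = -1 & dv q (a - e%:MP * b).
  move=> /(prime_dvM qp)[h|h]; [exists 1|exists (-1)]; [by left| |by right|].
    by rewrite mpolyC1 mul1r.
  by rewrite mpolyCN mpolyC1 mulN1r opprK.
have [a ha qa] := pm _ _ h1; have [b hb qb] := pm _ _ h2.
have vX (u0 u1 u2 : C) l : (l < 3)%N ->
    (x l).@[fun i : 'I_3 => nth 0 [:: u0; u1; u2] i] = nth 0 [:: u0; u1; u2] l.
  by move=> l3; rewrite mevalXU inordK.
have d0 : x 1 - a%:MP * x 2 != 0.
  apply/eqP => e0; have := congr1 (meval (fun i : 'I_3 => nth 0 [:: 0; 1; 0] i)) e0.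
  rewrite mevalB mevalM mevalC !vX //= mulr0 subr0 meval0 => /eqP.
  by rewrite oner_eq0.
have sd : (msize (x 1 - a%:MP * x 2) <= 2)%N.
  apply: leq_trans (msizeD_le _ _) _; rewrite geq_max msizeX mdeg1 /= msizeN.
  by rewrite mul_mpolyC (leq_trans (msizeZ_le _ _)) // msizeX mdeg1.
(* At (b + 1, a, 1) the form y - a z vanishes while x - b z is 1. *)
have := prime_dv_linear (v := fun i : 'I_3 => nth 0 [:: b + 1; a; 1] i) qp d0 sd qa qb.
rewrite !mevalB !mevalM !mevalC !vX //= !mulr1 subrr [b + 1]addrC addrK => /(_ erefl) /eqP.
by rewrite oner_eq0.
Qed.

Lemma a4_char t (i : 'I_1) : nth 1 (if t then [:: z] else [:: 1]) i ^+ 3 = 1.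
Proof. by case: t; case: i => [[|//] hi] /=; rewrite ?expr1n. Qed.

Lemma a4_char_prim (i : 'I_1) : exists t, 3.-primitive_root (nth 1 (if t then [:: z] else [:: 1]) i) /\
  forall j : 'I_1, j != i -> nth 1 (if t then [:: z] else [:: 1]) j = 1.
Proof. by case: i => [[|//] hi]; exists true; split=> [|[[|//] hj]]. Qed.

Lemma class_group_cox_ring_G7 : cl_cox_quotient (gensG7 C) 3 1 [:: [:: 0; 0; 2; 1]]
  (T_ 1 ^+ 3 + T_ 3 ^+ 3 - 3 * T_ 1 * T_ 3 * T_ 4 + T_ 4 ^+ 3 - 27 * T_ 2 ^+ 2).
Proof.
have [L GL] := a4_finite.
apply: (@matrix_class_group_and_cox_ring C 2 g a4_gen_unit L GL 'cV['Z_3]_1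
  (zm_char (m := 3) (fun t (i : 'I_1) => nth 1 (if t then [:: z] else [:: 1]) i)) _ _ _ 4 _
  a4_rel a4_pres).
- by apply: zm_char_neq0 => //; apply: a4_char.
- by apply: zm_charD => //; apply: a4_char.
- by apply: zm_char_inj => //; [apply: a4_char|apply: a4_char_prim].
- exact: a4_presC.
- exact: a4_pres_rel.
- move=> j t; rewrite a4_pres_semi; congr (_%:MP * _).
  rewrite [RHS](@zm_char_col C 3 1 _ isT a4_char [:: [:: 0; 0; 2; 1]]%N).
  by rewrite big_ord_recl big_ord0 mulr1 /=; case: t; rewrite ?expr1n.
- exact: a4_pres_ker.
- exact: a4_pres_onto.
move=> w q qp.
(* Weight 1 is attained by T_4 and T_3^2, weight 2 by T_3 and T_4^2, weight 0 by 1, so coprimality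
   of T_3 and T_4 suffices. *)
have wts : forall ks, size ks = 1%N -> all (fun k => k < 3)%N ks -> exists p p',
    [&& has_weight 3 1 [:: [:: 0; 0; 2; 1]]%N ks p, has_weight 3 1 [:: [:: 0; 0; 2; 1]]%N ks p'
      & separated_exps (fun i j => [&& i != j, 1 < i & 1 < j])%N p p'].
  by apply: (@weights1 3 _ _ [:: ([:: 0; 0; 0; 0], [:: 0; 0; 0; 0]);
    ([:: 0; 0; 0; 1], [:: 0; 0; 2; 0]); ([:: 0; 0; 1; 0], [:: 0; 0; 0; 2])]%N).
have [m1 [m2 [w1 w2 sep]]] := zm_separated_monomials (isT : (1 < 3)%N) wts w.
have [h1|h1] := pselect (dv q (a4_pres 'X_[m1])); last by exists m1.
exists m2 => //; apply: coprime_monomials qp h1 => i j mi mj.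
have := sep i j mi mj; elim/ord4P: i {mi}; elim/ord4P: j {mj}; rewrite !inordK //= => _.
  exact: a4_pres_coprime.
by move=> p pp p3 p2; apply: a4_pres_coprime pp p2 p3.
Qed.
End CaseA4.


Theorem proposition4p3 (R : realType) (zeta3 zeta5 : R[i])
    (hzeta3 : 3.-primitive_root zeta3) (hzeta5 : 5.-primitive_root zeta5) :
  cl_cox_quotient (gensG1 R[i]) 2 1
    [:: [:: 1; 1; 0; 0]]
    (4 * T_ 3 ^+ 3 - T_ 2 ^+ 2 - 27 * T_ 4 ^+ 2) /\
  cl_cox_quotient (gensG2 R[i]) 2 2
    [:: [:: 1; 1; 0; 0];
        [:: 1; 0; 1; 0]]
    (4 * T_ 1 ^+ 2 + T_ 2 ^+ 2 - T_ 4 ^+ 2) /\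
  cl_cox_quotient (gensG3 R[i]) 2 2
    [:: [:: 1; 1; 0; 0];
        [:: 1; 0; 1; 0]]
    (T_ 1 ^+ 2 - T_ 2 ^+ 2 + 4 * T_ 3 ^+ 2) /\
  cl_cox_quotient (gensG4 R[i]) 2 2
    [:: [:: 1; 1; 1; 0];
        [:: 1; 0; 0; 1]]
    (T_ 1 ^+ 2 - T_ 3 ^+ 2 + 4 * T_ 4 ^+ 2) /\
  cl_cox_quotient (gensG5 zeta5) 2 1
    [:: [:: 1; 1; 0; 0]]
    (4 * T_ 3 ^+ 5 + T_ 2 ^+ 2 - T_ 4 ^+ 2) /\
  cl_cox_quotient (gensG6 zeta3) 2 2
    [:: [:: 1; 1; 0; 0];
        [:: 1; 0; 1; 0]]
    (4 * T_ 4 ^+ 3 + T_ 1 ^+ 2 - T_ 2 ^+ 2) /\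
  cl_cox_quotient (gensG7 R[i]) 3 1
    [:: [:: 0; 0; 2; 1]]
    (T_ 1 ^+ 3 + T_ 3 ^+ 3 - 3 * T_ 1 * T_ 3 * T_ 4 + T_ 4 ^+ 3
       - 27 * T_ 2 ^+ 2) /\
  cl_cox_quotient (gensG8 zeta3) 4 1
    [:: [:: 3; 1; 2; 0]]
    (4 * T_ 3 ^+ 3 + T_ 1 ^+ 2 - T_ 2 ^+ 2) /\
  cl_cox_quotient (gensG9 zeta3) 4 1
    [:: [:: 3; 1; 1; 2]]
    (4 * T_ 4 ^+ 3 + T_ 1 ^+ 2 - T_ 3 ^+ 2) /\
  cl_cox_quotient (gensG10 zeta3) 4 1
    [:: [:: 3; 1; 2; 2]]
    (4 * T_ 4 ^+ 3 + T_ 1 ^+ 2 - T_ 2 ^+ 2).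
Proof.
split; first exact: class_group_cox_ring_G1 hzeta3.
split; first exact: class_group_cox_ring_G2.
split; first exact: class_group_cox_ring_G3.
split; first exact: class_group_cox_ring_G4.
split; first exact: class_group_cox_ring_G5 hzeta5.
split; first exact: class_group_cox_ring_G6 hzeta3.
split; first exact: class_group_cox_ring_G7 hzeta3.
split; first exact: class_group_cox_ring_G8 hzeta3.
split; first exact: class_group_cox_ring_G9 hzeta3.
exact: class_group_cox_ring_G10 hzeta3.
Qed.
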